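(* Let $(X_n)_{n\in\mathbb{Z}}$ be a strictly stationary real-valued process which is arithmetically $\beta$-mixing with rate $\theta>2$, i.e. $\beta_k\le (1+k)^{-(1+\theta)}$ for all $k\in\mathbb{N}$. Assume that its marginal distribution $P$ admits a density $s$ with respect to the Lebesgue measure $\mu$ on $\mathbb{R}$, with $s\in L^2(\mu)$ and $s$ supported in $[0,1]$. For each $n\ge 2$ let $(S_m)_{m\in\mathcal{M}_n}$ be a (non-empty) collection of models satisfying assumptions $[M_1]$, $[M_2]$ and $[M_3]$ (stated in the context), with a constant $\Phi$ in $[M_2]$ not depending on $n$. Let $\kappa_1=\sum_{l=0}^\infty \beta_l$, let $K>4$, and let $\tilde s$ be the penalized least-squares estimator built from $X_1,\dots,X_n$ with penalty $$\mathrm{pen}(m)=\frac{K\Phi^2\kappa_1 D_m}{n},\qquad m\in\mathcal{M}_n .$$ Then, for all $\kappa>2$, there exist $c_0>0$, $L_s>0$, $\gamma_1>0$ and a sequence $\epsilon_n\to 0$ such that, for all $n\geq 2$, $$\mathbb{P}\left(\|\tilde s-s\|_2^2>(1+\epsilon_n)\inf_{m\in\mathcal{M}_n,\ D_m\ge c_0(\log n)^{\gamma_1}}\left(\|s-s_m\|_2^2+\mathrm{pen}(m)\right)\right)\le L_s\,\frac{(\log n)^{(\theta+2)\kappa}}{n^{\theta/2}} .$$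
   Context: $\|\cdot\|_p$ is the usual norm on $L^p(\mu)$, where $\mu$ is the Lebesgue measure on $\mathbb{R}$. $\beta$-mixing coefficients. For a $\sigma$-algebra $\mathcal{G}$ and a random variable $Y$ (possibly vector- or sequence-valued), $\beta(\mathcal{G},\sigma(Y))=\mathbb{E}\left(\sup_{A}|\mathbb{P}_{Y|\mathcal{G}}(A)-\mathbb{P}_Y(A)|\right)$, where the supremum is over measurable sets $A$, $\mathbb{P}_{Y|\mathcal{G}}$ is the conditional law of $Y$ given $\mathcal{G}$ and $\mathbb{P}_Y$ is the law of $Y$. For the stationary process, $\beta_k=\beta(\sigma(X_i,i\le 0),\sigma(X_i,i\ge k))$ for $k\ge1$, and $\beta_0=1$ by convention. Models. $\{\psi_{j,k}\}_{(j,k)\in\Lambda}$ is an orthonormal system of $L^2(\mu)$; models are indexed by subsets $m\subset\Lambda$. Assumptions: - $[M_1]$: for all $m\in\mathcal{M}_n$, $S_m$ is the linear span of $\{\psi_{j,k}\}_{(j,k)\in m}$, of finite dimension $D_m=|m|\ge2$, and $\max_{m\in\mathcal{M}_n}D_m\le n$. - $[M_2]$: there is a constant $\Phi$ such that for all $m,m'\in\mathcal{M}_n$, $t\in S_m$, $t'\in S_{m'}$: $\|t+t'\|_\infty\le\Phi\sqrt{\dim(S_m+S_{m'})}\,\|t+t'\|_2$. - $[M_3]$: for $m,m'\in\mathcal{M}_n$, $D_m\le D_{m'}$ implies $m\subset m'$ (hence $S_m\subset S_{m'}$). $s_m$ denotes the orthogonal projection of $s$ onto $S_m$ in $L^2(\mu)$.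 Estimator. For $t\in S_m$ put $\gamma_n(t)=\|t\|_2^2-\frac2n\sum_{i=1}^n t(X_i)$. The projection estimator $\hat s_m$ is the minimizer of $\gamma_n$ over $S_m$, i.e. $\hat s_m=\sum_{(j,k)\in m}\left(\frac1n\sum_{i=1}^n\psi_{j,k}(X_i)\right)\psi_{j,k}$. Given $\mathrm{pen}:\mathcal{M}_n\to\mathbb{R}^+$, the selected model $\hat m$ is any element of $\arg\min_{m\in\mathcal{M}_n}\left(\gamma_n(\hat s_m)+\mathrm{pen}(m)\right)$, and the penalized least-squares estimator is any $\tilde s\in S_{\hat m}$ with $\gamma_n(\tilde s)+\mathrm{pen}(\hat m)=\inf_{m\in\mathcal{M}_n}\left(\gamma_n(\hat s_m)+\mathrm{pen}(m)\right)$ (so $\tilde s=\hat s_{\hat m}$). The quantities $c_0,L_s,\gamma_1,(\epsilon_n)$ do not depend on $n$ (other than through the index of $\epsilon_n$); they may depend on the other data of the problem, in particular on $s$. The infimum over an empty set is $+\infty$. *)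

(* Defs.v *)
From HB Require Import structures.
From mathcomp Require Import all_boot all_order all_algebra finmap.
From mathcomp Require Import all_classical all_reals all_analysis.

Set Implicit Arguments.
Unset Strict Implicit.
Unset Printing Implicit Defensive.
Import Order.TTheory GRing.Theory Num.Theory.
Import numFieldNormedType.Exports.

Local Open Scope classical_set_scope.
Local Open Scope ring_scope.

(* A class generating sigma(X_i, i in D). *)
Definition gen_events (R : realType) (I Om : Type) (X : I -> Om -> R)
    (D : set I) : set (set Om) :=
  \bigcup_(i in D) preimage_set_system [set: Om] (X i) measurable.

(* R^I with its product sigma-algebra, generated by the coordinates. *)
Definition path_space (R : realType) (I : Type) :=
  g_sigma_algebraType
    (gen_events (fun (i : I) (x : I -> R) => x i) [set: I]).

Definition strictly_stationary (R : realType) (d : measure_display)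
    (Om : measurableType d) (P : probability Om R)
    (X : int -> {RV P >-> R}) : Prop :=
  forall (h : int) (A : set (path_space R int)), measurable A ->
    P [set w | A (fun i => X (i + h) w)] = P [set w | A (fun i => X i w)].

(* k is a regular version of the conditional law of Y given <<s G >>. *)
Definition is_cond_law (R : realType) (d d' : measure_display)
    (Om : measurableType d) (P : probability Om R) (G : set (set Om))
    (T : measurableType d') (Y : Om -> T)
    (k : R.-pker (g_sigma_algebraType G) ~> T) : Prop :=
  forall (A : set T) (B : set Om), measurable A -> <<s G >> B ->
    (\int[P]_(w in B) k w A)%E = P (B `&` Y @^-1` A).

(* beta(<<s G >>, sigma(Y)).  The infimum ranges over the versions of the
   conditional law; when the sigma-algebra of T is countably generated, two
   versions agree almost surely, so that all of them give the same value, and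
   when T is standard Borel (as is path_space R nat) there is one. *)
Definition beta_coef (R : realType) (d d' : measure_display)
    (Om : measurableType d) (P : probability Om R) (G : set (set Om))
    (T : measurableType d') (Y : Om -> T) : \bar R :=
  ereal_inf [set b | exists2 k : R.-pker (g_sigma_algebraType G) ~> T,
    is_cond_law P Y k &
    b = (\int[P]_w ereal_sup
           [set `|k w A - P (Y @^-1` A)| | A in measurable])%E].

Definition beta_mixing (R : realType) (d : measure_display)
    (Om : measurableType d) (P : probability Om R)
    (X : int -> {RV P >-> R}) (k : nat) : \bar R :=
  if k == 0%N then 1%E
  else beta_coef P (gen_events (fun i w => X i w) [set i : int | i <= 0])
         (fun w => (fun j : nat => X (k%:Z + j%:Z) w) : path_space R nat).

Definition arithmetically_beta_mixing (R : realType) (d : measure_display)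
    (Om : measurableType d) (P : probability Om R)
    (X : int -> {RV P >-> R}) (theta : R) : Prop :=
  forall k : nat, (beta_mixing X k <= ((1 + k%:R) `^ (- (1 + theta)))%:E)%E.

Definition kappa1 (R : realType) (d : measure_display)
    (Om : measurableType d) (P : probability Om R)
    (X : int -> {RV P >-> R}) : R :=
  fine (\sum_(0 <= l <oo) beta_mixing X l)%E.

(* ||t||_p in L^p(mu), mu the Lebesgue measure on R. *)
Definition Lpnorm (R : realType) (p : \bar R) (t : R -> R) : \bar R :=
  ('N[lebesgue_measure]_p[EFin \o t])%E.

Definition dotL2 (R : realType) (t u : R -> R) : R :=
  \int[lebesgue_measure]_x (t x * u x).

Definition orthonormal_system (R : realType) (L : choiceType)
    (psi : L -> R -> R) : Prop :=
  (forall l, psi l \in Lfun (@lebesgue_measure R) 2%:E) /\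
  (forall l l', dotL2 (psi l) (psi l') = (l == l')%:R).

Definition model (R : realType) (L : choiceType) (psi : L -> R -> R)
    (m : {fset L}) : set (R -> R) :=
  [set t | exists a : L -> R, t = fun x => \sum_(l <- m) a l * psi l x].

Definition model_dim (L : choiceType) (m : {fset L}) : nat := #|` m|.

Definition subspace_sum (R : realType) (V W : set (R -> R)) : set (R -> R) :=
  [set t \+ u | t in V & u in W].

(* V is a vector space of functions of dimension D. *)
Definition has_dim (R : realType) (V : set (R -> R)) (D : nat) : Prop :=
  exists b : 'I_D -> R -> R,
    (forall a : 'I_D -> R,
       (forall x, \sum_(i < D) a i * b i x = 0) -> forall i, a i = 0) /\
    V = [set t | exists a : 'I_D -> R,
                   t = fun x => \sum_(i < D) a i * b i x].

Definition assumption_M1 (L : choiceType) (n : nat) (M : set {fset L}) : Prop :=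
  forall m, M m -> (2 <= model_dim m <= n)%N.

Definition assumption_M2 (R : realType) (L : choiceType) (psi : L -> R -> R)
    (Phi : R) (M : set {fset L}) : Prop :=
  forall m m', M m -> M m' ->
  forall t t', model psi m t -> model psi m' t' ->
  forall D, has_dim (subspace_sum (model psi m) (model psi m')) D ->
    (Lpnorm +oo (t \+ t')%R <=
       (Phi * Num.sqrt D%:R)%:E * Lpnorm 2%:E (t \+ t')%R)%E.

Definition assumption_M3 (L : choiceType) (M : set {fset L}) : Prop :=
  forall m m', M m -> M m' -> (model_dim m <= model_dim m')%N ->
    (m `<=` m')%fset.

(* t is the orthogonal projection of s onto V in L^2(mu). *)
Definition is_orth_proj (R : realType) (V : set (R -> R)) (s t : R -> R) :
    Prop :=
  V t /\ forall u, V u -> dotL2 (s \- t) u = 0.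

(* In the three definitions below, x i stands for the observation X_i; only
   x 1, ..., x n are used. *)
Definition contrast (R : realType) (x : int -> R) (n : nat) (t : R -> R) : R :=
  fine (Lpnorm 2%:E t) ^+ 2 - 2 / n%:R * \sum_(1 <= i < n.+1) t (x i%:Z).

Definition proj_estimator (R : realType) (L : choiceType) (psi : L -> R -> R)
    (x : int -> R) (n : nat) (m : {fset L}) : R -> R :=
  fun y => \sum_(l <- m)
    (n%:R^-1 * \sum_(1 <= i < n.+1) psi l (x i%:Z)) * psi l y.

(* m is a selected model and t a penalized least-squares estimator in S_m. *)
Definition is_pen_ls_estimator (R : realType) (L : choiceType)
    (psi : L -> R -> R) (M : set {fset L}) (pen : {fset L} -> R)
    (x : int -> R) (n : nat) (m : {fset L}) (t : R -> R) : Prop :=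
  let crit m' := contrast x n (proj_estimator psi x n m') + pen m' in
  [/\ M m,
      forall m', M m' -> crit m <= crit m',
      model psi m t &
      (contrast x n t + pen m)%:E = ereal_inf [set (crit m')%:E | m' in M]].

Definition penalty (R : realType) (L : choiceType) (K Phi kappa1 : R)
    (n : nat) (m : {fset L}) : R :=
  K * Phi ^+ 2 * kappa1 * (model_dim m)%:R / n%:R.

(* Infimum of ||s - s_m||_2^2 + pen(m) over the m in M with D_m >= c. *)
Definition oracle_risk (R : realType) (L : choiceType) (psi : L -> R -> R)
    (M : set {fset L}) (pen : {fset L} -> R) (s : R -> R) (c : R) : \bar R :=
  ereal_inf [set r | exists m, exists sm : R -> R,
    [/\ M m, c <= (model_dim m)%:R, is_orth_proj (model psi m) s sm &
        r = (Lpnorm 2%:E (s \- sm)%R ^+ 2 + (pen m)%:E)%E]].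

(* Main.v *)
Require Import Defs.
From HB Require Import structures.
From mathcomp Require Import all_boot all_order all_algebra finmap.
From mathcomp Require Import all_classical all_reals all_analysis.
From mathcomp Require Import measurable_realfun ess_sup_inf.
From mathcomp Require Import ring lra zify.

Set Implicit Arguments.
Unset Strict Implicit.
Unset Printing Implicit Defensive.
Import Order.TTheory GRing.Theory Num.Theory.
Import numFieldNormedType.Exports.

Local Open Scope classical_set_scope.
Local Open Scope ring_scope.

(* Let nu be the vector of errors of the empirical coefficients and F = Phi^2/n.
   By the penalized criterion, if the models are nested and K > 4, the oracle
   inequality holds on any event where, for every model m of dimension D,
   |nu_m|^2 <= 1.96 F D + o(1) F (D + ell^16), and where every cross term
   <s_m' - s_m, nu> is o(1) |s_m' - s_m| sqrt(F (D' + ell^16)), with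
   ell = log n; the o(1) terms are negative powers of ell, and ell^16 <= D on the
   oracle models.

   The time interval is cut into periods of length 900 h, each split into a long
   part 899 h and a short gap h, with h about sqrt n / ell^kappa. beta-mixing
   compares the law of (past, future) with the product of the marginals, with an
   error beta_h for each test function bounded by 1. Applied block by block to
   min(1, sum_t exp(lambda_t |S_t|^2 + a_t)), where S_t is the sum of the vector t
   over the blocks, it yields an exponential bound and a total error (n/h) beta_h,
   which gives the rate of the theorem. The same applies to the short parts,
   whose contribution is small.

   The strong variance of a block is at most its length times
   Phi^2 D (1 + 4 sum_l (1+l)^(-1-theta)) <= (11/6) Phi^2 D, because theta > 2
   (the sum starts at l = 1), while 4 Phi^2 D is below the penalty since
   kappa_1 >= 1. The weak variance is of order sqrt D, by s in L^2, [M_2] and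
   summability of the square roots of the mixing rates; this is negligible with
   respect to D + ell^16. *)

(** * Mixing of the path law *)

(** The block length is squeezed from two sides. The total mixing error is about n h^-(2+theta), and
    h = sqrt n / ell^kappa turns it into n^(-theta/2) ell^((theta+2) kappa). On the other hand, expR
    (lam |S|^2) can be expanded along one more block only while lam |S| |block| stays bounded; with
    lam of order ell^2 / (n W), where W bounds one squared observation, blocks must be shorter than
    sqrt n / ell^2 up to a constant, whence kappa > 2. The cap at 1 makes an exponential moment an
    admissible test function for mixing. Summing over the models before capping lets one mixing
    error per block serve all of them; a union bound afterwards would multiply this error, already
    of the size of the final rate, by powers of n. Twice the variance constant must stay below 4.
    Two equal parts would lose a factor 2; with proportions 899 to 1 the loss is (1 + 1/30)^2, and 2
    * 1.96 < 4. The o(1) terms are eta = ell^(-1/4) and del = eta^2: a deviation of relative size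
    del has an exponent of order del ell^2 = ell^(3/2), which beats every multiple of log n. *)

Lemma ge0_le_integral_nonmeas (R : realType) (d : measure_display)
    (T : measurableType d) (mu : {measure set T -> \bar R}) (f g : T -> \bar R) :
  (forall x, 0 <= f x)%E -> (forall x, f x <= g x)%E ->
  (\int[mu]_x f x <= \int[mu]_x g x)%E.
Proof.
move=> f0 fg.
have g0 x : (0 <= g x)%E by exact: le_trans (fg x).
(* The integral of a nonnegative function is a supremum over the simple functions below it, hence
   monotone without measurability; the supremum over sets in [beta_coef] is not known to be
   measurable. *)
rewrite !ge0_integralTE //; apply: ge_ereal_sup => _ [h hf <-].
apply: ereal_sup_ubound; exists h => //= x; exact: le_trans (fg x).
Qed.

Lemma integral_cst_probability (R : realType) (d : measure_display)
    (T : measurableType d) (P : probability T R) (c : \bar R) :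
  (\int[P]_x c = c)%E.
Proof.
rewrite integral_cst//; transitivity (c * 1)%E; last by rewrite mule1.
by congr (_ * _)%E; exact: probability_setT.
Qed.

Section conditional_law.
Context (R : realType) (d d' : measure_display) (Om : measurableType d)
  (P : probability Om R) (G : set (set Om)) (T : measurableType d')
  (Y : Om -> T).
Hypothesis G_meas : G `<=` measurable.
Hypothesis mY : measurable_fun setT Y.

Local Notation GT := (g_sigma_algebraType G).

Lemma gen_sub_measurable (A : set Om) : <<s G >> A -> measurable A.
Proof.
move=> GA; have : <<s G >> `<=` @measurable _ Om.
  by apply: smallest_sub => //; exact: sigma_algebra_measurable.
exact.
Qed.

Lemma measurable_fun_coarser d1 (U : measurableType d1) (f : Om -> U) :
  measurable_fun [set: GT] (f : GT -> U) -> measurable_fun [set: Om] f.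
Proof.
move=> mf _ A mA; apply: gen_sub_measurable.
exact: (mf measurableT A mA).
Qed.

Lemma measurable_pair_coarser :
  measurable_fun [set: Om] (fun w => (w, Y w) : GT * T).
Proof.
apply: measurable_fun_pair => //= _ A mA.
by rewrite setTI; exact: gen_sub_measurable.
Qed.

Variable k : R.-pker GT ~> T.
Hypothesis kP : is_cond_law P Y k.

Lemma kernel_xsection_le1 (C : set (GT * T)) (w : GT) : measurable C ->
  (k w (xsection C w) <= 1)%E.
Proof.
move=> mC; rewrite -(prob_kernel (s:=k) w) le_measure ?inE//.
exact: measurable_xsection.
Qed.

Lemma measurable_kernel_xsection (C : set (GT * T)) : measurable C ->
  measurable_fun [set: Om] (fun w => k w (xsection C w)).
Proof.
move=> mC; apply: measurable_fun_coarser.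
by apply: measurable_fun_xsection_finite_kernel; rewrite inE.
Qed.

(** [is_cond_law] is the case of rectangles, which are stable under intersection and generate the
    product; Dynkin's argument extends it to events that entangle past and future. *)
Lemma disintegration (C : set (GT * T)) : measurable C ->
  P [set w | C (w, Y w)] = (\int[P]_w k w (xsection C w))%E.
Proof.
pose GG := [set A `*` B | A in @measurable _ GT & B in @measurable _ T].
have mpre (B : set (GT * T)) : measurable B -> measurable [set w : Om | B (w, Y w)].
  by move=> mB; rewrite -[X in measurable X]setTI; exact: measurable_pair_coarser.
rewrite measurable_prod_measurableType => GC.
apply: (@dynkin_induction _ (GT * T)%type GG
  (fun C => P [set w | C (w, Y w)] = (\int[P]_w k w (xsection C w))%E)) => //.
- exact: measurable_prod_measurableType.
- move=> _ _ [X1 mX1 [X2 mX2 <-]] [Y1 mY1 [Y2 mY2 <-]].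
  exists (X1 `&` Y1); first exact: measurableI.
  by exists (X2 `&` Y2); [exact: measurableI|rewrite setXI].
- have -> : [set w | [set: GT * T] (w, Y w)] = setT by apply/seteqP; split.
  have xT (w : GT) : xsection [set: GT * T] w = setT.
    by apply/seteqP; split => // y _; rewrite /xsection /= inE.
  under eq_integral do rewrite xT prob_kernel.
  by rewrite integral_cst_probability probability_setT.
- move=> _ [A mA [B mB <-]].
  have -> : [set w | (A `*` B) (w, Y w)] = A `&` Y @^-1` B by apply/seteqP; split.
  rewrite -kP// integral_mkcond; apply: eq_integral => w _.
  rewrite patchE; case: ifPn => wA; first by rewrite in_xsectionX.
  by rewrite notin_xsectionX// measure0.
- move=> S mS PS.
  have -> : [set w | (~` S) (w, Y w)] = ~` [set w | S (w, Y w)] by [].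
  rewrite probability_setC; last exact: mpre.
  rewrite PS.
  transitivity (\int[P]_w (1 - k w (xsection S w)))%E; last first.
    apply: eq_integral => w _.
    rewrite (_ : xsection (~` S) w = setT `\` xsection S w); last first.
      rewrite /xsection; apply/seteqP; split => y /=.
        by rewrite !inE => ?; split.
      by rewrite !inE => -[].
    rewrite measureD//=; [|exact: measurable_xsection|by rewrite prob_kernel ltry].
    by rewrite prob_kernel setTI.
  rewrite integralB//.
  + by rewrite integral_cst_probability.
  + apply/integrableP; split => //=.
    under eq_integral do rewrite normr1.
    by rewrite integral_cst_probability ltry.
  + apply/integrableP; split; first exact: measurable_kernel_xsection.
    apply: (@le_lt_trans _ _ (\int[P]_w (cst 1 w))%E); last first.
      by rewrite integral_cst_probability ltry.
    apply: ge0_le_integral => //.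
      by apply: measurableT_comp => //; exact: measurable_kernel_xsection.
    by move=> w _; rewrite gee0_abs//; exact: kernel_xsection_le1.
- move=> F mF tF PF.
  have -> : [set w | (\bigcup_n F n) (w, Y w)] =
    \bigcup_n [set w | F n (w, Y w)] by [].
  rewrite measure_semi_bigcup//=; last 3 first.
  + by move=> n; exact: mpre.
  + move=> i j _ _ [w [/= Fi Fj]]; apply: (tF i j) => //.
    by exists (w, Y w).
  + by apply: bigcupT_measurable => n; exact: mpre.
  under eq_eseriesr do rewrite PF.
  rewrite -integral_nneseries//; last first.
    by move=> n; exact: measurable_kernel_xsection.
  apply: eq_integral => w _.
  rewrite xsection_bigcup measure_semi_bigcup//=.
  + by move=> n; exact: measurable_xsection.
  + exact: trivIset_xsection.
  + by apply: bigcupT_measurable => n; exact: measurable_xsection.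
Qed.

Lemma cond_law_mixing (C : set (GT * T)) : measurable C ->
  (P [set w | C (w, Y w)] <= \int[P]_w P (Y @^-1` xsection C w) +
     \int[P]_w ereal_sup [set `|k w A - P (Y @^-1` A)| | A in measurable])%E.
Proof.
move=> mC; rewrite disintegration//.
have mY' A : measurable A -> measurable (Y @^-1` A).
  by move=> mA; rewrite -[X in measurable X]setTI; exact: mY.
have mPY : measurable_fun [set: Om] (fun w => P (Y @^-1` xsection C w)).
  apply: measurable_fun_coarser.
  pose Y' : {mfun Om >-> T} := mfun_Sub (mem_set mY : Y \in mfun).
  have := @measurable_fun_xsection _ _ GT T R (distribution P Y') C mC.
  by [].
(* The positive part of the difference is measurable, so the integral can be split with it; only
   then is it compared with the supremum over all sets, of which the section of [C] is one. *)
pose h (w : Om) : \bar R := maxe 0%E (k w (xsection C w) - P (Y @^-1` xsection C w))%E.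
have mh : measurable_fun [set: Om] h.
  apply: measurable_maxe => //; apply: emeasurable_funB => //.
  exact: measurable_kernel_xsection.
have h0 w : (0 <= h w)%E by rewrite /h le_max lexx.
apply: (@le_trans _ _ (\int[P]_w (P (Y @^-1` xsection C w) + h w))%E).
  apply: ge0_le_integral => //.
  - exact: measurable_kernel_xsection.
  - exact: emeasurable_funD.
  - move=> w _.
    have fin : P (Y @^-1` xsection C w) \is a fin_num.
      by apply: fin_num_measure; apply: mY'; exact: measurable_xsection.
    by rewrite -leeBlDl// /h le_max lexx orbT.
rewrite ge0_integralD//; apply: leeD2l.
apply: ge0_le_integral_nonmeas => // w.
rewrite /h ge_max; apply/andP; split.
  apply: ereal_sup_ge; exists `|k w set0 - P (Y @^-1` set0)|%E; first by exists set0.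
  exact: abse_ge0.
apply: ereal_sup_ge.
exists `|k w (xsection C w) - P (Y @^-1` xsection C w)|%E; last exact: lee_abs.
by exists (xsection C w) => //; exact: measurable_xsection.
Qed.

End conditional_law.

Lemma beta_coef_mixing (R : realType) (d d' : measure_display)
    (Om : measurableType d) (P : probability Om R) (G : set (set Om))
    (T : measurableType d') (Y : Om -> T) (b : R)
    (C : set (g_sigma_algebraType G * T)) :
  G `<=` measurable -> measurable_fun setT Y -> measurable C ->
  (beta_coef P G Y <= b%:E)%E ->
  (P [set w | C (w, Y w)] <= \int[P]_w P (Y @^-1` xsection C w) + b%:E)%E.
Proof.
(* The infimum over the versions of the conditional law need not be attained, hence the slack [e]; a
   finite bound on it also provides a version. *)
move=> Gm mY mC bb; apply/lee_addgt0Pr => e e0.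
rewrite -addeA -EFinD.
have : (beta_coef P G Y < (b + e)%:E)%E.
  by apply: le_lt_trans bb _; rewrite lte_fin ltrDl.
move=> /ereal_inf_lt[_ [k kP ->]] /ltW ke.
apply: le_trans (cond_law_mixing Gm mY kP mC) _.
exact: leeD2l.
Qed.

(** Under a probability these functions are integrable, and they are stable under all the operations
    below, so that integrability is never a separate question. *)
Definition bmeas (R : realType) (d : measure_display) (T : measurableType d)
    (f : T -> R) : Prop :=
  measurable_fun setT f /\ exists M, forall x, `|f x| <= M.

Section bounded_measurable.
Context (R : realType) (d : measure_display) (T : measurableType d).
Implicit Types f g : T -> R.

Lemma bmeas_cst (c : R) : bmeas (fun _ : T => c).
Proof. by split; [exact: measurable_cst|exists `|c|]. Qed.

Lemma bmeasD f g : bmeas f -> bmeas g -> bmeas (fun x => f x + g x).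
Proof.
move=> [mf [M fM]] [mg [N gN]]; split; first exact: measurable_funD.
by exists (M + N) => x; rewrite (le_trans (ler_normD _ _))// lerD.
Qed.

Lemma bmeasM f g : bmeas f -> bmeas g -> bmeas (fun x => f x * g x).
Proof.
move=> [mf [M fM]] [mg [N gN]]; split; first exact: measurable_funM.
by exists (M * N) => x; rewrite normrM ler_pM.
Qed.

Lemma bmeasN f : bmeas f -> bmeas (fun x => - f x).
Proof.
move=> [mf [M fM]]; split; first exact: measurableT_comp.
by exists M => x; rewrite normrN.
Qed.

Lemma bmeasB f g : bmeas f -> bmeas g -> bmeas (fun x => f x - g x).
Proof. by move=> bf bg; apply: bmeasD => //; exact: bmeasN. Qed.

Lemma bmeasZ (c : R) f : bmeas f -> bmeas (fun x => c * f x).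
Proof. by move=> bf; apply: bmeasM => //; exact: bmeas_cst. Qed.

Lemma bmeasX (n : nat) f : bmeas f -> bmeas (fun x => f x ^+ n).
Proof.
move=> bf; elim: n => [|n IH]; first exact: bmeas_cst.
rewrite (_ : (fun x => _) = (fun x => f x * f x ^+ n)); first exact: bmeasM.
by apply/funext => x; rewrite exprS.
Qed.

Lemma bmeas_sum (I : Type) (r : seq I) (F : I -> T -> R) :
  (forall i, bmeas (F i)) -> bmeas (fun x => \sum_(i <- r) F i x).
Proof.
move=> bF; elim: r => [|i r IH].
  by rewrite (_ : (fun x => _) = cst 0); [exact: bmeas_cst|
    apply/funext => x; rewrite big_nil].
rewrite (_ : (fun x => _) = (fun x => F i x + \sum_(j <- r) F j x)).
  exact: bmeasD.
by apply/funext => x; rewrite big_cons.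
Qed.

Lemma bmeas_sum_in (I : eqType) (r : seq I) (F : I -> T -> R) :
  (forall i, i \in r -> bmeas (F i)) -> bmeas (fun x => \sum_(i <- r) F i x).
Proof.
elim: r => [|i r IH] bF.
  by rewrite (_ : (fun x => _) = cst 0); [exact: bmeas_cst|
    apply/funext => x; rewrite big_nil].
rewrite (_ : (fun x => _) = (fun x => F i x + \sum_(j <- r) F j x)).
  apply: bmeasD; first by apply: bF; rewrite mem_head.
  by apply: IH => j jr; apply: bF; rewrite in_cons jr orbT.
by apply/funext => x; rewrite big_cons.
Qed.

Lemma bmeas_comp (d' : measure_display) (U : measurableType d') (g : U -> R)
  (f : T -> U) : bmeas g -> measurable_fun setT f -> bmeas (g \o f).
Proof.
by move=> [mg [M gM]] mf; split; [exact: measurableT_comp|exists M => x; exact: gM].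
Qed.

End bounded_measurable.

Section bounded_expectation.
Context (R : realType) (d : measure_display) (T : measurableType d)
  (P : probability T R).
Implicit Types f g : T -> R.

Lemma bmeas_integrable f : bmeas f -> P.-integrable setT (EFin \o f).
Proof.
move=> [mf [M fM]]; apply/integrableP; split; first exact/measurable_EFinP.
apply: (@le_lt_trans _ _ (\int[P]_x M%:E)%E).
  apply: ge0_le_integral => //.
  - by apply: measurableT_comp => //; exact/measurable_EFinP.
  - by move=> x _; rewrite lee_fin.
by rewrite integral_cst_probability ltry.
Qed.
Hint Resolve bmeas_integrable : core.

Lemma expectation_EFin f : bmeas f ->
  (\int[P]_x (f x)%:E)%E = (\int[P]_x f x)%:E.
Proof.
by move=> bf; rewrite fineK//; apply: integrable_fin_num => //;
  exact: bmeas_integrable.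
Qed.

Lemma bexp_cst (c : R) : \int[P]_x (fun _ => c) x = c.
Proof. by rewrite /Rintegral integral_cst_probability. Qed.

Lemma bexpD f g : bmeas f -> bmeas g ->
  \int[P]_x (f x + g x) = \int[P]_x f x + \int[P]_x g x.
Proof. by move=> bf bg; rewrite RintegralD//; exact: bmeas_integrable. Qed.

Lemma bexpB f g : bmeas f -> bmeas g ->
  \int[P]_x (f x - g x) = \int[P]_x f x - \int[P]_x g x.
Proof. by move=> bf bg; rewrite RintegralB//; exact: bmeas_integrable. Qed.

Lemma bexpZ (c : R) f : bmeas f ->
  \int[P]_x (c * f x) = c * \int[P]_x f x.
Proof. by move=> bf; rewrite RintegralZl//; exact: bmeas_integrable. Qed.

Lemma bexp_le f g : bmeas f -> bmeas g -> (forall x, f x <= g x) ->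
  \int[P]_x f x <= \int[P]_x g x.
Proof. by move=> bf bg fg; apply: le_Rintegral => //; exact: bmeas_integrable. Qed.

Lemma bexp_le_cst f (c : R) : bmeas f -> (forall x, f x <= c) ->
  \int[P]_x f x <= c.
Proof.
by move=> bf fg; rewrite -[leRHS]bexp_cst; apply: bexp_le => //; exact: bmeas_cst.
Qed.

Lemma bexp_ge_cst f (c : R) : bmeas f -> (forall x, c <= f x) ->
  c <= \int[P]_x f x.
Proof.
by move=> bf fg; rewrite -[leLHS]bexp_cst; apply: bexp_le => //; exact: bmeas_cst.
Qed.

Lemma bexp_sum (I : Type) (r : seq I) (F : I -> T -> R) :
  (forall i, bmeas (F i)) ->
  \int[P]_x (\sum_(i <- r) F i x) = \sum_(i <- r) \int[P]_x F i x.
Proof.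
move=> bF; elim: r => [|i r IH].
  rewrite big_nil -[RHS](bexp_cst 0); apply: eq_Rintegral => x _.
  by rewrite big_nil.
rewrite big_cons -IH -bexpD//; last exact: bmeas_sum.
by apply: eq_Rintegral => x _; rewrite big_cons.
Qed.

Lemma bexp_sum_in (I : eqType) (r : seq I) (F : I -> T -> R) :
  (forall i, i \in r -> bmeas (F i)) ->
  \int[P]_x (\sum_(i <- r) F i x) = \sum_(i <- r) \int[P]_x F i x.
Proof.
elim: r => [|i r IH] bF.
  rewrite big_nil -[RHS](bexp_cst 0); apply: eq_Rintegral => x _.
  by rewrite big_nil.
have bFr j : j \in r -> bmeas (F j) by move=> jr; apply: bF; rewrite in_cons jr orbT.
rewrite big_cons -IH// -bexpD//; last exact: bmeas_sum_in.
  by apply: eq_Rintegral => x _; rewrite big_cons.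
by apply: bF; rewrite mem_head.
Qed.

Lemma bexp_indic (A : set T) : measurable A ->
  \int[P]_x (\1_A x : R) = fine (P A).
Proof. by move=> mA; rewrite /Rintegral integral_indic// setIT. Qed.

Lemma bmeas_indic (A : set T) : measurable A -> bmeas (\1_A : T -> R).
Proof.
move=> mA; split; first exact: measurable_indic.
by exists 1 => x; rewrite indicE; case: (_ \in _); rewrite ?normr1 ?normr0.
Qed.

End bounded_expectation.

Section bounded_fubini.
Context (R : realType) (d d' : measure_display) (T : measurableType d)
  (U : measurableType d') (P : probability U R).

Lemma bmeas_section (H : T * U -> R) (x : T) : bmeas H ->
  bmeas (fun y => H (x, y)).
Proof. by move=> bH; apply: (bmeas_comp bH). Qed.

Lemma bmeas_fubini (H : T * U -> R) : bmeas H ->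
  bmeas (fun x => \int[P]_y H (x, y)).
Proof.
move=> bH; have [mH [M HM]] := bH.
split; last first.
  exists M => x; rewrite ler_norml; apply/andP; split.
    apply: bexp_ge_cst => [|y]; first exact: bmeas_section.
    by have := HM (x, y); rewrite ler_norml => /andP[].
  apply: bexp_le_cst => [|y]; first exact: bmeas_section.
  by have := HM (x, y); rewrite ler_norml => /andP[].
have HM0 z : 0 <= H z + M.
  by have := HM z; rewrite ler_norml => /andP[+ _]; lra.
have bHM : bmeas (fun z => H z + M) by apply: bmeasD => //; exact: bmeas_cst.
have -> : (fun x => \int[P]_y H (x, y)) =
          (fun x => fine (\int[P]_y (H (x, y) + M)%:E)%E - M).
  apply/funext => x.
  rewrite -[fine _]/(\int[P]_y (H (x, y) + M)) (@bexpD _ _ _ _ (fun y => H (x, y))).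
  - by rewrite bexp_cst addrK.
  - exact: bmeas_section.
  - exact: bmeas_cst.
apply: measurable_funB; last exact: measurable_cst.
apply: measurableT_comp; first exact: fine_measurable.
apply: (@measurable_fun_fubini_tonelli_F _ _ T U R P (fun z => (H z + M)%:E)) => //.
  apply/measurable_EFinP; exact: bHM.1.
Qed.

End bounded_fubini.

Section path_space_theory.
Context (R : realType) (I : Type).
Local Notation PS := (path_space R I).

Lemma measurable_coord (i : I) : measurable_fun setT (fun x : PS => x i).
Proof.
move=> _ A mA; rewrite setTI; apply: sub_gen_smallest.
by exists i => //; exists A => //; rewrite setTI.
Qed.

Lemma measurable_to_path (d : measure_display) (T : measurableType d)
    (f : T -> PS) :
  (forall i, measurable_fun setT (fun w => f w i)) -> measurable_fun setT f.
Proof.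
move=> mf; apply: measurability; first reflexivity.
move=> _ [_ [i _ [B mB <-]] <-]; rewrite !setTI.
by rewrite -[X in measurable X]setTI; exact: mf.
Qed.

End path_space_theory.

Definition shift_path (R : realType) (a : int) (x : path_space R int) :
  path_space R int := fun i => x (i + a).

Lemma measurable_shift_path (R : realType) (a : int) :
  measurable_fun setT (@shift_path R a).
Proof. by apply: measurable_to_path => i; exact: measurable_coord. Qed.

(** Past and future are two copies of the whole path, with a restriction on what is read of each;
    blocks at varying times thus live on one space. *)
Definition path_depends (R : realType) (U : Type) (a b : int)
    (H : path_space R int * path_space R int -> U) : Prop :=
  forall x x' y y' : path_space R int, (forall i, i <= a -> x i = x' i) ->
    (forall j, b <= j -> y j = y' j) -> H (x, y) = H (x', y').

Section path_law.
Context (R : realType) (d : measure_display) (Om : measurableType d)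
  (P : probability Om R) (X : int -> {RV P >-> R}).
Local Notation PS := (path_space R int).

Definition sample_path (w : Om) : PS := fun i => X i w.

Lemma measurable_sample_path : measurable_fun setT sample_path.
Proof. by apply: measurable_to_path => i; exact: measurable_funP. Qed.

HB.instance Definition _ :=
  isMeasurableFun.Build _ _ _ _ sample_path measurable_sample_path.

(** On the path space stationarity becomes invariance under the map [shift_path], and independence
    of past and future is integration over two points. *)
Definition path_law : probability PS R := distribution P sample_path.

Lemma path_lawE (A : set PS) : path_law A = P (sample_path @^-1` A).
Proof. by []. Qed.

Lemma bexp_path_law (f : PS -> R) : bmeas f ->
  \int[path_law]_x f x = \int[P]_w f (sample_path w).
Proof.
move=> bf; rewrite /Rintegral; congr fine.
rewrite integral_distribution//=.
- by apply/measurable_EFinP; exact: bf.1.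
- by apply: bmeas_integrable; exact: (bmeas_comp bf measurable_sample_path).
Qed.

Hypothesis X_stationary : strictly_stationary X.

Lemma path_law_shift (a : int) (A : set PS) : measurable A ->
  path_law (shift_path a @^-1` A) = path_law A.
Proof. by move=> mA; rewrite !path_lawE -(X_stationary a mA). Qed.

Lemma bexp_shift (a : int) (f : PS -> R) : bmeas f ->
  \int[path_law]_x f (shift_path a x) = \int[path_law]_x f x.
Proof.
move=> bf.
pose S : {mfun PS >-> PS} :=
  mfun_Sub (mem_set (@measurable_shift_path R a) : shift_path a \in mfun).
transitivity (\int[distribution path_law S]_x f x).
  rewrite /Rintegral; congr fine; rewrite [RHS]integral_distribution//=.
  - by apply/measurable_EFinP; exact: bf.1.
  - by apply: bmeas_integrable; exact: (bmeas_comp bf (@measurable_shift_path R a)).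
rewrite /Rintegral; congr fine; apply: eq_measure_integral => A mA _.
exact: path_law_shift.
Qed.

End path_law.

Section path_mixing.
Context (R : realType) (d : measure_display) (Om : measurableType d)
  (P : probability Om R) (X : int -> {RV P >-> R}).
Local Notation PS := (path_space R int).
Local Notation Q := (path_law X).

Lemma measurable_diag : measurable_fun setT (fun x : PS => (x, x)).
Proof. by apply: measurable_fun_pair. Qed.

Lemma path_mixing_set0 (h : nat) (r : R) (C : set (PS * PS)) :
  (0 < h)%N -> (beta_mixing X h <= r%:E)%E -> measurable C ->
  path_depends 0 h%:Z C ->
  (Q [set x | C (x, x)] <= \int[Q]_x Q [set y | C (x, y)] + r%:E)%E.
Proof.
move=> h0 br mC dC.
pose G := gen_events (fun i w => X i w) [set i : int | i <= 0].
pose Y (w : Om) : path_space R nat := fun j : nat => X (h%:Z + j%:Z) w.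
have Gm : G `<=` measurable.
  move=> _ [i _ [B mB <-]]; rewrite setTI -[X in measurable X]setTI.
  exact: measurable_funP.
have mY : measurable_fun setT Y.
  by apply: measurable_to_path => i; exact: measurable_funP.
have {}br : (beta_coef P G Y <= r%:E)%E.
  by move: br; rewrite /beta_mixing -[h == 0%N]negbK -lt0n h0.
pose GT := g_sigma_algebraType G.
(* Both maps complete a half-line by the value 0, which [dC] makes irrelevant. Since [past] reads
   only the times up to 0, it is measurable for the sigma-algebra generated by [G]. *)
pose past (w : GT) : PS := fun i : int => if (i <= 0)%R then X i w else 0.
pose futr (y : path_space R nat) : PS :=
  fun j : int => if (h%:Z <= j)%R then y `|j - h%:Z|%N else 0.
have mpast : measurable_fun setT past.
  apply: measurable_to_path => i; rewrite /past.
  have [i0|i0] := boolP (i <= 0); last exact: measurable_cst.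
  move=> _ A mA; apply: sub_gen_smallest; exists i => //.
  by exists A.
have mfutr : measurable_fun setT futr.
  apply: measurable_to_path => j; rewrite /futr.
  have [i0|i0] := boolP (h%:Z <= j); last exact: measurable_cst.
  exact: measurable_coord.
pose phi (z : GT * path_space R nat) := (past z.1, futr z.2).
have mphi : measurable_fun setT phi.
  by apply: measurable_fun_pair; apply: measurableT_comp.
have CE x y w w' : (forall i : int, i <= 0 -> x i = X i w) ->
    (forall j : int, h%:Z <= j -> y j = X j w') ->
    C (past w, futr (Y w')) = C (x, y).
  move=> xw yw'; apply: dC => [i i0|j hj]; first by rewrite /past i0 xw.
  by rewrite /futr /Y hj yw'//; congr (X _ w'); lia.
have mC' : measurable (phi @^-1` C).
  by rewrite -[X in measurable X]setTI; exact: mphi.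
have := beta_coef_mixing Gm mY mC' br.
have -> : [set w | (phi @^-1` C) (w, Y w)] =
    sample_path X @^-1` [set x | C (x, x)].
  apply/seteqP; split=> w /=; rewrite /phi /=.
    by rewrite (CE (sample_path X w) (sample_path X w)).
  by rewrite (CE (sample_path X w) (sample_path X w)).
have mCx (x : PS) : measurable [set y | C (x, y)].
  rewrite (_ : [set y | _] = xsection C x); first exact: measurable_xsection.
  by apply/seteqP; split => y; rewrite /xsection /= inE.
have mQ : measurable_fun setT (fun x : PS => Q [set y | C (x, y)]).
  have := @measurable_fun_xsection _ _ PS PS R Q C mC.
  congr (measurable_fun _ _); apply/funext => x; congr (Q _).
  by apply/seteqP; split => y; rewrite /xsection /= inE.
have -> : (\int[Q]_x Q [set y | C (x, y)] =
    \int[P]_w P (Y @^-1` xsection (phi @^-1` C) w))%E.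
  rewrite ge0_integral_distribution//; apply: eq_integral => w _ /=.
  rewrite path_lawE; congr (P _).
  apply/seteqP; split => w'; rewrite /xsection /= inE /= /phi /=;
    by rewrite (CE (sample_path X w) (sample_path X w')).
by [].
Qed.

Lemma path_mixing_indic0 (h : nat) (r : R) (C : set (PS * PS)) :
  (0 < h)%N -> (beta_mixing X h <= r%:E)%E -> measurable C ->
  path_depends 0 h%:Z C ->
  \int[Q]_x (\1_C (x, x) : R) <= \int[Q]_x (\int[Q]_y \1_C (x, y)) + r.
Proof.
move=> h0 br mC dC.
have bC : bmeas (\1_C : PS * PS -> R) by exact: bmeas_indic.
have mCx (x : PS) : measurable [set y | C (x, y)].
  rewrite (_ : [set y | _] = xsection C x); first exact: measurable_xsection.
  by apply/seteqP; split => y; rewrite /xsection /= inE.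
rewrite -lee_fin EFinD -expectation_EFin; last first.
  exact: (bmeas_comp bC measurable_diag).
rewrite -expectation_EFin; last exact: bmeas_fubini.
have := path_mixing_set0 h0 br mC dC.
have mCd : measurable [set x | C (x, x)].
  by rewrite -[X in measurable X]setTI; exact: measurable_diag.
have -> : (\int[Q]_x ((\1_C (x, x) : R)%:E) = Q [set x | C (x, x)])%E.
  by rewrite -[in RHS](setIT [set x | C (x, x)]) -integral_indic.
have -> : (\int[Q]_x (\int[Q]_y (\1_C (x, y) : R))%:E =
           \int[Q]_x Q [set y | C (x, y)])%E; last by [].
apply: eq_integral => x _; rewrite -expectation_EFin; last exact: bmeas_section.
by rewrite -[in RHS](setIT [set y | C (x, y)]) -integral_indic.
Qed.

(* Discretization [H <= 1/N + (1/N) * #{i | i/N <= H} <= 1/N + H], which reduces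
   to the level sets of [H]. *)
Lemma path_mixing0 (h : nat) (r : R) (H : PS * PS -> R) :
  (0 < h)%N -> (beta_mixing X h <= r%:E)%E -> measurable_fun setT H ->
  (forall z, 0 <= H z <= 1) -> path_depends 0 h%:Z H ->
  \int[Q]_x H (x, x) <= \int[Q]_x (\int[Q]_y H (x, y)) + r.
Proof.
move=> h0 br mH H01 dH.
have bH : bmeas H.
  split => //; exists 1 => z; have /andP[? ?] := H01 z.
  by rewrite ger0_norm.
have bHd : bmeas (fun x : PS => H (x, x)).
  exact: (bmeas_comp bH measurable_diag).
pose C (N i : nat) : set (PS * PS) := [set z | i.+1%:R / N.+1%:R <= H z].
have mC N i : measurable (C N i).
  rewrite /C -[X in measurable X]setTI.
  exact: (@measurable_fun_le _ _ _ _ (cst _) H).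
pose F N z : R := \sum_(i < N.+1) \1_(C N i) z / N.+1%:R.
have FE N z : F N z = (Num.truncn (H z * N.+1%:R))%:R / N.+1%:R.
  have /andP[Hz0 Hz1] := H01 z.
  have HN0 : 0 <= H z * N.+1%:R by rewrite mulr_ge0.
  have tN : (Num.truncn (H z * N.+1%:R) <= N.+1)%N.
    rewrite -(ler_nat R); apply: (@le_trans _ _ (H z * N.+1%:R)).
      by rewrite truncn_le.
    by rewrite ler_piMl.
  rewrite /F -mulr_suml; congr (_ / _).
  rewrite (eq_bigr (fun i : 'I_N.+1 => (i < Num.truncn (H z * N.+1%:R))%N%:R)).
    rewrite -natr_sum; congr (_%:R).
    rewrite -(big_mkord xpredT (fun i => (i < _)%N : nat)).
    rewrite (big_cat_nat (leq0n _) tN) //= big_nat (eq_bigr (fun=> 1%N)).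
      rewrite -big_nat sum_nat_const_nat subn0 muln1.
      rewrite big_nat big1 ?addn0// => i /andP[ti _].
      by rewrite ltnNge ti.
    by move=> i /andP[_ ->].
  move=> i _; rewrite indicE /C; congr (_%:R); congr (nat_of_bool _).
  apply/idP/idP; rewrite inE /= ler_pdivrMr//.
    by move=> Hi; rewrite truncn_gt_nat.
  by rewrite truncn_gt_nat.
have FH N z : F N z <= H z.
  have /andP[Hz0 _] := H01 z.
  by rewrite FE ler_pdivrMr// truncn_le mulr_ge0.
have HF N z : H z <= F N z + N.+1%:R^-1.
  rewrite FE -[X in _ <= _ + X]mul1r -mulrDl ler_pdivlMr//.
  by rewrite natr1 ltW// truncnS_gt.
have bI N i : bmeas (\1_(C N i) : PS * PS -> R) by exact: bmeas_indic.
have bF N : bmeas (F N).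
  apply: bmeas_sum => i.
  by apply: (bmeasM (bI N i)); exact: bmeas_cst.
have dC N i : path_depends 0 h%:Z (C N i).
  by move=> x x' y y' xx yy; rewrite /C /= (dH _ x' _ y').
have FF N : \int[Q]_x F N (x, x) <= \int[Q]_x (\int[Q]_y F N (x, y)) + r.
  rewrite /F.
  rewrite (@bexp_sum _ _ _ Q _ _ (fun (i : 'I_N.+1) x => \1_(C N i) (x, x) / N.+1%:R)); last first.
    move=> i; apply: (@bmeasM _ _ _ (fun x => \1_(C N i) (x, x))).
      exact: (bmeas_comp (bI N i) measurable_diag).
    exact: bmeas_cst.
  rewrite (_ : \int[Q]_x _ = \sum_(i < N.+1)
      (\int[Q]_x \int[Q]_y \1_(C N i) (x, y)) / N.+1%:R); last first.
    rewrite -mulr_suml mulrC.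
    rewrite -(@bexp_sum _ _ _ Q _ _ (fun (i : 'I_N.+1) x => \int[Q]_y \1_(C N i) (x, y)));
      last by move=> i; exact: bmeas_fubini.
    rewrite -bexpZ; last by apply: bmeas_sum => i; exact: bmeas_fubini.
    apply: eq_Rintegral => x _.
    rewrite -(@bexp_sum _ _ _ Q _ _ (fun (i : 'I_N.+1) y => \1_(C N i) (x, y)));
      last by move=> i; exact: bmeas_section.
    rewrite -bexpZ; last by apply: bmeas_sum => i; exact: bmeas_section.
    by apply: eq_Rintegral => y _; rewrite mulr_sumr; apply: eq_bigr => i _; rewrite mulrC.
  rewrite (_ : r = \sum_(i < N.+1) r / N.+1%:R); last first.
    by rewrite sumr_const card_ord -[RHS]mulr_natr divfK.
  rewrite -big_split /=; apply: ler_sum => i _.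
  under eq_Rintegral do rewrite mulrC.
  rewrite bexpZ; last exact: (bmeas_comp (bI N i) measurable_diag).
  rewrite mulrC -mulrDl ler_pM2r ?invr_gt0//.
  exact: (path_mixing_indic0 h0 br (mC N i) (dC N i)).
have FH2 N : \int[Q]_x (\int[Q]_y F N (x, y)) <= \int[Q]_x (\int[Q]_y H (x, y)).
  apply: bexp_le => [||x]; [exact: bmeas_fubini|exact: bmeas_fubini|].
  by apply: bexp_le => [||y]; [exact: bmeas_section|exact: bmeas_section|exact: FH].
apply/ler_addgt0Pr => e e0.
pose N := Num.truncn e^-1.
have Ne : N.+1%:R^-1 <= e.
  by rewrite invf_ple ?posrE//; exact/ltW/truncnS_gt.
apply: (@le_trans _ _ (\int[Q]_x (F N (x, x) + N.+1%:R^-1))).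
  apply: bexp_le => //.
  apply: bmeasD; [exact: (bmeas_comp (bF N) measurable_diag)|exact: bmeas_cst].
rewrite (@bexpD _ _ _ Q (fun x => F N (x, x))); last 2 first.
  exact: (bmeas_comp (bF N) measurable_diag).
  exact: bmeas_cst.
rewrite bexp_cst lerD// (le_trans (FF N))// lerD2r.
exact: FH2.
Qed.

Lemma path_mixing (X_stationary : strictly_stationary X) (a b : int) (h : nat)
    (r : R) (H : PS * PS -> R) :
  (0 < h)%N -> a + h%:Z <= b -> (beta_mixing X h <= r%:E)%E ->
  measurable_fun setT H ->
  (forall z, 0 <= H z <= 1) -> path_depends a b H ->
  \int[Q]_x H (x, x) <= \int[Q]_x (\int[Q]_y H (x, y)) + r.
Proof.
move=> h0 ahb br mH H01 dH.
have bH : bmeas H.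
  split => //; exists 1 => z; have /andP[? ?] := H01 z.
  by rewrite ger0_norm.
(* Shifting both copies by [- a] reduces to [a = 0]; by stationarity neither integral changes. *)
pose S (z : PS * PS) := (shift_path (- a) z.1, shift_path (- a) z.2).
have mS : measurable_fun setT S.
  apply: measurable_fun_pair.
    exact: (measurableT_comp (measurable_shift_path (- a)) measurable_fst).
  exact: (measurableT_comp (measurable_shift_path (- a)) measurable_snd).
have bHS : bmeas (H \o S) by exact: bmeas_comp.
have HS01 z : 0 <= (H \o S) z <= 1 by exact: H01.
have dHS : path_depends 0 h%:Z (H \o S).
  move=> x x' y y' xx yy /=; apply: dH => i ia; rewrite /shift_path.
    by apply: xx; lia.
  by apply: yy; lia.
have := path_mixing0 h0 br bHS.1 HS01 dHS.
rewrite /= /S /= (bexp_shift X_stationary (- a) (f := fun x => H (x, x))); last first.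
  exact: (bmeas_comp bH measurable_diag).
under [X in _ <= X + _ -> _]eq_Rintegral => x _.
  rewrite (bexp_shift X_stationary (- a) (f := fun y => H (shift_path (- a) x, y)));
    last exact: bmeas_section.
  over.
by rewrite (bexp_shift X_stationary (- a) (f := fun x => \int[Q]_y H (x, y)));
  last exact: bmeas_fubini.
Qed.

End path_mixing.

(** * Deviation inequality for blocks *)

Section finite_sums.
Context (R : realFieldType).

Lemma sum_sqr_ge0 (I : Type) (r : seq I) (a : I -> R) :
  0 <= \sum_(i <- r) a i ^+ 2.
Proof. by apply: sumr_ge0 => i _; exact: sqr_ge0. Qed.

(* Lagrange's identity *)
Lemma cauchy_schwarz_sum (I : Type) (r : seq I) (a b : I -> R) :
  (\sum_(i <- r) a i * b i) ^+ 2 <=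
  (\sum_(i <- r) a i ^+ 2) * (\sum_(i <- r) b i ^+ 2).
Proof.
have : 0 <= \sum_(i <- r) \sum_(j <- r) (a i * b j - a j * b i) ^+ 2.
  by apply: sumr_ge0 => i _; apply: sum_sqr_ge0.
have E : \sum_(i <- r) \sum_(j <- r) (a i * b j - a j * b i) ^+ 2 =
    2 * ((\sum_(i <- r) a i ^+ 2) * (\sum_(i <- r) b i ^+ 2)) -
    2 * (\sum_(i <- r) a i * b i) ^+ 2.
  transitivity (\sum_(i <- r) \sum_(j <- r)
     (a i ^+ 2 * b j ^+ 2 + (b i ^+ 2 * a j ^+ 2 - 2 * ((a i * b i) * (a j * b j))))).
    by apply: eq_bigr => i _; apply: eq_bigr => j _; ring.
  under eq_bigr do rewrite big_split /= sumrB -!mulr_sumr.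
  rewrite big_split /= sumrB -!mulr_sumr -!mulr_suml.
  by rewrite expr2; ring.
rewrite E; lra.
Qed.

Lemma sqr_sum_le_size (I : Type) (r : seq I) (a : I -> R) :
  (\sum_(i <- r) a i) ^+ 2 <= (size r)%:R * \sum_(i <- r) a i ^+ 2.
Proof.
have := cauchy_schwarz_sum r (fun=> 1) a.
under eq_bigr do rewrite mul1r.
under [X in _ <= X * _ -> _]eq_bigr do rewrite expr1n.
by rewrite big_const_seq count_predT iter_addr_0.
Qed.

Lemma ler_sum_uniq_sub (I : eqType) (r s : seq I) (F : I -> R) :
  uniq r -> uniq s -> {subset r <= s} -> (forall i, 0 <= F i) ->
  \sum_(i <- r) F i <= \sum_(i <- s) F i.
Proof.
move=> ur us rs F0.
have p : perm_eq r [seq i <- s | i \in r].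
  apply: uniq_perm => //; first exact: filter_uniq.
  by move=> i; rewrite mem_filter; case: (boolP (i \in r)) => // /rs ->.
rewrite (perm_big _ p) big_filter /= [leRHS](bigID (mem r)) /= lerDl.
exact: sumr_ge0.
Qed.

(** In each row the lag 0 occurs once and every other lag at most twice. The conditional computes
    the distance from [i] to [j] in spite of truncated subtraction. *)
Lemma sum_toeplitz_le (J : seq nat) (gam : nat -> R) (S : R) :
  uniq J -> (forall l, 0 <= gam l) ->
  (forall n, \sum_(1 <= l < n.+1) gam l <= S) ->
  \sum_(i <- J) \sum_(j <- J) gam (if (i < j)%N then j - i else i - j)%N <=
  (size J)%:R * (gam 0%N + 2 * S).
Proof.
move=> uJ g0 gS.
have row i : i \in J ->
    \sum_(j <- J) gam (if (i < j)%N then j - i else i - j)%N <= gam 0%N + 2 * S.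
  move=> iJ.
  pose M := (\max_(j <- J) j).+1.
  have JM j : j \in J -> (j < M)%N by move=> jJ; rewrite ltnS; exact: leq_bigmax_seq.
  (* [J] may have holes; as [gam] is nonnegative, it can be enlarged to an initial segment. *)
  apply: (@le_trans _ _ (\sum_(j <- iota 0 M)
      gam (if (i < j)%N then j - i else i - j)%N)).
    apply: (@ler_sum_uniq_sub _ _ _ (fun j => gam (if (i < j)%N then j - i else i - j)%N)) => //.
      exact: iota_uniq.
    by move=> j /JM jM; rewrite mem_iota.
  rewrite -[iota 0 M]/(iota 0 (M - 0)) -/(index_iota 0 M).
  have iM := JM _ iJ.
  rewrite (big_cat_nat (leq0n i.+1) iM) //= big_nat_recr //= ltnn subnn.
  have -> : \sum_(0 <= j < i) gam (if (i < j)%N then (j - i)%N else (i - j)%N) =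
            \sum_(1 <= l < i.+1) gam l.
    rewrite big_add1 /= big_nat_rev /= add0n big_nat [RHS]big_nat.
    apply: eq_bigr => j /andP[_ ji]; rewrite ifF; last by apply/negbTE; lia.
    by congr gam; lia.
  have -> : \sum_(i.+1 <= j < M) gam (if (i < j)%N then (j - i)%N else (i - j)%N) =
            \sum_(1 <= l < (M - i.+1).+1) gam l.
    rewrite -{1}(add0n i.+1) big_addn big_add1 /= big_nat [RHS]big_nat.
    apply: eq_bigr => j _; rewrite ifT; last by lia.
    by congr gam; lia.
  by have := gS i; have := gS (M - i.+1)%N; lra.
rewrite big_seq; apply: le_trans (ler_sum _ row) _.
by rewrite -big_seq big_const_seq count_predT iter_addr_0 -[leLHS]mulr_natl.
Qed.

End finite_sums.

Section covariance.
Context (R : realType).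
Local Notation PS := (path_space R int).
Context (Q : probability PS R) (rho : nat -> R).
Hypothesis rho_ge0 : forall l, 0 <= rho l.
Hypothesis Q_mixing : forall (a b : int) (h : nat) (H : PS * PS -> R),
  (0 < h)%N -> a + h%:Z <= b -> measurable_fun setT H ->
  (forall z, 0 <= H z <= 1) -> path_depends a b H ->
  \int[Q]_x H (x, x) <= \int[Q]_x (\int[Q]_y H (x, y)) + rho h.
Hypothesis Q_shift : forall (a : int) (f : PS -> R), bmeas f ->
  \int[Q]_x f (shift_path a x) = \int[Q]_x f x.

Definition path_mean (f : R -> R) : R := \int[Q]_x f (x 0).

Lemma bmeas_coord (f : R -> R) (i : int) : bmeas f ->
  bmeas (fun x : PS => f (x i)).
Proof. by move=> bf; apply: (bmeas_comp bf); exact: measurable_coord. Qed.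

Lemma path_meanE (f : R -> R) (i : int) : bmeas f ->
  \int[Q]_x f (x i) = path_mean f.
Proof.
move=> bf; rewrite /path_mean -(Q_shift i (bmeas_coord 0 bf)).
by apply: eq_Rintegral => x _; rewrite /shift_path add0r.
Qed.

Context (L : eqType) (r : seq L) (f : L -> R -> R) (B : R).
Hypothesis mf : forall l, measurable_fun setT (f l).
Hypothesis fB : forall u, \sum_(l <- r) f l u ^+ 2 <= B.

Lemma bmeas_of_sqr_le (l : L) : l \in r -> bmeas (f l).
Proof.
move=> lr; split; first exact: mf.
exists (B + 1) => u; have : f l u ^+ 2 <= B.
  apply: le_trans (fB u); rewrite (big_rem l)//= lerDl.
  exact: sum_sqr_ge0.
move=> fu; have := normr_ge0 (f l u).
rewrite -(real_normK (num_real _)) in fu.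
by nra.
Qed.

Lemma sum_mul_le (u w : R) : `|\sum_(l <- r) f l u * f l w| <= B.
Proof.
have B0 : 0 <= B by apply: le_trans (fB 0); exact: sum_sqr_ge0.
rewrite -ler_sqr ?nnegrE// real_normK ?num_real//.
apply: le_trans (cauchy_schwarz_sum _ _ _) _.
by rewrite expr2 ler_pM ?sum_sqr_ge0.
Qed.

(** The whole sum over [l] is one test function, bounded by [B] through Cauchy-Schwarz. Mapped
    affinely to [0, 1], it costs a single mixing coefficient times [2 * B], with no factor
    [size r]. *)
Lemma path_covariance_le (i j : nat) : (i < j)%N ->
  \int[Q]_x (\sum_(l <- r) (f l (x i%:Z) - path_mean (f l)) *
                           (f l (x j%:Z) - path_mean (f l)))
  <= 2 * B * rho (j - i)%N.
Proof.
move=> ij.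
have B0 : 0 <= B by apply: le_trans (fB 0); exact: sum_sqr_ge0.
have bf l : l \in r -> bmeas (f l) by exact: bmeas_of_sqr_le.
have bfi l k : l \in r -> bmeas (fun x : PS => f l (x k)).
  by move=> lr; apply: bmeas_coord; exact: bf.
(* works with a strictly positive bound, so that [B = 0] is not special *)
apply/ler_addgt0Pr => e e0.
pose B' := B + e / (2 * (rho (j - i)%N + 1)).
have re0 : 0 < 2 * (rho (j - i)%N + 1) by have := rho_ge0 (j - i)%N; lra.
have ee0 : 0 < e / (2 * (rho (j - i)%N + 1)) by rewrite divr_gt0.
have B'0 : 0 < B' by rewrite /B'; lra.
have BB' : B <= B' by rewrite /B'; lra.
pose K (z : PS * PS) := \sum_(l <- r) f l (z.1 i%:Z) * f l (z.2 j%:Z).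
have bK : bmeas K.
  apply: bmeas_sum_in => l lr; apply: bmeasM.
    exact: (bmeas_comp (bfi l i%:Z lr) measurable_fst).
  exact: (bmeas_comp (bfi l j%:Z lr) measurable_snd).
pose H z := (2 * B')^-1 * (K z + B').
have bKB : bmeas (fun z => K z + B') by apply: bmeasD => //; exact: bmeas_cst.
have mH : measurable_fun setT H by apply: (bmeasZ _ bKB).1.
have H01 z : 0 <= H z <= 1.
  have := sum_mul_le (z.1 i%:Z) (z.2 j%:Z); rewrite ler_norml => /andP[K1 K2].
  rewrite /H mulr_ge0 /=; last 2 first.
  - by rewrite invr_ge0; lra.
  - by rewrite /K; lra.
  by rewrite ler_pdivrMl ?mulr1; rewrite /K; lra.
have dH : path_depends i%:Z j%:Z H.
  move=> x x' y y' xx yy; rewrite /H /K /=; congr (_ * (_ + _)).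
  by apply: eq_bigr => l _; rewrite xx// yy.
have ahb : i%:Z + (j - i)%N%:Z <= j%:Z by lia.
have := Q_mixing (h := (j - i)%N) (a := i%:Z) (b := j%:Z) (H := H).
rewrite subn_gt0 => /(_ ij ahb mH H01 dH).
have bKd : bmeas (fun x : PS => K (x, x)).
  by apply: (bmeas_comp bK); exact: measurable_diag.
rewrite /H bexpZ; last by apply: bmeasD => //; exact: bmeas_cst.
rewrite bexpD//; last exact: bmeas_cst.
rewrite bexp_cst.
under [X in _ <= X + _ -> _]eq_Rintegral => x _.
  rewrite bexpZ; last exact: (bmeas_section x bKB).
  rewrite (@bexpD _ _ _ Q (fun y => K (x, y))); [|exact: bmeas_section|exact: bmeas_cst].
  rewrite bexp_cst.
  over.
rewrite bexpZ; last by apply: bmeasD; [exact: bmeas_fubini|exact: bmeas_cst].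
rewrite bexpD; [|exact: bmeas_fubini|exact: bmeas_cst].
rewrite bexp_cst.
have -> : \int[Q]_x \int[Q]_y K (x, y) = \sum_(l <- r) path_mean (f l) ^+ 2.
  transitivity (\int[Q]_x \sum_(l <- r) path_mean (f l) * f l (x i%:Z)).
    apply: eq_Rintegral => x _.
    rewrite (@bexp_sum_in _ _ _ Q _ _ (fun l y => f l (x i%:Z) * f l (y j%:Z)));
      last by move=> l lr; apply: bmeasZ; exact: bfi.
    rewrite big_seq [RHS]big_seq; apply: eq_bigr => l lr.
    rewrite (bexpZ Q _ (bfi l j%:Z lr)) (path_meanE j%:Z (bf l lr)).
    by rewrite mulrC.
  rewrite (@bexp_sum_in _ _ _ Q _ _ (fun l x => path_mean (f l) * f l (x i%:Z)));
    last by move=> l lr; apply: bmeasZ; exact: bfi.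
  rewrite big_seq [RHS]big_seq; apply: eq_bigr => l lr.
  by rewrite (bexpZ Q _ (bfi l i%:Z lr)) (path_meanE i%:Z (bf l lr)) expr2.
set c2 := \sum_(l <- r) _ => mix.
have -> : \int[Q]_x (\sum_(l <- r) (f l (x i%:Z) - path_mean (f l)) *
    (f l (x j%:Z) - path_mean (f l))) = \int[Q]_x K (x, x) - c2.
  rewrite (@bexp_sum_in _ _ _ Q _ _ (fun l x => (f l (x i%:Z) - path_mean (f l)) *
    (f l (x j%:Z) - path_mean (f l)))); last first.
    by move=> l lr; apply: bmeasM; apply: bmeasB; [exact: bfi|exact: bmeas_cst|
      exact: bfi|exact: bmeas_cst].
  rewrite /K /= (@bexp_sum_in _ _ _ Q _ _ (fun l x => f l (x i%:Z) * f l (x j%:Z))); last first.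
    by move=> l lr; apply: bmeasM; exact: bfi.
  rewrite /c2 -sumrB big_seq [RHS]big_seq; apply: eq_bigr => l lr.
  transitivity (\int[Q]_x (f l (x i%:Z) * f l (x j%:Z) -
      (path_mean (f l) * f l (x i%:Z) + path_mean (f l) * f l (x j%:Z) -
       path_mean (f l) ^+ 2))).
    by apply: eq_Rintegral => x _; ring.
  rewrite bexpB; first last.
  - apply: bmeasB; last exact: bmeas_cst.
    by apply: bmeasD; apply: bmeasZ; exact: bfi.
  - by apply: bmeasM; exact: bfi.
  congr (_ - _); rewrite bexpB; first last.
  - exact: bmeas_cst.
  - by apply: bmeasD; apply: bmeasZ; exact: bfi.
  rewrite bexp_cst bexpD; [|by apply: bmeasZ; exact: bfi|by apply: bmeasZ; exact: bfi].
  rewrite (bexpZ Q _ (bfi l j%:Z lr)) (path_meanE j%:Z (bf l lr)).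
  rewrite (bexpZ Q _ (bfi l i%:Z lr)) (path_meanE i%:Z (bf l lr)).
  by ring.
have : \int[Q]_x K (x, x) + B' <= c2 + B' + 2 * B' * rho (j - i)%N.
  rewrite -(ler_pM2l (x := (2 * B')^-1)); last by rewrite invr_gt0; lra.
  rewrite [leRHS]mulrDr [X in _ <= _ + X]mulrA mulVf ?mul1r//.
  by apply: lt0r_neq0; lra.
have : 2 * B' * rho (j - i)%N <= 2 * B * rho (j - i)%N + e.
  rewrite /B' mulrDr mulrDl lerD2l.
  have := rho_ge0 (j - i)%N; set t := rho _ => t0.
  rewrite mulrAC mulrA ler_pdivrMr; last by lra.
  by nra.
lra.
Qed.
End covariance.

Definition block_sum (R : realType) (J : seq nat) (g : R -> R)
    (x : path_space R int) : R := \sum_(i <- J) g (x i%:Z).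

Section block_moments.
Context (R : realType).
Local Notation PS := (path_space R int).
Context (Q : probability PS R) (rho : nat -> R).
Hypothesis rho_ge0 : forall l, 0 <= rho l.
Hypothesis Q_mixing : forall (a b : int) (h : nat) (H : PS * PS -> R),
  (0 < h)%N -> a + h%:Z <= b -> measurable_fun setT H ->
  (forall z, 0 <= H z <= 1) -> path_depends a b H ->
  \int[Q]_x H (x, x) <= \int[Q]_x (\int[Q]_y H (x, y)) + rho h.
Hypothesis Q_shift : forall (a : int) (f : PS -> R), bmeas f ->
  \int[Q]_x f (shift_path a x) = \int[Q]_x f x.

Lemma bmeas_block_sum (J : seq nat) (g : R -> R) : bmeas g ->
  bmeas (block_sum J g).
Proof. by move=> bg; apply: bmeas_sum => i; exact: bmeas_coord. Qed.

Lemma block_second_moment_le (L : eqType) (r : seq L) (g : L -> R -> R)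
    (J : seq nat) (gam : nat -> R) (S : R) :
  (forall l, l \in r -> bmeas (g l)) -> uniq J ->
  (forall l, 0 <= gam l) ->
  (forall n, \sum_(1 <= l < n.+1) gam l <= S) ->
  (forall i j : nat, (i <= j)%N ->
    \int[Q]_x (\sum_(l <- r) g l (x i%:Z) * g l (x j%:Z)) <= gam (j - i)%N) ->
  \int[Q]_x (\sum_(l <- r) block_sum J (g l) x ^+ 2) <=
  (size J)%:R * (gam 0%N + 2 * S).
Proof.
move=> bg uJ gam0 gamS cov.
have bgg i j : bmeas (fun x : PS => \sum_(l <- r) g l (x i%:Z) * g l (x j%:Z)).
  by apply: bmeas_sum_in => l lr; apply: bmeasM; apply: bmeas_coord; exact: bg.
apply: le_trans (sum_toeplitz_le uJ gam0 gamS).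
rewrite (_ : \int[Q]_x _ = \int[Q]_x (\sum_(i <- J) \sum_(j <- J)
    \sum_(l <- r) g l (x i%:Z) * g l (x j%:Z))); last first.
  apply: eq_Rintegral => x _.
  under [in RHS]eq_bigr do rewrite exchange_big.
  rewrite exchange_big /=; apply: eq_bigr => l _.
  rewrite /block_sum expr2 mulr_suml; apply: eq_bigr => i _.
  by rewrite mulr_sumr.
rewrite bexp_sum; last by move=> i; apply: bmeas_sum => j; exact: bgg.
apply: ler_sum => i _; rewrite bexp_sum; last by move=> j; exact: bgg.
apply: ler_sum => j _; case: ifPn => ij; first by apply: cov; exact: ltnW.
rewrite (_ : \int[Q]_x _ = \int[Q]_x (\sum_(l <- r) g l (x j%:Z) * g l (x i%:Z))).
  by apply: cov; rewrite leqNgt.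
by apply: eq_Rintegral => x _; apply: eq_bigr => l _; rewrite mulrC.
Qed.

Lemma path_variance_le (f : R -> R) (i : int) : bmeas f ->
  \int[Q]_x ((f (x i) - path_mean Q f) ^+ 2) <= path_mean Q (fun u => f u ^+ 2).
Proof.
move=> bf; set c := path_mean Q f.
have bfi : bmeas (fun x : PS => f (x i)) by exact: bmeas_coord.
have bf2 : bmeas (fun u => f u ^+ 2) by exact: bmeasX.
have -> : \int[Q]_x ((f (x i) - c) ^+ 2) =
    \int[Q]_x (f (x i) ^+ 2 - (2 * c * f (x i) - c ^+ 2)).
  by apply: eq_Rintegral => x _; ring.
have b1 : bmeas (fun x : PS => 2 * c * f (x i)) by exact: bmeasZ.
rewrite bexpB; [|exact: (bmeasX 2 bfi)|by apply: bmeasB => //; exact: bmeas_cst].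
rewrite bexpB ?bexp_cst ?bexpZ//; last exact: bmeas_cst.
rewrite (path_meanE Q_shift i bf2) (path_meanE Q_shift i bf) -/c.
by have := sqr_ge0 c; lra.
Qed.

Lemma strong_variance_le (L : eqType) (r : seq L) (f : L -> R -> R) (B S : R)
    (J : seq nat) :
  (forall l, measurable_fun setT (f l)) ->
  (forall u, \sum_(l <- r) f l u ^+ 2 <= B) -> uniq J ->
  (forall n, \sum_(1 <= l < n.+1) rho l <= S) ->
  \int[Q]_x (\sum_(l <- r)
     block_sum J (fun u => f l u - path_mean Q (f l)) x ^+ 2) <=
  (size J)%:R * (B * (1 + 4 * S)).
Proof.
move=> mf fB uJ rS.
have B0 : 0 <= B by apply: le_trans (fB 0); exact: sum_sqr_ge0.
have bf l : l \in r -> bmeas (f l) by exact: (bmeas_of_sqr_le mf fB).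
(* Lag 0 is bounded by the second moment, that is by [B]. The mixing rate is 1 at 0, so
   [2 * B * rho 0] would double the leading term and ruin the constant 11/6. *)
pose gam l := if l == 0%N then B else 2 * B * rho l.
rewrite (_ : B * (1 + 4 * S) = gam 0%N + 2 * (2 * B * S)); last first.
  by rewrite /gam /=; ring.
apply: (@block_second_moment_le _ r
    (fun l u => f l u - path_mean Q (f l)) J gam) => //.
- by move=> l lr; apply: bmeasB; [exact: bf|exact: bmeas_cst].
- by move=> l; rewrite /gam; case: ifP => // _; rewrite !mulr_ge0.
- move=> n; rewrite big_nat (eq_bigr (fun l => 2 * B * rho l)).
    by rewrite -big_nat -mulr_sumr ler_wpM2l// mulr_ge0.
  by move=> [|l] //.
move=> i j; rewrite leq_eqVlt => /predU1P[<-|ij].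
  rewrite subnn /gam eqxx.
  apply: (@le_trans _ _ (\sum_(l <- r) path_mean Q (fun u => f l u ^+ 2))).
    rewrite bexp_sum_in; last first.
      move=> l lr; apply: bmeasM; apply: bmeasB;
        by [apply: bmeas_coord; exact: bf|exact: bmeas_cst].
    rewrite big_seq [leRHS]big_seq; apply: ler_sum => l lr.
    under eq_Rintegral do rewrite -expr2.
    exact: (path_variance_le i%:Z (bf l lr)).
  rewrite /path_mean -(@bexp_sum_in _ _ _ Q _ r (fun l x => f l (x 0) ^+ 2)).
    apply: bexp_le_cst => [|x]; last exact: fB.
    by apply: bmeas_sum_in => l lr; apply: bmeasX; apply: bmeas_coord; exact: bf.
  by move=> l lr; apply: bmeasX; apply: bmeas_coord; exact: bf.
rewrite /gam ifF; last by apply/eqP; lia.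
exact: path_covariance_le.
Qed.

(* [Cov (t X_0) (t X_l)] is at most [min v0 (2 B rho_l)], hence at most the
   geometric mean of the two, which is summable. *)
Lemma weak_variance_le (t : R -> R) (B v0 S : R) (J : seq nat) :
  measurable_fun setT t -> (forall u, t u ^+ 2 <= B) ->
  path_mean Q (fun u => t u ^+ 2) <= v0 -> uniq J ->
  (forall n, \sum_(1 <= l < n.+1) Num.sqrt (rho l) <= S) ->
  \int[Q]_x (block_sum J (fun u => t u - path_mean Q t) x ^+ 2) <=
  (size J)%:R * (v0 + 2 * (Num.sqrt (2 * B * v0) * S)).
Proof.
move=> mt tB tv uJ rS.
have B0 : 0 <= B by apply: le_trans (tB 0); exact: sqr_ge0.
pose f (l : unit) := t.
have fB u : \sum_(l <- [:: tt]) f l u ^+ 2 <= B by rewrite big_seq1.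
have mf l : measurable_fun setT (f l) by [].
have bt : bmeas t.
  by apply: (bmeas_of_sqr_le mf fB (l := tt)); rewrite mem_head.
have v00 : 0 <= v0.
  apply: le_trans tv; rewrite /path_mean; apply: bexp_ge_cst => [|x].
    by apply: bmeasX; exact: bmeas_coord.
  exact: sqr_ge0.
pose gam l := if l == 0%N then v0 else Num.sqrt (2 * B * v0) * Num.sqrt (rho l).
have bti i : bmeas (fun x : PS => t (x i) - path_mean Q t).
  by apply: bmeasB; [exact: bmeas_coord|exact: bmeas_cst].
rewrite (_ : \int[Q]_x _ = \int[Q]_x (\sum_(l <- [:: tt])
    block_sum J (fun u => t u - path_mean Q t) x ^+ 2)); last first.
  by apply: eq_Rintegral => x _; rewrite big_seq1.
apply: (@block_second_moment_le _ [:: tt] (fun _ u => t u - path_mean Q t) J gam) => //.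
- by move=> l _; apply: bmeasB => //; exact: bmeas_cst.
- by move=> l; rewrite /gam; case: ifP => // _; rewrite mulr_ge0// sqrtr_ge0.
- move=> n; rewrite big_nat (eq_bigr (fun l => Num.sqrt (2 * B * v0) * Num.sqrt (rho l))).
    by rewrite -big_nat -mulr_sumr ler_wpM2l// sqrtr_ge0.
  by move=> [|l].
have cv i j : \int[Q]_x ((t (x i) - path_mean Q t) * (t (x j) - path_mean Q t)) <= v0.
  apply: (@le_trans _ _ (\int[Q]_x (2^-1 * (t (x i) - path_mean Q t) ^+ 2 +
      2^-1 * (t (x j) - path_mean Q t) ^+ 2))).
    apply: bexp_le => [||x].
    - exact: bmeasM.
    - by apply: bmeasD; apply: bmeasZ; exact: bmeasX.
    - set a := t _ - _; set b := t _ - _.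
      by have := sqr_ge0 (a - b); rewrite sqrrB; lra.
  rewrite bexpD ?bexpZ; [|exact: bmeasX|exact: bmeasX|
    by apply: bmeasZ; exact: bmeasX|by apply: bmeasZ; exact: bmeasX].
  have := path_variance_le i bt; have := path_variance_le j bt; lra.
move=> i j; rewrite leq_eqVlt => /predU1P[<-|ij].
  rewrite subnn /gam eqxx.
  by under eq_Rintegral do rewrite big_seq1; exact: cv.
rewrite /gam ifF; last by apply/eqP; lia.
have := path_covariance_le rho_ge0 Q_mixing Q_shift mf fB ij.
have E1 (G : unit -> PS -> R) :
    \int[Q]_x (\sum_(l <- [:: tt]) G l x) = \int[Q]_x G tt x.
  by apply: eq_Rintegral => x _; rewrite big_seq1.
rewrite !(E1 (fun l x => _)) /f.
have := cv i%:Z j%:Z.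
set c := \int[Q]_x _ => c1 c2.
have r0 := rho_ge0 (j - i)%N.
rewrite -sqrtrM ?mulr_ge0//.
have [c0|c0] := leP c 0; first by apply: le_trans c0 _; exact: sqrtr_ge0.
rewrite -(ger0_norm (ltW c0)) -sqrtr_sqr ler_sqrt ?mulr_ge0//.
rewrite expr2 (_ : 2 * B * v0 * _ = 2 * B * rho (j - i)%N * v0); last by ring.
by rewrite ler_pM // ltW.
Qed.

End block_moments.

(** From [1 - x <= expR (- x)] and (1 - x)(1 + x + 2 x^2) = 1 + x^2 (1 - 2 x). *)
Lemma expR_le_quadratic (R : realType) (x : R) : x <= 2^-1 ->
  expR x <= 1 + x + 2 * x ^+ 2.
Proof.
move=> x2; have x1 : 0 < 1 - x by lra.
have e1 : 1 - x <= expR (- x) by exact: expR_ge1Dx.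
have : (expR (- x))^-1 <= (1 - x)^-1 by rewrite lef_pV2// posrE expR_gt0.
rewrite -expRN opprK => /le_trans; apply.
rewrite -[leLHS]mul1r ler_pdivrMr//.
have := mulr_ge0 (sqr_ge0 x) (_ : 0 <= 1 - 2 * x); nra.
Qed.

Lemma bmeas_expR (R : realType) (d : measure_display) (T : measurableType d)
    (f : T -> R) : bmeas f -> bmeas (fun x => expR (f x)).
Proof.
move=> [mf [M fM]]; split; first exact: measurableT_comp.
exists (expR M) => x; rewrite ger0_norm ?expR_ge0// ler_expR.
exact: le_trans (ler_norm _) (fM x).
Qed.

Lemma bmeas_min1 (R : realType) (d : measure_display) (T : measurableType d)
    (f : T -> R) : measurable_fun setT f -> (forall x, 0 <= f x) ->
  bmeas (fun x => Num.min 1 (f x)).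
Proof.
move=> mf f0; split; first exact: measurable_minr.
exists 1 => x; rewrite ger0_norm ?ge_min ?lexx//.
by rewrite le_min ler01 f0.
Qed.

Section exponential_step.
Context (R : realType).
Local Notation PS := (path_space R int).
Context (Q : probability PS R) (L : eqType) (r : seq L) (g : L -> R -> R).
Context (J : seq nat) (A a B e v y lam : R).
Hypothesis mg : forall l, measurable_fun setT (g l).
Hypothesis gB : forall u, \sum_(l <- r) g l u ^+ 2 <= B.
Hypothesis g_mean : forall l (i : nat), l \in r -> \int[Q]_x g l (x i%:Z) = 0.
Hypothesis strong_var :
  \int[Q]_x (\sum_(l <- r) block_sum J (g l) x ^+ 2) <= e * (size J)%:R.
Hypothesis weak_var : forall s : L -> R,
  \int[Q]_x ((\sum_(l <- r) s l * block_sum J (g l) x) ^+ 2) <=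
  v * (size J)%:R * \sum_(l <- r) s l ^+ 2.
Hypothesis v_ge0 : 0 <= v.
Hypothesis lam_ge0 : 0 <= lam.
Hypothesis a_ge0 : 0 <= a.
Hypothesis Aa : A <= a ^+ 2.
Hypothesis y_ge0 : 0 <= y.
Hypothesis Jy : (size J)%:R ^+ 2 * B <= y ^+ 2.
Hypothesis lam_small : lam * (2 * a * y + y ^+ 2) <= 2^-1.

Lemma bmeas_g_sum (l : L) : l \in r -> bmeas (block_sum J (g l)).
Proof. by move=> lr; apply: bmeas_block_sum; exact: (bmeas_of_sqr_le mg gB). Qed.

Lemma block_sqr_norm_le (x : PS) :
  \sum_(l <- r) block_sum J (g l) x ^+ 2 <= y ^+ 2.
Proof.
apply: le_trans Jy.
apply: (@le_trans _ _ (\sum_(l <- r) (size J)%:R * \sum_(i <- J) g l (x i%:Z) ^+ 2)).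
  by apply: ler_sum => l _; exact: sqr_sum_le_size.
rewrite -mulr_sumr expr2 -mulrA ler_wpM2l// exchange_big /=.
apply: (@le_trans _ _ (\sum_(i <- J) B)); first by apply: ler_sum => i _.
by rewrite big_const_seq count_predT iter_addr_0 -[leLHS]mulr_natl.
Qed.

(** With Y the block sum, |s + Y|^2 = |s|^2 + 2 <s, Y> + |Y|^2. The cross term has mean 0, so the
    strong variance alone enters at first order in [lam]; at second order |s|^2 meets only the weak
    variance, and the strong one is multiplied by the small [y ^+ 2]. *)
Lemma exponential_step (s : L -> R) : \sum_(l <- r) s l ^+ 2 <= A ->
  \int[Q]_x expR (lam * \sum_(l <- r) (s l + block_sum J (g l) x) ^+ 2) <=
  expR (lam * \sum_(l <- r) s l ^+ 2 +
    (lam * e + lam ^+ 2 * (16 * v * A + 4 * y ^+ 2 * e)) * (size J)%:R).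
Proof.
set s2 := \sum_(l <- r) s l ^+ 2 => sA.
have s20 : 0 <= s2 by exact: sum_sqr_ge0.
pose Y2 x := \sum_(l <- r) block_sum J (g l) x ^+ 2.
pose SY x := \sum_(l <- r) s l * block_sum J (g l) x.
have Y20 x : 0 <= Y2 x by exact: sum_sqr_ge0.
have Y2y x : Y2 x <= y ^+ 2 by exact: block_sqr_norm_le.
have bY2 : bmeas Y2.
  by apply: bmeas_sum_in => l lr; apply: bmeasX; exact: bmeas_g_sum.
have bSY : bmeas SY.
  by apply: bmeas_sum_in => l lr; apply: bmeasZ; exact: bmeas_g_sum.
pose W x := 2 * SY x + Y2 x.
have bW : bmeas W by apply: bmeasD => //; exact: bmeasZ.
have WE x : \sum_(l <- r) (s l + block_sum J (g l) x) ^+ 2 = s2 + W x.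
  rewrite /s2 /W /SY /Y2 mulr_sumr -!big_split /=.
  by apply: eq_bigr => l _; ring.
have SYle x : SY x <= a * y.
  apply: le_trans (ler_norm _) _.
  rewrite -ler_sqr ?nnegrE ?mulr_ge0// real_normK ?num_real//.
  apply: le_trans (cauchy_schwarz_sum _ _ _) _.
  rewrite exprMn; apply: ler_pM; rewrite ?sum_sqr_ge0//.
    exact: le_trans sA Aa.
  exact: Y2y.
have lamW x : lam * W x <= 2^-1.
  apply: le_trans lam_small; rewrite ler_wpM2l// /W.
  by have := SYle x; have := Y2y x; lra.
have ESY : \int[Q]_x SY x = 0.
  rewrite /SY (@bexp_sum_in _ _ _ Q _ _ (fun l x => s l * block_sum J (g l) x)).
    rewrite big_seq big1// => l lr; rewrite bexpZ; last exact: bmeas_g_sum.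
    rewrite /block_sum bexp_sum; last first.
      by move=> i; apply: bmeas_coord; exact: (bmeas_of_sqr_le mg gB).
    by rewrite big1 ?mulr0// => i _; exact: g_mean.
  by move=> l lr; apply: bmeasZ; exact: bmeas_g_sum.
have e0 : 0 <= e * (size J)%:R.
  apply: le_trans strong_var; apply: bexp_ge_cst => // x; exact: Y20.
have EW2 : \int[Q]_x (W x ^+ 2) <=
    (8 * v * A + 2 * y ^+ 2 * e) * (size J)%:R.
  apply: (@le_trans _ _ (\int[Q]_x (8 * SY x ^+ 2 + 2 * y ^+ 2 * Y2 x))).
    apply: bexp_le => [||x].
    - exact: bmeasX.
    - by apply: bmeasD; apply: bmeasZ => //; exact: bmeasX.
    - rewrite /W; have := Y20 x; have := Y2y x; set p := Y2 x; set q := SY x.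
      by move=> py p0; have := sqr_ge0 (2 * q - p); nra.
  have bSY2 : bmeas (fun x => SY x ^+ 2) by exact: bmeasX.
  rewrite bexpD; [|exact: bmeasZ|exact: bmeasZ].
  rewrite (bexpZ Q _ bSY2) (bexpZ Q _ bY2).
  have H1 : \int[Q]_x (SY x ^+ 2) <= v * (size J)%:R * A.
    by apply: le_trans (weak_var s) _; rewrite ler_wpM2l// mulr_ge0.
  have H2 : y ^+ 2 * \int[Q]_x Y2 x <= y ^+ 2 * (e * (size J)%:R).
    by rewrite ler_wpM2l// sqr_ge0.
  rewrite (_ : _ * (size J)%:R = 8 * (v * (size J)%:R * A) +
    2 * (y ^+ 2 * (e * (size J)%:R))); last by ring.
  by rewrite -mulrA lerD// ler_wpM2l.
under eq_Rintegral do rewrite WE mulrDr expRD.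
have bE : bmeas (fun x => expR (lam * W x)) by apply: bmeas_expR; exact: bmeasZ.
rewrite bexpZ// expRD ler_pM2l ?expR_gt0//.
apply: (@le_trans _ _ (\int[Q]_x (1 + lam * W x + 2 * (lam * W x) ^+ 2))).
  apply: bexp_le => // [|x]; last exact: expR_le_quadratic.
  apply: bmeasD; first by apply: bmeasD; [exact: bmeas_cst|exact: bmeasZ].
  by apply: bmeasZ; apply: bmeasX; exact: bmeasZ.
apply: le_trans (expR_ge1Dx _).
rewrite (_ : \int[Q]_x _ =
    \int[Q]_x (1 + (lam * W x + 2 * lam ^+ 2 * (W x ^+ 2)))); last first.
  by apply: eq_Rintegral => x _; ring.
have bW2 : bmeas (fun x => W x ^+ 2) by exact: bmeasX.
rewrite bexpD ?bexp_cst; [|exact: bmeas_cst|by apply: bmeasD; exact: bmeasZ].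
rewrite bexpD; [|exact: bmeasZ|exact: bmeasZ].
rewrite (bexpZ Q _ bW) (bexpZ Q _ bW2).
have EW : \int[Q]_x W x = \int[Q]_x Y2 x.
  rewrite /W bexpD//; last exact: bmeasZ.
  by rewrite (bexpZ Q _ bSY) ESY mulr0 add0r.
rewrite EW lerD2l (_ : _ * (size J)%:R = lam * (e * (size J)%:R) +
  2 * lam ^+ 2 * ((8 * v * A + 2 * y ^+ 2 * e) * (size J)%:R)); last by ring.
by rewrite lerD// ler_wpM2l// mulr_ge0// sqr_ge0.
Qed.

End exponential_step.

Fixpoint concat_blocks (J : nat -> seq nat) (k : nat) : seq nat :=
  if k is k'.+1 then concat_blocks J k' ++ J k' else [::].

Section blocks_concentration.
Context (R : realType).
Local Notation PS := (path_space R int).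
Context (Q : probability PS R) (rho : nat -> R).
Hypothesis Q_mixing : forall (a b : int) (h : nat) (H : PS * PS -> R),
  (0 < h)%N -> a + h%:Z <= b -> measurable_fun setT H ->
  (forall z, 0 <= H z <= 1) -> path_depends a b H ->
  \int[Q]_x H (x, x) <= \int[Q]_x (\int[Q]_y H (x, y)) + rho h.
Context (I L : eqType) (tests : seq I) (fam : I -> seq L)
  (g : I -> L -> R -> R) (J : nat -> seq nat) (h : nat)
  (A a B e v y lam : I -> R).
Hypothesis h_gt0 : (0 < h)%N.
Hypothesis J_gap : forall k, exists b : int,
  (forall i, i \in concat_blocks J k -> i%:Z <= b) /\
  (forall j, j \in J k -> b + h%:Z <= j%:Z).
Hypothesis mg : forall t, t \in tests -> forall l, measurable_fun setT (g t l).
Hypothesis gB : forall t, t \in tests ->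
  forall u, \sum_(l <- fam t) g t l u ^+ 2 <= B t.
Hypothesis g_mean : forall t l (i : nat), t \in tests -> l \in fam t ->
  \int[Q]_x g t l (x i%:Z) = 0.
Hypothesis strong_var : forall t k, t \in tests ->
  \int[Q]_x (\sum_(l <- fam t) block_sum (J k) (g t l) x ^+ 2) <=
  e t * (size (J k))%:R.
Hypothesis weak_var : forall t k, t \in tests -> forall s : L -> R,
  \int[Q]_x ((\sum_(l <- fam t) s l * block_sum (J k) (g t l) x) ^+ 2) <=
  v t * (size (J k))%:R * \sum_(l <- fam t) s l ^+ 2.
Hypothesis e_ge0 : forall t, t \in tests -> 0 <= e t.
Hypothesis v_ge0 : forall t, t \in tests -> 0 <= v t.
Hypothesis lam_gt0 : forall t, t \in tests -> 0 < lam t.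
Hypothesis A_ge0 : forall t, t \in tests -> 0 <= A t.
Hypothesis a_ge0 : forall t, t \in tests -> 0 <= a t.
Hypothesis Aa : forall t, t \in tests -> A t <= a t ^+ 2.
Hypothesis y_ge0 : forall t, t \in tests -> 0 <= y t.
Hypothesis Jy : forall t k, t \in tests ->
  (size (J k))%:R ^+ 2 * B t <= y t ^+ 2.
Hypothesis lam_small : forall t, t \in tests ->
  lam t * (2 * a t * y t + y t ^+ 2) <= 2^-1.

Definition sqr_norm (t : I) (K : seq nat) (x : PS) : R :=
  \sum_(l <- fam t) block_sum K (g t l) x ^+ 2.

(** Increase of the exponent per observation in [exponential_step]. *)
Definition growth (t : I) : R :=
  lam t * e t + lam t ^+ 2 * (16 * v t * A t + 4 * y t ^+ 2 * e t).

Lemma growth_ge0 t : t \in tests -> 0 <= growth t.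
Proof.
move=> tt; have l0 := ltW (lam_gt0 tt); have e0 := e_ge0 tt.
have v0 := v_ge0 tt; have A0 := A_ge0 tt.
apply: addr_ge0; first exact: mulr_ge0.
apply: mulr_ge0; first exact: sqr_ge0.
by rewrite addr_ge0 ?mulr_ge0 ?exprn_ge0 ?y_ge0.
Qed.

Lemma measurable_block_sum t K l : t \in tests ->
  measurable_fun setT (block_sum K (g t l)).
Proof.
move=> tt; rewrite /block_sum.
apply: measurable_sum => i.
by apply: measurableT_comp; [exact: mg|exact: measurable_coord].
Qed.

Lemma measurable_sqr_norm_shift t K (s : PS * PS -> L -> R) :
  t \in tests -> (forall l, measurable_fun setT (s ^~ l)) ->
  measurable_fun setT (fun z : PS * PS =>
    \sum_(l <- fam t) (s z l + block_sum K (g t l) z.2) ^+ 2).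
Proof.
move=> tt ms; apply: measurable_sum => l; apply: measurable_funX.
apply: measurable_funD; first exact: ms.
exact: (measurableT_comp (measurable_block_sum K l tt) measurable_snd).
Qed.

Lemma measurable_exp_sum (d : measure_display) (T : measurableType d)
    (F : I -> T -> R) :
  (forall t, t \in tests -> measurable_fun setT (F t)) ->
  measurable_fun setT (fun z => \sum_(t <- tests) expR (F t z)).
Proof.
elim: tests => [|t s IH] mF.
  by rewrite (_ : (fun z => _) = cst 0);
    [exact: measurable_cst|apply/funext => z; rewrite big_nil].
rewrite (_ : (fun z => _) = (fun z => expR (F t z) + \sum_(t <- s) expR (F t z))).
  apply: measurable_funD.
    by apply: measurableT_comp => //; apply: mF; rewrite mem_head.
  by apply: IH => u us; apply: mF; rewrite in_cons us orbT.
by apply/funext => z; rewrite big_cons.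
Qed.

Lemma exp_sum_ge0 (F : I -> R) : 0 <= \sum_(t <- tests) expR (F t).
Proof. by apply: sumr_ge0 => t _; exact: expR_ge0. Qed.

Lemma bmeas_min_exp_sum (d : measure_display) (T : measurableType d)
    (F : I -> T -> R) :
  (forall t, t \in tests -> measurable_fun setT (F t)) ->
  bmeas (fun z => Num.min 1 (\sum_(t <- tests) expR (F t z))).
Proof.
by move=> mF; apply: bmeas_min1; [exact: measurable_exp_sum|
  move=> z; exact: exp_sum_ge0].
Qed.

Lemma measurable_sqr_norm t K : t \in tests ->
  measurable_fun setT (sqr_norm t K).
Proof.
move=> tt; apply: measurable_sum => l; apply: measurable_funX.
exact: measurable_block_sum.
Qed.

(* Averaging out the last block, with the past frozen at the value [s]: the cap
   at 1 makes the bound trivial as soon as some [|s|^2] exceeds [A t]. *)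
Lemma capped_step (k : nat) (s : I -> L -> R) (c : I -> R) :
  (forall t, t \in tests -> - (lam t * A t) <= c t) ->
  \int[Q]_x Num.min 1 (\sum_(t <- tests) expR (lam t *
      (\sum_(l <- fam t) (s t l + block_sum (J k) (g t l) x) ^+ 2) + c t)) <=
  Num.min 1 (\sum_(t <- tests) expR (lam t * (\sum_(l <- fam t) s t l ^+ 2) +
    (c t + growth t * (size (J k))%:R))).
Proof.
move=> cA.
have mF t : t \in tests -> measurable_fun setT (fun x : PS => lam t *
    (\sum_(l <- fam t) (s t l + block_sum (J k) (g t l) x) ^+ 2) + c t).
  move=> tt; apply: measurable_funD; last exact: measurable_cst.
  apply: measurable_funM; first exact: measurable_cst.
  apply: measurable_sum => l; apply: measurable_funX.
  by apply: measurable_funD; [exact: measurable_cst|exact: measurable_block_sum].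
have bF := bmeas_min_exp_sum mF.
have [S1|S1] := leP 1 (\sum_(t <- tests) expR (lam t * (\sum_(l <- fam t) s t l ^+ 2) +
    (c t + growth t * (size (J k))%:R))).
  by apply: bexp_le_cst => // x; rewrite ge_min lexx.
(* A sum below 1 makes each exponent negative; [cA] and the sign of [growth] turn this into the
   bound on |s|^2 that [exponential_step] requires. *)
have sA t : t \in tests -> \sum_(l <- fam t) s t l ^+ 2 <= A t.
  move=> tt; have lt1 : expR (lam t * (\sum_(l <- fam t) s t l ^+ 2) +
      (c t + growth t * (size (J k))%:R)) < 1.
    apply: le_lt_trans S1; rewrite (big_rem t)//= lerDl.
    by apply: sumr_ge0 => u _; exact: expR_ge0.
  move: lt1; rewrite expR_lt1 => lt0.
  rewrite -(ler_pM2l (lam_gt0 tt)).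
  have c1 := cA t tt; have c2 := mulr_ge0 (growth_ge0 tt) (ler0n R (size (J k))).
  by lra.
have bE t : t \in tests -> bmeas (fun x : PS => expR (lam t *
    (\sum_(l <- fam t) (s t l + block_sum (J k) (g t l) x) ^+ 2) + c t)).
  move=> tt; apply: bmeas_expR; apply: bmeasD; last exact: bmeas_cst.
  apply: bmeasZ; apply: bmeas_sum_in => l lr; apply: bmeasX.
  apply: bmeasD; first exact: bmeas_cst.
  exact: (bmeas_g_sum (J k) (mg tt) (gB tt) lr).
apply: (@le_trans _ _ (\int[Q]_x \sum_(t <- tests) expR (lam t *
    (\sum_(l <- fam t) (s t l + block_sum (J k) (g t l) x) ^+ 2) + c t))).
  apply: bexp_le => // [|x]; first exact: bmeas_sum_in.
  by rewrite ge_min lexx orbT.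
rewrite (@bexp_sum_in _ _ _ Q _ _ (fun t x => expR (lam t *
    (\sum_(l <- fam t) (s t l + block_sum (J k) (g t l) x) ^+ 2) + c t)))//.
rewrite big_seq [leRHS]big_seq; apply: ler_sum => t tt.
under eq_Rintegral do rewrite expRD mulrC.
have bE' : bmeas (fun x : PS => expR (lam t *
    (\sum_(l <- fam t) (s t l + block_sum (J k) (g t l) x) ^+ 2))).
  apply: bmeas_expR.
  apply: bmeasZ; apply: bmeas_sum_in => l lr; apply: bmeasX.
  apply: bmeasD; first exact: bmeas_cst.
  exact: (bmeas_g_sum (J k) (mg tt) (gB tt) lr).
rewrite (bexpZ Q _ bE') addrCA expRD ler_pM2l ?expR_gt0//.
apply: (@exponential_step _ Q _ (fam t) (g t) (J k) (A t) (a t) (B t) (e t)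
  (v t) (y t) (lam t)) => //.
- exact: mg.
- exact: gB.
- by move=> l i lr; exact: g_mean.
- exact: strong_var.
- exact: weak_var.
- exact: v_ge0.
- exact/ltW/lam_gt0.
- exact: a_ge0.
- exact: Aa.
- exact: y_ge0.
- exact: Jy.
- exact: lam_small.
- exact: sA.
Qed.

Lemma block_sum_cat (K K' : seq nat) (f : R -> R) (x : PS) :
  block_sum (K ++ K') f x = block_sum K f x + block_sum K' f x.
Proof. by rewrite /block_sum big_cat. Qed.

(** The constants [c] are generalized because each averaged block transfers its growth to them,
    which preserves their lower bound. The capped sum is a single test function, so a block costs
    one [rho h] whatever the number of tests. *)
Lemma capped_recursion (k : nat) (c : I -> R) :
  (forall t, t \in tests -> - (lam t * A t) <= c t) ->
  \int[Q]_x Num.min 1 (\sum_(t <- tests)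
     expR (lam t * sqr_norm t (concat_blocks J k) x + c t)) <=
  \sum_(t <- tests) expR (c t + growth t * (size (concat_blocks J k))%:R) +
  k%:R * rho h.
Proof.
elim: k c => [|k IH] c cA.
  rewrite mul0r addr0; apply: bexp_le_cst => [|x].
    apply: bmeas_min_exp_sum => t tt; apply: measurable_funD; last exact: measurable_cst.
    by apply: measurable_funM; [exact: measurable_cst|exact: measurable_sqr_norm].
  rewrite ge_min; apply/orP; right; apply: ler_sum => t _.
  rewrite /sqr_norm big1 ?mulr0 ?add0r ?addr0// => l _.
  by rewrite /block_sum /= big_nil expr0n.
pose H (z : PS * PS) := Num.min 1 (\sum_(t <- tests) expR (lam t *
  (\sum_(l <- fam t) (block_sum (concat_blocks J k) (g t l) z.1 +
     block_sum (J k) (g t l) z.2) ^+ 2) + c t)).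
have bH : bmeas H.
  apply: bmeas_min_exp_sum => t tt; apply: measurable_funD; last exact: measurable_cst.
  apply: measurable_funM; first exact: measurable_cst.
  apply: measurable_sqr_norm_shift => // l.
  exact: (measurableT_comp (measurable_block_sum _ l tt) measurable_fst).
have H01 z : 0 <= H z <= 1.
  by rewrite /H ge_min lexx le_min ler01 exp_sum_ge0.
have [b [pb fb]] := J_gap k.
have dH : path_depends b (b + h%:Z) H.
  move=> x x' z z' xx zz; rewrite /H /=; congr (Num.min 1 _).
  apply: eq_bigr => t _; congr expR; congr (_ + _); congr (_ * _).
  apply: eq_bigr => l _.
  congr ((_ + _) ^+ 2); rewrite /block_sum big_seq [RHS]big_seq.
    by apply: eq_bigr => i ik; rewrite xx//; exact: pb.
  by apply: eq_bigr => i ik; rewrite zz//; exact: fb.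
have := Q_mixing h_gt0 (lexx _) bH.1 H01 dH.
under [X in X <= _ -> _]eq_Rintegral => x _.
  rewrite /H /=.
  under eq_bigr do under eq_bigr do rewrite -block_sum_cat.
  over.
move=> /le_trans; apply.
rewrite -natr1 mulrDl mul1r addrA lerD2r.
pose c' t := c t + growth t * (size (J k))%:R.
have c'A t : t \in tests -> - (lam t * A t) <= c' t.
  move=> tt; apply: le_trans (cA t tt) _.
  by rewrite lerDl mulr_ge0// growth_ge0.
apply: le_trans (le_trans (IH _ c'A) _); last first.
  rewrite lerD2r; apply: ler_sum => t _; rewrite /c' /= size_cat natrD.
  by rewrite mulrDr -addrA [X in c t + X]addrC.
apply: bexp_le => [||x].
- exact: bmeas_fubini.
- apply: bmeas_min_exp_sum => t tt; apply: measurable_funD; last exact: measurable_cst.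
  by apply: measurable_funM; [exact: measurable_cst|exact: measurable_sqr_norm].
- exact: (capped_step k (fun t l => block_sum (concat_blocks J k) (g t l) x) cA).
Qed.

Theorem blocks_deviation (k : nat) (T : R) :
  (size (concat_blocks J k))%:R <= T ->
  \int[Q]_x Num.min 1 (\sum_(t <- tests)
     expR (lam t * (sqr_norm t (concat_blocks J k) x - A t))) <=
  \sum_(t <- tests) expR (- (lam t * A t) + growth t * T) + k%:R * rho h.
Proof.
move=> kT.
under eq_Rintegral do under eq_bigr do rewrite mulrBr.
apply: le_trans (capped_recursion (c := fun t => - (lam t * A t)) k _) _ => //.
rewrite lerD2r big_seq [leRHS]big_seq; apply: ler_sum => t tt.
by rewrite ler_expR lerD2l ler_wpM2l// growth_ge0.
Qed.

End blocks_concentration.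

(** * Orthonormal systems *)

Section square_integrable.
Context (R : realType).
Local Notation mu := (@lebesgue_measure R).
Local Notation L2 := (Lfun mu 2%:E).
Implicit Types f g u : R -> R.

Lemma L2_measurable f : f \in L2 -> measurable_fun setT f.
Proof. by rewrite inE => /andP[]; rewrite inE. Qed.

Lemma L2D f g : f \in L2 -> g \in L2 -> (fun x => f x + g x) \in L2.
Proof.
move=> f2 g2; have p1 : (1 <= 2%:E :> \bar R)%E by rewrite lee_fin ler1n.
exact: ((Lfun_addr_closed mu p1).2 f g f2 g2).
Qed.

Lemma L2Z (c : R) f : f \in L2 -> (fun x => c * f x) \in L2.
Proof.
move=> f2; rewrite (_ : (fun x => _) = c \o* f).
  by apply: Lfun_scale => //; rewrite ler1n.
by apply/funext => x /=; rewrite mulrC.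
Qed.

Lemma L2B f g : f \in L2 -> g \in L2 -> (fun x => f x - g x) \in L2.
Proof.
move=> f2 g2; rewrite (_ : (fun x => _) = (fun x => f x + (-1) * g x)).
  by apply: L2D => //; exact: L2Z.
by apply/funext => x; rewrite mulN1r.
Qed.

Lemma L2_sum (L : Type) (r : seq L) (a : L -> R) (psi : L -> R -> R) :
  (forall l, psi l \in L2) -> (fun x => \sum_(l <- r) a l * psi l x) \in L2.
Proof.
move=> psi2; elim: r => [|l r IH].
  rewrite (_ : (fun x => _) = (fun x => 0 * \sum_(l <- [::]) psi l x)).
    have p1 : (1 <= 2%:E :> \bar R)%E by rewrite lee_fin ler1n.
    rewrite (_ : (fun x => _) = (0 : R -> R)).
      exact: (Lfun_addr_closed mu p1).1.
    by apply/funext => x; rewrite mul0r.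
  by apply/funext => x; rewrite !big_nil mul0r.
rewrite (_ : (fun x => _) = (fun x => a l * psi l x + \sum_(j <- r) a j * psi j x)).
  by apply: L2D => //; exact: L2Z.
by apply/funext => x; rewrite big_cons.
Qed.

Lemma L2_mul_integrable f g : f \in L2 -> g \in L2 ->
  mu.-integrable setT (EFin \o (fun x => f x * g x)).
Proof. by move=> f2 g2; apply/Lfun1_integrable; exact: Lfun2_mul_Lfun1. Qed.

Lemma dotL2C f g : dotL2 f g = dotL2 g f.
Proof. by apply: eq_Rintegral => x _; rewrite mulrC. Qed.

Lemma dotL2D f g u : f \in L2 -> g \in L2 -> u \in L2 ->
  dotL2 (fun x => f x + g x) u = dotL2 f u + dotL2 g u.
Proof.
move=> f2 g2 u2; rewrite /dotL2 -RintegralD//; try exact: L2_mul_integrable.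
by apply: eq_Rintegral => x _; rewrite mulrDl.
Qed.

Lemma dotL2Z (c : R) f u : f \in L2 -> u \in L2 ->
  dotL2 (fun x => c * f x) u = c * dotL2 f u.
Proof.
move=> f2 u2; rewrite /dotL2 -RintegralZl//; try exact: L2_mul_integrable.
by apply: eq_Rintegral => x _; rewrite mulrA.
Qed.

Lemma dotL2B f g u : f \in L2 -> g \in L2 -> u \in L2 ->
  dotL2 (fun x => f x - g x) u = dotL2 f u - dotL2 g u.
Proof.
move=> f2 g2 u2; rewrite /dotL2 -RintegralB//; try exact: L2_mul_integrable.
by apply: eq_Rintegral => x _; rewrite mulrBl.
Qed.

Lemma dotL2_sum (L : Type) (r : seq L) (a : L -> R) (psi : L -> R -> R) u :
  (forall l, psi l \in L2) -> u \in L2 ->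
  dotL2 (fun x => \sum_(l <- r) a l * psi l x) u =
  \sum_(l <- r) a l * dotL2 (psi l) u.
Proof.
move=> psi2 u2; elim: r => [|l r IH].
  rewrite big_nil /dotL2 /Rintegral integral0_eq// => x _.
  by rewrite big_nil mul0r.
rewrite big_cons -IH -dotL2Z// -dotL2D//; [|exact: L2Z|exact: L2_sum].
by apply: eq_Rintegral => x _; rewrite big_cons.
Qed.

Lemma Lpnorm2_sqr u : u \in L2 -> (Lpnorm 2%:E u ^+ 2 = (dotL2 u u)%:E)%E.
Proof.
move=> u2.
have E : (\int[mu]_x (`|(u x)%:E| `^ 2) = (dotL2 u u)%:E)%E.
  rewrite fineK; last first.
    by apply: integrable_fin_num => //; exact: L2_mul_integrable.
  apply: eq_integral => x _.
  by rewrite poweR_EFin powR_mulrn// -normrX ger0_norm ?sqr_ge0// expr2.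
rewrite /Lpnorm unlock /Lnorm E poweR_EFin expe2 -EFinM; congr (_%:E).
rewrite -expr2 -powR_mulrn ?powR_ge0// -powRrM mulVf ?pnatr_eq0// powRr1//.
by apply: Rintegral_ge0 => x _; rewrite -expr2 sqr_ge0.
Qed.

Lemma Lpnorm2E u : u \in L2 -> (Lpnorm 2%:E u = (Num.sqrt (dotL2 u u))%:E)%E.
Proof.
move=> u2.
have d0 : 0 <= dotL2 u u by apply: Rintegral_ge0 => x _; rewrite -expr2 sqr_ge0.
have E := Lpnorm2_sqr u2; have N0 : (0 <= Lpnorm 2%:E u)%E by exact: Lnorm_ge0.
move: E; rewrite expe2; case: (Lpnorm 2%:E u) N0 => [a| |] //.
by rewrite -EFinM lee_fin => a0 [<-]; rewrite -expr2 sqrtr_sqr ger0_norm.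
Qed.

Section orthonormal.
Context (L : choiceType) (psi : L -> R -> R).
Hypothesis psi_on : orthonormal_system psi.

Lemma dotL2_orthonormal_sum (r : seq L) (a : L -> R) (l : L) : uniq r ->
  dotL2 (fun x => \sum_(j <- r) a j * psi j x) (psi l) =
  if l \in r then a l else 0.
Proof.
move=> ur; rewrite dotL2_sum; [|exact: psi_on.1|exact: psi_on.1].
under eq_bigr do rewrite psi_on.2.
case: ifPn => lr; last first.
  rewrite big_seq big1// => j jr; rewrite (_ : j == l = false) ?mulr0//.
  by apply/eqP => jl; move: lr; rewrite -jl jr.
rewrite (bigD1_seq l)//= eqxx mulr1 big1 ?addr0// => j /negbTE ->.
by rewrite mulr0.
Qed.

Lemma dotL2_sum_self (r : seq L) (a : L -> R) : uniq r ->
  dotL2 (fun x => \sum_(j <- r) a j * psi j x)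
        (fun x => \sum_(j <- r) a j * psi j x) = \sum_(j <- r) a j ^+ 2.
Proof.
move=> ur.
rewrite {1}dotL2_sum; [|exact: psi_on.1|by apply: L2_sum; exact: psi_on.1].
rewrite big_seq [RHS]big_seq; apply: eq_bigr => l lr.
by rewrite dotL2C dotL2_orthonormal_sum// lr expr2.
Qed.

Lemma dotL2_sum_sub (s : R -> R) (r : seq L) (a : L -> R) :
  s \in L2 -> uniq r ->
  dotL2 (fun x => \sum_(j <- r) a j * psi j x - s x)
        (fun x => \sum_(j <- r) a j * psi j x - s x) =
  dotL2 s s - 2 * \sum_(j <- r) a j * dotL2 (psi j) s + \sum_(j <- r) a j ^+ 2.
Proof.
move=> s2 ur; set t := fun x => \sum_(j <- r) a j * psi j x.
have t2 : t \in L2 by apply: L2_sum; exact: psi_on.1.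
have ts2 : (fun x => t x - s x) \in L2 by exact: L2B.
rewrite (dotL2B (f := t))// ![dotL2 _ (fun x => t x - s x)]dotL2C.
rewrite !(dotL2B (f := t))// [dotL2 s t]dotL2C dotL2_sum_self//.
rewrite {1 2}/t dotL2_sum//; last exact: psi_on.1.
by ring.
Qed.

Lemma orth_proj_coef (s : R -> R) (m : {fset L}) (sm : R -> R) :
  s \in L2 -> is_orth_proj (model psi m) s sm ->
  sm = fun x => \sum_(l <- m) dotL2 (psi l) s * psi l x.
Proof.
move=> s2 [[a ->] orth].
have aE l : l \in m -> a l = dotL2 (psi l) s.
  move=> lm; have : model psi m (psi l).
    exists (fun j => (j == l)%:R); apply/funext => x.
    rewrite (bigD1_seq l)//= eqxx mul1r big1 ?addr0// => j /negbTE ->.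
    by rewrite mul0r.
  move=> /orth; rewrite dotL2B//; [|by apply: L2_sum; exact: psi_on.1|exact: psi_on.1].
  by rewrite dotL2_orthonormal_sum// lm dotL2C => /subr0_eq.
apply/funext => x; rewrite big_seq [RHS]big_seq.
by apply: eq_bigr => l lm; rewrite aE.
Qed.

(** Gives the dimension at which [M_2] is instantiated; linear independence comes from
    orthonormality. *)
Lemma has_dim_model (m : {fset L}) : has_dim (model psi m) #|` m|.
Proof.
pose b (i : 'I_(size m)) := psi (tnth (in_tuple m) i).
have inj : injective (tnth (in_tuple m)).
  by apply/tuple_uniqP; exact: fset_uniq.
exists b; split.
  move=> a a0 i.
  have : dotL2 (fun x => \sum_(i < size m) a i * b i x) (b i) = 0.
    rewrite /dotL2 /Rintegral integral0_eq// => x _.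
    by rewrite a0 mul0r.
  rewrite (dotL2_sum _ a (psi := b)); last 2 first.
    by move=> j; exact: psi_on.1.
    exact: psi_on.1.
  rewrite (bigD1 i)//= /b psi_on.2 eqxx mulr1 big1 ?addr0// => j ji.
  by rewrite psi_on.2 (inj_eq inj) (negbTE ji) mulr0.
apply/seteqP; split => [_ [a ->]|_ [a ->]].
  exists (fun i => a (tnth (in_tuple m) i)); apply/funext => x.
  by rewrite big_tnth.
(* Coefficients carried back along the enumeration of [m]: by injectivity one term of the sum
   survives. *)
pose a' l := \sum_(i < size m) (tnth (in_tuple m) i == l)%:R * a i.
exists a'; apply/funext => x; rewrite [RHS]big_tnth.
apply: eq_bigr => i _; congr (_ * _); rewrite /a' (bigD1 i)//= eqxx mul1r.
rewrite big1 ?addr0// => j ji.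
by rewrite (inj_eq inj) (negbTE ji) mul0r.
Qed.

Lemma subspace_sum_model (m : {fset L}) :
  subspace_sum (model psi m) (model psi m) = model psi m.
Proof.
apply/seteqP; split => [_ [_ [a ->] [_ [b ->] <-]]|_ [a ->]].
  exists (fun l => a l + b l); apply/funext => x /=.
  by rewrite -big_split; apply: eq_bigr => l _; rewrite mulrDl.
exists (fun x => \sum_(l <- m) a l * psi l x); first by exists a.
exists (fun x => \sum_(l <- m) 0 * psi l x); first by exists (fun=> 0).
by apply/funext => x /=; rewrite -mulr_sumr mul0r addr0.
Qed.

End orthonormal.
End square_integrable.

Section density.
Context (R : realType).
Local Notation mu := (@lebesgue_measure R).

(** The change of variables holds for the Radon-Nikodym derivative, which agrees with [s] almost
    everywhere because both have the same integrals. *)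
Lemma bexp_density (nu : probability (measurableTypeR R) R) (s f : R -> R) :
  measurable_fun setT s -> (forall x, 0 <= s x) ->
  (forall A, measurable A -> nu A = \int[mu]_(x in A) (s x)%:E)%E ->
  bmeas f -> \int[nu]_x f x = \int[mu]_x (f x * s x).
Proof.
move=> ms s0 nus bf; rewrite /Rintegral; congr fine.
have numu : nu `<< mu.
  apply/null_content_dominatesP => A mA A0; rewrite nus//.
  apply: null_set_integral => //.
  by apply: measurable_funTS; exact/measurable_EFinP.
rewrite -(Radon_Nikodym_change_of_variables numu)//=; last exact: bmeas_integrable.
apply: ae_eq_integral => //.
- apply: emeasurable_funM; first by apply/measurable_EFinP; exact: bf.1.
  by apply: (measurable_int mu); exact: Radon_Nikodym_integrable.
- by apply/measurable_EFinP; apply: measurable_funM => //; exact: bf.1.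
- rewrite (_ : (fun x => (f x * s x)%:E) = (fun x => (f x)%:E * (s x)%:E)%E)//.
  apply: ae_eqe_mul2l => /=.
  rewrite Radon_NikodymE//=; case: cid => /= k [k1 k2 k3].
  apply: integral_ae_eq => //=.
  + by apply/measurable_EFinP.
  + by move=> E _ mE; rewrite -k3//= nus.
Qed.

Lemma bexp_RV_density (d : measure_display) (Om : measurableType d)
    (P : probability Om R) (X : {RV P >-> R}) (s f : R -> R) :
  measurable_fun setT s -> (forall x, 0 <= s x) ->
  (forall A, measurable A ->
    distribution P X A = \int[mu]_(x in A) (s x)%:E)%E ->
  bmeas f -> \int[P]_w f (X w) = \int[mu]_x (f x * s x).
Proof.
move=> ms s0 Ps bf.
have mX : measurable_fun setT (X : Om -> measurableTypeR R).
  exact: (measurable_funP X).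
pose X' : {RV P >-> measurableTypeR R} :=
  mfun_Sub (mem_set mX : (X : Om -> measurableTypeR R) \in mfun).
have bf' : @bmeas R _ (measurableTypeR R) f by exact: bf.
rewrite -(@bexp_density (distribution P X') s f ms s0 Ps bf').
rewrite /Rintegral; congr fine; rewrite integral_distribution//=.
- by apply/measurable_EFinP; exact: bf'.1.
- by apply: bmeas_integrable; exact: (bmeas_comp bf' mX).
Qed.

End density.

Section sup_bound.
Context (R : realType).
Local Notation mu := (@lebesgue_measure R).
Local Notation L2 := (Lfun mu 2%:E).

(* Rational coefficients, so that only countably many null sets are involved
   when the assumption [M_2] is applied. *)
Lemma sum_sqr_le_rational (L : eqType) (r : seq L) (u : L -> R) (C2 : R) :
  uniq r -> 0 <= C2 ->
  (forall q : seq rat,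
    (\sum_(l <- r) ratr (nth 0 q (index l r)) * u l) ^+ 2 <=
    C2 * \sum_(l <- r) (ratr (nth 0 q (index l r)) : R) ^+ 2) ->
  \sum_(l <- r) u l ^+ 2 <= C2.
Proof.
move=> ur C20 H; set T := \sum_(l <- r) u l ^+ 2.
have T0 : 0 <= T by exact: sum_sqr_ge0.
pose S := \sum_(l <- r) `|u l|; have S0 : 0 <= S by exact: sumr_ge0.
pose K := 2 * T * S + C2 * (2 * S + (size r)%:R).
have K0 : 0 <= K by rewrite addr_ge0 ?mulr_ge0// addr_ge0 ?mulr_ge0.
(* The coefficients are taken close to [u] itself, the equality case of Cauchy-Schwarz: the sums [G]
   and [N] are then both close to [T], and [K] collects the errors. Letting [e] tend to 0 leaves
   [T ^+ 2 <= C2 * T]. *)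
have approx (e : R) : 0 < e -> e <= 1 -> T ^+ 2 <= C2 * T + e * K.
  move=> e0 e1.
  have /choice[q qP] l : exists q : rat, u l < ratr q < u l + e.
    have [q] := rat_in_itvoo (ltr_pwDr e0 (lexx (u l))).
    by rewrite in_itv /= => qe; exists q.
  have nq l : l \in r -> nth 0 [seq q l | l <- r] (index l r) = q l.
    by move=> lr; rewrite (nth_map l) ?index_mem// nth_index.
  have := H [seq q l | l <- r].
  have -> : \sum_(l <- r) ratr [seq q l | l <- r]`_(index l r) * u l =
      \sum_(l <- r) ratr (q l) * u l.
    by apply: eq_big_seq => l lr; rewrite nq.
  have -> : \sum_(l <- r) (ratr [seq q l | l <- r]`_(index l r) : R) ^+ 2 =
      \sum_(l <- r) ratr (q l) ^+ 2.
    by apply: eq_big_seq => l lr; rewrite nq.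
  set G := \sum_(l <- r) _; set N := \sum_(l <- r) _ => GN.
  have G1 : T - e * S <= G.
    rewrite mulr_sumr -sumrB; apply: ler_sum => l _.
    have /andP[q1 q2] := qP l.
    have -> : ratr (q l) * u l = u l ^+ 2 + (ratr (q l) - u l) * u l by ring.
    rewrite lerD2l lerNl -mulNr; apply: le_trans (ler_norm _) _.
    rewrite normrM ler_wpM2r// normrN ger0_norm; lra.
  have N1 : N <= T + e * (2 * S + (size r)%:R).
    rewrite mulrDr mulrA [e * 2]mulrC mulr_sumr.
    have -> : e * (size r)%:R = \sum_(l <- r) e.
      by rewrite big_const_seq count_predT iter_addr_0 mulr_natr.
    rewrite -!big_split /=; apply: ler_sum => l _.
    have /andP[q1 q2] := qP l.
    pose d := ratr (q l) - u l; have -> : ratr (q l) = u l + d by rewrite /d; ring.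
    have d0 : 0 <= d by rewrite /d; lra.
    have de : d <= e by rewrite /d; lra.
    have ud : u l * d <= e * `|u l|.
      apply: (@le_trans _ _ (`|u l| * d)); first by rewrite ler_wpM2r// ler_norm.
      by rewrite mulrC ler_wpM2r.
    by nra.
  have N2 := ler_wpM2l C20 N1.
  have [TS|TS] := leP (e * S) T.
    have : (T - e * S) ^+ 2 <= G ^+ 2 by rewrite ler_sqr ?nnegrE; lra.
    have := sqr_ge0 (e * S); rewrite /K; nra.
  rewrite /K; have : T ^+ 2 <= e * (T * S) by rewrite expr2 mulrCA ler_wpM2l// ltW.
  have := mulr_ge0 (ltW e0) (mulr_ge0 T0 S0).
  have := mulr_ge0 C20 T0.
  have : 0 <= e * (C2 * (2 * S + (size r)%:R)).
    by apply: mulr_ge0; [exact: ltW|apply: mulr_ge0 => //;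
      apply: addr_ge0 => //; exact: mulr_ge0].
  lra.
have T2 : T ^+ 2 <= C2 * T.
  apply/ler_addgt0Pr => e e0.
  pose e' := Num.min 1 (e / (K + 1)).
  have K1 : 0 < K + 1 by lra.
  have e'0 : 0 < e' by rewrite /e' lt_min ltr01 divr_gt0.
  have e'1 : e' <= 1 by rewrite /e' ge_min lexx.
  apply: le_trans (approx _ e'0 e'1) _; rewrite lerD2l.
  apply: (@le_trans _ _ (e / (K + 1) * K)).
    by rewrite ler_wpM2r// /e' ge_min lexx orbT.
  by rewrite mulrAC ler_pdivrMr//; nra.
have [->//|Tn0] := eqVneq T 0.
have Tgt0 : 0 < T by rewrite lt_def Tn0.
by rewrite -(ler_pM2r Tgt0) -expr2.
Qed.

Context (L : choiceType) (psi : L -> R -> R).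
Hypothesis psi_on : orthonormal_system psi.

Lemma M2_ae_bound (Phi : R) (M : set {fset L}) (m : {fset L}) (a : L -> R) :
  assumption_M2 psi Phi M -> M m ->
  \forall x \ae mu, (\sum_(l <- m) a l * psi l x) ^+ 2 <=
    (Phi ^+ 2 * #|` m|%:R) * \sum_(l <- m) a l ^+ 2.
Proof.
move=> M2 Mm; set t := fun x => \sum_(l <- m) a l * psi l x.
have t2 : t \in L2 by apply: L2_sum; exact: psi_on.1.
have tm : model psi m t by exists a.
have zm : model psi m (cst 0).
  exists (fun=> 0); apply/funext => x.
  by rewrite -mulr_sumr mul0r.
have hd : has_dim (subspace_sum (model psi m) (model psi m)) #|` m|.
  by rewrite subspace_sum_model; exact: has_dim_model.
have := M2 m m Mm Mm t (cst 0) tm zm _ hd.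
have -> : (t \+ cst 0)%R = t by apply/funext => x /=; rewrite addr0.
rewrite (Lpnorm2E t2) (dotL2_sum_self psi_on a (fset_uniq m)).
(* The norm of index [+oo] is an essential supremum only on a space of positive measure. *)
have mT : (0 < mu setT)%E.
  apply: (@lt_le_trans _ _ (mu `[0%R, 1%R])).
    by rewrite lebesgue_measure_itv /= lte01 oppr0 adde0 lte01.
  by apply: le_measure; rewrite ?inE.
rewrite /Lpnorm unlock /Lnorm mT -EFinM => /ess_supP.
apply: filterS => x /=; rewrite lee_fin => tx.
rewrite -/(t x) -(real_normK (num_real (t x))).
set A := \sum_(l <- m) a l ^+ 2 in tx *.
have A0 : 0 <= A by exact: sum_sqr_ge0.
have : `|t x| ^+ 2 <= (Phi * Num.sqrt #|` m|%:R * Num.sqrt A) ^+ 2.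
  by rewrite ler_sqr ?nnegrE// (le_trans _ tx).
by rewrite !exprMn !sqr_sqrtr.
Qed.

(** By duality, the sum of the squares at [x] is the squared norm of the evaluation at [x] on the
    model, and [M_2] bounds this evaluation for almost every [x]. *)
Lemma M2_sup_bound (Phi : R) (M : set {fset L}) (m : {fset L}) :
  assumption_M2 psi Phi M -> M m ->
  exists E : set R, [/\ measurable E, mu E = 0%E &
    forall x, ~ E x -> \sum_(l <- m) psi l x ^+ 2 <= Phi ^+ 2 * #|` m|%:R].
Proof.
move=> M2 Mm.
(* Enumeration of the rational coefficient vectors: the list coded by [n], empty if there is none
   and padded with 0, read along the order of [m]. *)
pose coef (n : nat) (l : L) : R :=
  ratr (nth 0 (odflt [::] (@choice.unpickle (seq rat) n)) (index l m)).
have [E [mE E0 PE]] : \forall x \ae mu, forall n,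
    (\sum_(l <- m) coef n l * psi l x) ^+ 2 <=
    (Phi ^+ 2 * #|` m|%:R) * \sum_(l <- m) coef n l ^+ 2.
  by apply: ae_foralln => n; exact: (M2_ae_bound (coef n) M2 Mm).
exists E; split => // x Ex.
apply: sum_sqr_le_rational; [exact: fset_uniq|by rewrite mulr_ge0 ?sqr_ge0|].
move=> q; have [H|nH] := pselect (forall n,
    (\sum_(l <- m) coef n l * psi l x) ^+ 2 <=
    (Phi ^+ 2 * #|` m|%:R) * \sum_(l <- m) coef n l ^+ 2).
  by have := H (choice.pickle q); rewrite /coef choice.pickleK.
by exfalso; apply: Ex; apply: PE => /=.
Qed.

End sup_bound.

(** * Deviations of the empirical coefficients *)

Section mixing_rate.
Context (R : realType) (theta : R).
Hypothesis theta_gt2 : 2 < theta.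

Definition mixing_rate (l : nat) : R := (1 + l%:R) `^ (- (1 + theta)).

Lemma mixing_rate_ge0 l : 0 <= mixing_rate l.
Proof. exact: powR_ge0. Qed.

Lemma mixing_rate_le_cube l : mixing_rate l <= ((1 + l%:R) ^+ 3)^-1.
Proof.
rewrite /mixing_rate powRN lef_pV2 ?posrE ?powR_gt0 ?exprn_gt0 ?ltr_pwDl//.
rewrite -powR_mulrn ?addr_ge0//; apply: ler_powR; first by rewrite lerDl.
by have := theta_gt2; lra.
Qed.

(** The term l = 1 is at most 1/8. For l >= 2, (1 + l)^-3 <= 1 / (l (l+1) (l+2)), which telescopes
    to at most 1/12. This yields 1 + 4 * 5/24 = 11/6 in the strong variance. *)
Lemma sum_mixing_rate_le n : \sum_(1 <= l < n.+1) mixing_rate l <= 5 / 24.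
Proof.
suff H : forall n, \sum_(1 <= l < n.+2) mixing_rate l <=
    5 / 24 - (2 * ((n.+2)%:R * (n.+3)%:R))^-1.
  case: n => [|n]; first by rewrite big_geq// divr_ge0.
  by apply: le_trans (H n) _; rewrite gerBl invr_ge0 !mulr_ge0.
move=> {}n; elim: n => [|n IH].
  rewrite big_nat1; apply: le_trans (mixing_rate_le_cube 1) _.
  have -> : ((1 + 1%:R : R) ^+ 3)^-1 = 1 / 8 by field.
  have -> : (2 * (2%:R * 3%:R : R))^-1 = 1 / 12 by field.
  lra.
rewrite big_nat_recr//=; apply: le_trans (lerD IH (mixing_rate_le_cube _)) _.
pose k : R := n%:R; have k0 : 0 <= k by rewrite /k.
have -> : n.+2%:R = k + 2 :> R by rewrite /k -natrD addn2.
have -> : n.+3%:R = k + 3 :> R by rewrite /k -natrD addn3.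
have -> : n.+4%:R = k + 4 :> R by rewrite /k -natrD addn4.
have E : (2 * ((k + 2) * (k + 3)))^-1 - (2 * ((k + 3) * (k + 4)))^-1 =
    ((k + 2) * (k + 3) * (k + 4))^-1.
  by field; do ! (apply/andP; split); apply: lt0r_neq0; lra.
have I : ((1 + (k + 2)) ^+ 3)^-1 <= ((k + 2) * (k + 3) * (k + 4))^-1.
  rewrite lef_pV2 ?posrE; [by nra|by apply: exprn_gt0; lra|].
  by rewrite !mulr_gt0; lra.
rewrite -E in I; move: I.
set x := _^-1; set y := (2 * _)^-1; set z := (2 * _)^-1; lra.
Qed.

(** Comparison with the integral of x^(-3/2) from 1 to n + 1, which is 2 - 2 / sqrt (n + 1), written
    as an induction. *)
Lemma sum_sqrt_mixing_rate_le n :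
  \sum_(1 <= l < n.+1) Num.sqrt (mixing_rate l) <= 2.
Proof.
suff H : \sum_(1 <= l < n.+1) Num.sqrt (mixing_rate l) <= 2 - 2 / Num.sqrt n.+1%:R.
  by apply: le_trans H _; rewrite gerBl divr_ge0.
elim: n => [|n IH]; first by rewrite big_geq// sqrtr1 divr1 subrr.
rewrite big_nat_recr//=.
pose p : R := Num.sqrt n.+1%:R; pose q : R := Num.sqrt n.+2%:R.
have p2 : p ^+ 2 = n.+1%:R by rewrite sqr_sqrtr.
have q2 : q ^+ 2 = p ^+ 2 + 1 by rewrite p2 sqr_sqrtr// natr1.
have p0 : 0 < p by rewrite sqrtr_gt0.
have q0 : 0 < q by rewrite sqrtr_gt0.
have pq : p < q by rewrite ltr_sqrt// ltr_nat.
have r3 : Num.sqrt (mixing_rate n.+1) <= (q ^+ 3)^-1.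
  have -> : (q ^+ 3)^-1 = Num.sqrt ((q ^+ 3)^-1 ^+ 2).
    by rewrite sqrtr_sqr ger0_norm// invr_ge0 exprn_ge0// ltW.
  rewrite ler_sqrt ?sqr_ge0//; apply: le_trans (mixing_rate_le_cube _) _.
  by rewrite exprVn -exprM mulnC exprM sqr_sqrtr// nat1r.
apply: le_trans (lerD IH r3) _; rewrite -/p -/q.
rewrite -addrA lerD2l -lerBrDl opprK addrC.
have -> : 2 / p - 2 / q = 2 * (q - p) / (p * q) by field; rewrite !gt_eqF.
rewrite ler_pdivlMr ?mulr_gt0// mulrC ler_pdivrMr ?exprn_gt0//.
have : p * (q + p) <= 2 * q ^+ 2 by nra.
have : (q - p) * (q + p) = 1 by rewrite -subr_sqr q2; ring.
move=> E F.
rewrite -(ler_pM2r (x := q + p)); last by rewrite addr_gt0.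
have -> : 2 * (q - p) * q ^+ 3 * (q + p) = 2 * ((q - p) * (q + p)) * q ^+ 3 by ring.
rewrite E mulr1 exprSr mulrA mulrAC.
by rewrite ler_pM2r.
Qed.

End mixing_rate.

Section stationary_sample.
Context (R : realType) (d : measure_display) (Om : measurableType d)
  (P : probability Om R) (X : int -> {RV P >-> R}) (theta : R) (s : R -> R).
Local Notation mu := (@lebesgue_measure R).
Local Notation L2 := (Lfun mu 2%:E).
Local Notation Q := (path_law X).
Hypothesis X_stationary : strictly_stationary X.
Hypothesis theta_gt2 : 2 < theta.
Hypothesis X_mixing : arithmetically_beta_mixing X theta.
Hypothesis s_ge0 : forall x, 0 <= s x.
Hypothesis s_L2 : s \in L2.
Hypothesis s_density : forall A : set R, measurable A ->
  distribution P (X 0) A = (\int[mu]_(x in A) (s x)%:E)%E.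

Lemma path_law_mixing (a b : int) (h : nat)
    (H : path_space R int * path_space R int -> R) :
  (0 < h)%N -> a + h%:Z <= b -> measurable_fun setT H ->
  (forall z, 0 <= H z <= 1) -> path_depends a b H ->
  \int[Q]_x H (x, x) <= \int[Q]_x (\int[Q]_y H (x, y)) + mixing_rate theta h.
Proof. by move=> h0 ab; exact: (path_mixing X_stationary h0 ab (X_mixing h)). Qed.

Lemma path_law_density (f : R -> R) : bmeas f ->
  path_mean Q f = \int[mu]_x (f x * s x).
Proof.
move=> bf; rewrite /path_mean bexp_path_law; last exact: bmeas_coord.
exact: (bexp_RV_density (L2_measurable s_L2) s_ge0 s_density bf).
Qed.

(** Almost surely the sample never visits a null set, so the functions [psi] may be modified
    there. *)
Lemma sample_null_set (E : set R) : measurable E -> mu E = 0%E ->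
  exists N : set Om, [/\ measurable N, P N = 0%E &
    forall w, ~ N w -> forall i : nat, ~ E (X i%:Z w)].
Proof.
move=> mE E0.
exists (\bigcup_(i : nat) (X i%:Z @^-1` E)).
have mi i : measurable (X i%:Z @^-1` E).
  by rewrite -[X in measurable X]setTI; exact: (measurable_funP (X i%:Z)).
split.
- exact: bigcupT_measurable.
- apply/eqP; rewrite -measure_le0.
  apply: (@le_trans _ _ (\sum_(i <oo) P (X i%:Z @^-1` E))%E).
    apply: measure_sigma_subadditive => //.
    exact: bigcupT_measurable.
  rewrite eseries0// => i _ _.
  have mA : measurable [set x : path_space R int | E (x 0)].
    rewrite -[X in measurable X]setTI; exact: (measurable_coord 0 measurableT mE).
  have := X_stationary i%:Z mA; rewrite /= add0r => ->.
  rewrite -[LHS]/(distribution P (X 0) E) s_density//.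
  apply: null_set_integral => //; apply: measurable_funTS.
  by apply/measurable_EFinP; exact: L2_measurable.
- by move=> w nN i Ei; apply: nN; exists i.
Qed.

Context (L : choiceType) (psi : L -> R -> R).
Hypothesis psi_on : orthonormal_system psi.

(* [tp] is the system [psi] truncated to 0 on a Lebesgue-null set. *)
Lemma truncated_model (Phi : R) (M : set {fset L}) (m : {fset L})
    (B := Phi ^+ 2 * #|` m|%:R) :
  assumption_M2 psi Phi M -> M m ->
  exists tp : L -> R -> R, [/\ forall l, measurable_fun setT (tp l),
    forall u, \sum_(l <- m) tp l u ^+ 2 <= B,
    forall l, l \in m -> path_mean Q (tp l) = dotL2 (psi l) s,
    forall a : L -> R, path_mean Q (fun u => (\sum_(l <- m) a l * tp l u) ^+ 2) <=
      Num.sqrt B * ((1 + dotL2 s s) / 2) * \sum_(l <- m) a l ^+ 2 &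
    exists N : set Om, [/\ measurable N, P N = 0%E &
      forall w, ~ N w -> forall (i : nat) l, tp l (X i%:Z w) = psi l (X i%:Z w)]].
Proof.
move=> M2 Mm; have [E [mE E0 EB]] := M2_sup_bound psi_on M2 Mm.
have B0 : 0 <= B by rewrite mulr_ge0// sqr_ge0.
have mpsi l : measurable_fun setT (psi l) by apply: L2_measurable; exact: psi_on.1.
pose tp l x := psi l x * \1_(~` E) x.
have tpE l x : E x -> tp l x = 0.
  by move=> Ex; rewrite /tp indicE memNset ?mulr0//; exact.
have tpN l x : ~ E x -> tp l x = psi l x.
  by move=> Ex; rewrite /tp indicE mem_set ?mulr1.
have mtp l : measurable_fun setT (tp l).
  by apply: measurable_funM => //; apply: measurable_indic; exact: measurableC.
have tpB u : \sum_(l <- m) tp l u ^+ 2 <= B.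
  have [Eu|Eu] := pselect (E u).
    by rewrite big1// => l _; rewrite tpE// expr0n.
  by under eq_bigr do rewrite tpN//; exact: EB.
have btp l : l \in m -> bmeas (tp l) by exact: (bmeas_of_sqr_le (r := m) mtp tpB).
have aeE (f g : R -> R) : (forall x, ~ E x -> f x = g x) ->
    measurable_fun setT f -> measurable_fun setT g ->
    \int[mu]_x f x = \int[mu]_x g x.
  move=> fg mf mg; rewrite /Rintegral; congr fine; apply: ae_eq_integral => //.
  - exact/measurable_EFinP.
  - exact/measurable_EFinP.
  - exists E; split => // x /= nfg; apply: contrapT => Ex; apply: nfg => _.
    by rewrite fg.
have ms := L2_measurable s_L2.
exists tp; split => //.
- move=> l lm; rewrite path_law_density; last exact: btp.
  apply: aeE => [x Ex||].
  + by rewrite tpN.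
  + exact: measurable_funM.
  + exact: measurable_funM.
- move=> a; set A := \sum_(l <- m) a l ^+ 2.
  have A0 : 0 <= A by exact: sum_sqr_ge0.
  pose t u := \sum_(l <- m) a l * tp l u.
  pose t' u := \sum_(l <- m) a l * psi l u.
  have bt : bmeas t by apply: bmeas_sum_in => l lm; apply: bmeasZ; exact: btp.
  have t'2 : t' \in L2 by apply: L2_sum; exact: psi_on.1.
  have tt' u : t u ^+ 2 <= t' u ^+ 2.
    rewrite /t; have [Eu|Eu] := pselect (E u).
      by rewrite big1 ?expr0n ?sqr_ge0// => l _; rewrite tpE// mulr0.
    by rewrite /t'; under eq_bigr do rewrite tpN//.
  have tK u : t u ^+ 2 <= A * B.
    apply: le_trans (cauchy_schwarz_sum _ _ _) _.
    by rewrite ler_wpM2l.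
  have [A00|An0] := eqVneq A 0.
    rewrite A00 mulr0; apply: bexp_le_cst => [|x].
      exact: (bmeas_coord 0 (bmeasX 2 bt)).
    by have := tK (x 0); rewrite A00 mul0r.
  have Agt0 : 0 < A by rewrite lt_def An0.
  pose rA := Num.sqrt A; pose rB := Num.sqrt B.
  have rA0 : 0 < rA by rewrite sqrtr_gt0.
  have rB0 : 0 <= rB by rewrite sqrtr_ge0.
  have rA2 : rA ^+ 2 = A by rewrite sqr_sqrtr.
  have rB2 : rB ^+ 2 = B by rewrite sqr_sqrtr.
  rewrite path_law_density; last exact: bmeasX.
  (* Majorant of t^2 s: one factor |t| is at most [rA * rB], and the product of the other with [s]
     is split by the arithmetic-geometric inequality, weighted so that both halves integrate to
     multiples of [A]. The untruncated [t'] has an explicit norm by orthonormality. This is how the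
     L^2 norm of [s] enters. *)
  pose G u := rB / 2 * (t' u * t' u) + rA ^+ 2 * rB / 2 * (s u * s u).
  have iZ (c : R) (f : R -> R) : f \in L2 ->
      mu.-integrable setT (EFin \o (fun u => c * (f u * f u))).
    move=> f2; rewrite (_ : EFin \o _ = (fun u => c%:E * (f u * f u)%:E)%E)//.
    by apply: integrableZl => //; exact: L2_mul_integrable.
  have iG : mu.-integrable setT (EFin \o G).
    by apply: (integrableD measurableT (iZ _ _ t'2) (iZ _ _ s_L2)).
  have tsG u : t u ^+ 2 * s u <= G u.
    have : `|t u| <= rA * rB.
      have rAB : 0 <= rA * rB by rewrite mulr_ge0// ltW.
      by rewrite -ler_sqr ?nnegrE// real_normK ?num_real// exprMn rA2 rB2.
    rewrite -real_normK ?num_real//; set x := `|t u| => xK.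
    have x0 : 0 <= x by exact: normr_ge0.
    have xt' : x ^+ 2 <= t' u ^+ 2 by rewrite /x real_normK ?num_real.
    apply: (@le_trans _ _ (rA * rB * (x * s u))).
      have -> : x ^+ 2 * s u = x * (x * s u) by ring.
      by apply: ler_wpM2r => //; exact: mulr_ge0.
    have H : 2 * (rA * (x * s u)) <= x ^+ 2 + rA ^+ 2 * s u ^+ 2.
      by have := sqr_ge0 (x - rA * s u); rewrite sqrrB exprMn; lra.
    have := ler_wpM2l rB0 H; have := ler_wpM2l rB0 xt'; rewrite /G; lra.
  apply: (@le_trans _ _ (\int[mu]_u G u)).
    apply: le_Rintegral => //; last by move=> u _; exact: tsG.
    apply: (le_integrable measurableT _ _ iG).
      by apply/measurable_EFinP; apply: measurable_funM => //; exact: (bmeasX 2 bt).1.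
    move=> u _ /=; rewrite lee_fin ger0_norm; last by rewrite mulr_ge0// sqr_ge0.
    exact: le_trans (tsG u) (ler_norm _).
  rewrite /G (RintegralD measurableT (iZ _ _ t'2) (iZ _ _ s_L2)).
  rewrite !RintegralZl//; [|exact: L2_mul_integrable|exact: L2_mul_integrable].
  rewrite -/(dotL2 t' t') -/(dotL2 s s) (dotL2_sum_self psi_on a (fset_uniq m)) -/A.
  rewrite rA2 -/rB; lra.
- have [N [mN N0 NE]] := sample_null_set mE E0.
  by exists N; split => // w nN i l; apply: tpN; exact: NE.
Qed.

End stationary_sample.

(** * Long and short blocks of the time interval *)

Section blocks.
Context (n h : nat).
Hypothesis h_gt0 : (0 < h)%N.
Let w := (900 * h)%N.

(** Observations are numbered from 1, hence the predecessor before division. Filtering [iota 1 n]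
    cuts the last period at [n]. *)
Definition period_block (pr : pred nat) (k : nat) : seq nat :=
  [seq i <- iota 1 n | ((i.-1 %/ w)%N == k) && pr (i.-1 %% w)%N].

Definition long_block := period_block (fun p => (p < 899 * h)%N).
Definition short_block := period_block (fun p => (899 * h <= p)%N).
(** The successor accounts for the last, incomplete period. *)
Definition n_blocks := (n %/ w)%N.+1.

Lemma period_gt0 : (0 < w)%N.
Proof. by rewrite muln_gt0. Qed.

Lemma uniq_period_block pr k : uniq (period_block pr k).
Proof. by apply: filter_uniq; exact: iota_uniq. Qed.

Lemma mem_period_block pr k i : i \in period_block pr k ->
  exists2 p, i = (k * w + p).+1 & (p < w)%N && pr p.
Proof.
rewrite mem_filter mem_iota => /andP[/andP[/eqP ik pri] /andP[i1 _]].
exists (i.-1 %% w)%N; last by rewrite ltn_pmod ?period_gt0.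
by rewrite -ik -divn_eq prednK.
Qed.

Lemma mem_concat_blocks (J : nat -> seq nat) k i :
  i \in concat_blocks J k -> exists2 k', (k' < k)%N & i \in J k'.
Proof.
elim: k => // k IH /=; rewrite mem_cat => /orP[/IH[k' kk' ik']|ik].
  by exists k' => //; exact: ltnW.
by exists k.
Qed.

Lemma long_block_gap k : exists b : int,
  (forall i, i \in concat_blocks long_block k -> i%:Z <= b) /\
  (forall j, j \in long_block k -> b + h%:Z <= j%:Z).
Proof.
(* The last time of the preceding long part; the short part in between is the gap. *)
exists ((k * w)%N%:Z - h%:Z); split.
  move=> i /mem_concat_blocks[k' kk' /mem_period_block[p -> /andP[_ ph]]].
  have : (k'.+1 * w <= k * w)%N by rewrite leq_mul2r kk' orbT.
  rewrite mulSn /w; lia.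
move=> j /mem_period_block[p -> _]; lia.
Qed.

Lemma short_block_gap k : exists b : int,
  (forall i, i \in concat_blocks short_block k -> i%:Z <= b) /\
  (forall j, j \in short_block k -> b + h%:Z <= j%:Z).
Proof.
(* The end of the preceding period; the long part in between is a gap of [899 * h], more than
   [h]. *)
exists (k * w)%N%:Z; split.
  move=> i /mem_concat_blocks[k' kk' /mem_period_block[p -> /andP[pw _]]].
  have : (k'.+1 * w <= k * w)%N by rewrite leq_mul2r kk' orbT.
  rewrite mulSn; lia.
move=> j /mem_period_block[p -> /andP[_ ph]]; lia.
Qed.

Lemma size_period_block pr k : (size (period_block pr k) <= w)%N.
Proof.
rewrite -(size_iota (k * w).+1 w); apply: uniq_leq_size; first exact: uniq_period_block.
move=> i /mem_period_block[p -> /andP[pw _]]; rewrite mem_iota; lia.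
Qed.

Lemma size_short_block k : (size (short_block k) <= h)%N.
Proof.
rewrite -(size_iota (k * w + 899 * h).+1 h).
apply: uniq_leq_size; first exact: uniq_period_block.
move=> i /mem_period_block[p -> /andP[pw ph]]; rewrite mem_iota.
move: pw ph; rewrite /w; lia.
Qed.

Section sums.
Context (R : nmodType) (F : nat -> R).

Lemma sum_concat_blocks (J : nat -> seq nat) N :
  \sum_(i <- concat_blocks J N) F i = \sum_(k < N) \sum_(i <- J k) F i.
Proof.
elim: N => [|N IH] /=; first by rewrite big_nil big_ord0.
by rewrite big_cat big_ord_recr IH.
Qed.

Lemma sum_period_blocks pr :
  \sum_(i <- concat_blocks (period_block pr) n_blocks) F i =
  \sum_(i <- iota 1 n | pr (i.-1 %% w)%N) F i.
Proof.
rewrite sum_concat_blocks /period_block.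
under eq_bigr do rewrite big_filter.
rewrite [RHS]big_mkcond /=; under eq_bigr do rewrite big_mkcond.
rewrite exchange_big big_seq [RHS]big_seq; apply: eq_bigr => i.
rewrite mem_iota => /andP[i1 iN].
have kN : (i.-1 %/ w < n_blocks)%N.
  by rewrite /n_blocks ltnS leq_div2r//; lia.
rewrite (bigD1 (Ordinal kN))//= eqxx big1 ?addr0// => k kne.
case: ifP => // /andP[/eqP e _]; case/negP: kne.
by apply/eqP/val_inj; rewrite /= e.
Qed.

Lemma sum_long_short :
  \sum_(i <- iota 1 n) F i =
  \sum_(i <- concat_blocks long_block n_blocks) F i +
  \sum_(i <- concat_blocks short_block n_blocks) F i.
Proof.
rewrite !sum_period_blocks (bigID (fun i => (i.-1 %% w < 899 * h)%N)) /=.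
by congr (_ + _); apply: eq_bigl => i; rewrite -leqNgt.
Qed.

End sums.

Lemma size_concat_blocks J N :
  size (concat_blocks J N) = (\sum_(k < N) size (J k))%N.
Proof.
elim: N => [|N IH] /=; first by rewrite big_ord0.
by rewrite size_cat big_ord_recr IH.
Qed.

Lemma size_concat_long : (size (concat_blocks long_block n_blocks) <= n)%N.
Proof.
have E : (size (iota 1 n) = size (concat_blocks long_block n_blocks) +
    size (concat_blocks short_block n_blocks))%N.
  by rewrite -!sum1_size; exact: (sum_long_short (fun=> 1%N)).
by move: E; rewrite size_iota => ->; exact: leq_addr.
Qed.

Lemma size_concat_short :
  (size (concat_blocks short_block n_blocks) <= n_blocks * h)%N.
Proof.
rewrite size_concat_blocks -[X in (_ <= X * _)%N]card_ord -sum_nat_const.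
by apply: leq_sum => k _; exact: size_short_block.
Qed.

Lemma n_blocks_mul_le : (900 * (n_blocks * h) <= n + 900 * h)%N.
Proof.
have := leq_trunc_div n w; rewrite /n_blocks /w; set q := (n %/ _)%N.
rewrite -addn1; nia.
Qed.

End blocks.

(** * Exponential bound with explicit parameters *)

Section standard_deviation.
Context (R : realType).
Local Notation PS := (path_space R int).
Context (Q : probability PS R) (rho : nat -> R).
Hypothesis Q_mixing : forall (a b : int) (h : nat) (H : PS * PS -> R),
  (0 < h)%N -> a + h%:Z <= b -> measurable_fun setT H ->
  (forall z, 0 <= H z <= 1) -> path_depends a b H ->
  \int[Q]_x H (x, x) <= \int[Q]_x (\int[Q]_y H (x, y)) + rho h.
Context (I L : eqType) (tests : seq I) (fam : I -> seq L)
  (g : I -> L -> R -> R) (J : nat -> seq nat) (h k q : nat)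
  (n T ell del Cv q0 C0 : R) (W e v : I -> R).
Hypothesis h_gt0 : (0 < h)%N.
Hypothesis J_gap : forall k, exists b : int,
  (forall i, i \in concat_blocks J k -> i%:Z <= b) /\
  (forall j, j \in J k -> b + h%:Z <= j%:Z).
Hypothesis mg : forall t, t \in tests -> forall l, measurable_fun setT (g t l).
Hypothesis gW : forall t, t \in tests ->
  forall u, \sum_(l <- fam t) g t l u ^+ 2 <= W t.
Hypothesis g_mean : forall t l (i : nat), t \in tests -> l \in fam t ->
  \int[Q]_x g t l (x i%:Z) = 0.
Hypothesis strong_var : forall t k, t \in tests ->
  \int[Q]_x (\sum_(l <- fam t) block_sum (J k) (g t l) x ^+ 2) <=
  e t * (size (J k))%:R.
Hypothesis weak_var : forall t k, t \in tests -> forall s : L -> R,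
  \int[Q]_x ((\sum_(l <- fam t) s l * block_sum (J k) (g t l) x) ^+ 2) <=
  v t * (size (J k))%:R * \sum_(l <- fam t) s l ^+ 2.
Hypothesis W_gt0 : forall t, t \in tests -> 0 < W t.
Hypothesis e_W : forall t, t \in tests -> 0 <= e t <= W t.
Hypothesis v_W : forall t, t \in tests -> 0 <= v t <= Cv * W t / ell ^+ 4.
Hypothesis size_J : forall k, (size (J k) <= q)%N.
Hypothesis q0_ge1 : 1 <= q0.
Hypothesis C0_ge : 2 * (3 * q0 + q0 ^+ 2) <= C0.
Hypothesis q_small : q%:R <= q0 * Num.sqrt n / ell ^+ 2.
Hypothesis T_ge : (size (concat_blocks J k))%:R <= T.
Hypothesis T_le : T <= n.
Hypothesis n_gt0 : 0 < n.
Hypothesis ell_ge1 : 1 <= ell.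
Hypothesis del01 : 0 < del <= 1.

(** [A] is the mean energy [T * e t] plus a margin; it is at most [2 * n * W t], hence below the
    square of [a]. [y] bounds the norm of a block sum. With [q_small], [C0_ge] is what makes
    [lam * (2 * a * y + y ^+ 2)] at most 1/2. *)
Let lam t := ell ^+ 2 / (C0 * W t * n).
Let A t := T * e t + del * n * W t.
Let a t := 3 / 2 * Num.sqrt n * Num.sqrt (W t).
Let y t := q%:R * Num.sqrt (W t).

Let C0_gt0 : 0 < C0.
Proof. by apply: lt_le_trans C0_ge; have := q0_ge1; nra. Qed.

Let T_ge0 : 0 <= T.
Proof. exact: le_trans T_ge. Qed.

Let lam_gt0 t : t \in tests -> 0 < lam t.
Proof.
move=> tt; have W0 := W_gt0 tt; rewrite /lam divr_gt0//.
  by rewrite exprn_gt0// (lt_le_trans ltr01).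
by rewrite !mulr_gt0.
Qed.

Let A_le t : t \in tests -> 0 <= A t <= 2 * n * W t.
Proof.
move=> tt; have W0 := W_gt0 tt; have /andP[e0 eW] := e_W tt.
have /andP[d0 d1] := del01.
have a1 : 0 <= T * e t by exact: mulr_ge0.
have a2 : 0 <= del * n * W t by rewrite !mulr_ge0// ltW.
rewrite /A addr_ge0//=.
have : T * e t <= n * W t by rewrite ler_pM.
have : del * (n * W t) <= 1 * (n * W t) by rewrite ler_wpM2r// mulr_ge0// ltW.
by lra.
Qed.

Let q2_small : q%:R ^+ 2 * ell ^+ 4 <= q0 ^+ 2 * n.
Proof.
have e0 : 0 < ell ^+ 2 by rewrite exprn_gt0// (lt_le_trans ltr01).
have : q%:R * ell ^+ 2 <= q0 * Num.sqrt n.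
  by rewrite -ler_pdivlMr.
have q00 : 0 <= q0 by have := q0_ge1; lra.
rewrite -ler_sqr ?nnegrE; [|by apply: mulr_ge0 => //; exact: ltW
                           |by apply: mulr_ge0; rewrite ?sqrtr_ge0].
have -> : (q%:R * ell ^+ 2) ^+ 2 = q%:R ^+ 2 * ell ^+ 4 :> R by ring.
by rewrite exprMn sqr_sqrtr// ltW.
Qed.

Let lam_small t : t \in tests -> lam t * (2 * a t * y t + y t ^+ 2) <= 2^-1.
Proof.
move=> tt; have W0 := W_gt0 tt.
have e0 : 0 < ell by exact: lt_le_trans ell_ge1.
pose w := Num.sqrt (W t); pose s := Num.sqrt n.
have w2 : w ^+ 2 = W t by rewrite sqr_sqrtr// ltW.
have s2 : s ^+ 2 = n by rewrite sqr_sqrtr// ltW.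
rewrite /lam /a /y -/w -/s -w2 -s2.
have w0 : 0 < w by rewrite sqrtr_gt0.
have s0 : 0 < s by rewrite sqrtr_gt0.
have -> : ell ^+ 2 / (C0 * w ^+ 2 * s ^+ 2) *
    (2 * (3 / 2 * s * w) * (q%:R * w) + (q%:R * w) ^+ 2) =
    (3 * s * (q%:R * ell ^+ 2) + (q%:R ^+ 2 * ell ^+ 4) / ell ^+ 2) / (C0 * s ^+ 2).
  field; do ! (apply/andP; split); apply: lt0r_neq0 => //.
rewrite ler_pdivrMr; last by rewrite mulr_gt0 ?exprn_gt0.
have H1 : q%:R * ell ^+ 2 <= q0 * s by rewrite -ler_pdivlMr// exprn_gt0.
have H2 : q%:R ^+ 2 * ell ^+ 4 / ell ^+ 2 <= q0 ^+ 2 * s ^+ 2.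
  rewrite ler_pdivrMr ?exprn_gt0//; apply: le_trans q2_small _.
  rewrite s2; apply: ler_peMr; last exact: exprn_ege1.
  by rewrite mulr_ge0 ?sqr_ge0 ?ltW.
have := ler_wpM2l (ltW s0) H1; have := ler_wpM2r (sqr_ge0 s) C0_ge; lra.
Qed.

(** The first-order growth [lam * e * T] cancels against the main part of [A], and the margin leaves
    [- (del * ell ^+ 2 / C0)]. The second-order part stays bounded: [lam ^+ 2] carries a factor
    [ell ^+ 4], which [v] and the squared block length compensate. *)
Lemma growth_bound t : t \in tests ->
  - (lam t * A t) + growth A e v y lam t * T <=
  - (del * ell ^+ 2 / C0) + (Cv + 1).
Proof.
move=> tt; have W0 := W_gt0 tt; have /andP[e0 eW] := e_W tt.
have /andP[v0 vW] := v_W tt; have /andP[A0 A2] := A_le tt.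
have l0 : 0 < ell by exact: lt_le_trans ell_ge1.
have l4 : 0 < ell ^+ 4 by exact: exprn_gt0.
have Cv0 : 0 <= Cv.
  have : 0 <= Cv * W t / ell ^+ 4 by exact: le_trans vW.
  by rewrite pmulr_lge0 ?invr_gt0// pmulr_lge0.
have -> : - (lam t * A t) + growth A e v y lam t * T =
    - (del * ell ^+ 2 / C0) +
    T * (16 * v t * A t + 4 * y t ^+ 2 * e t) * lam t ^+ 2.
  rewrite /growth {1}/A.
  have -> : del * ell ^+ 2 / C0 = lam t * (del * n * W t).
    by rewrite /lam; field; do ! (apply/andP; split);
      apply: lt0r_neq0 => //.
  by ring.
rewrite lerD2l.
have lam2 : lam t ^+ 2 = ell ^+ 4 / (C0 * W t * n) ^+ 2.
  by rewrite /lam expr_div_n -exprM.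
have D0 : 0 < (C0 * W t * n) ^+ 2.
  by rewrite exprn_gt0// !mulr_gt0.
rewrite lam2 mulrA ler_pdivrMr//.
have vA : 16 * v t * A t * ell ^+ 4 <= 32 * Cv * n * W t ^+ 2.
  have vl : v t * ell ^+ 4 <= Cv * W t by rewrite -ler_pdivlMr.
  have -> : 16 * v t * A t * ell ^+ 4 = 16 * ((v t * ell ^+ 4) * A t) by ring.
  have -> : 32 * Cv * n * W t ^+ 2 = 16 * ((Cv * W t) * (2 * n * W t)) by ring.
  by rewrite ler_wpM2l// ler_pM// mulr_ge0// ltW.
have ye : 4 * y t ^+ 2 * e t * ell ^+ 4 <= 4 * q0 ^+ 2 * n * W t ^+ 2.
  rewrite /y exprMn sqr_sqrtr; last exact: ltW.
  have -> : 4 * (q%:R ^+ 2 * W t) * e t * ell ^+ 4 =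
      4 * ((q%:R ^+ 2 * ell ^+ 4) * (W t * e t)) by ring.
  have -> : 4 * q0 ^+ 2 * n * W t ^+ 2 = 4 * ((q0 ^+ 2 * n) * (W t * W t)) by ring.
  rewrite ler_wpM2l//.
  rewrite ler_pM//; last by rewrite ler_wpM2l// ltW.
  - by rewrite mulr_ge0 ?sqr_ge0// ltW.
  - by rewrite mulr_ge0// ltW.
apply: (@le_trans _ _ (n * (32 * Cv * n * W t ^+ 2 + 4 * q0 ^+ 2 * n * W t ^+ 2))).
  rewrite -mulrA ler_pM//; last by rewrite mulrDl lerD.
  rewrite mulr_ge0 ?(ltW l4)// addr_ge0// !mulr_ge0// sqr_ge0.
have -> : n * (32 * Cv * n * W t ^+ 2 + 4 * q0 ^+ 2 * n * W t ^+ 2) =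
  (32 * Cv + 4 * q0 ^+ 2) * (W t * n) ^+ 2 by ring.
have -> : (Cv + 1) * (C0 * W t * n) ^+ 2 =
  ((Cv + 1) * C0 ^+ 2) * (W t * n) ^+ 2 by ring.
have H1 := q0_ge1; have H2 := C0_ge.
rewrite ler_wpM2r ?sqr_ge0//.
have H3 : 8 <= C0 by nra.
have H4 : 2 * q0 <= C0 by nra.
have H5 : 4 * q0 ^+ 2 <= C0 ^+ 2 by nra.
have H6 : 32 * Cv <= Cv * C0 ^+ 2 by rewrite mulrC ler_wpM2l//; nra.
by lra.
Qed.

Lemma standard_deviation : exists Bad : set PS, [/\ measurable Bad,
  (Q Bad <= ((size tests)%:R * expR (- (del * ell ^+ 2 / C0) + (Cv + 1)) +
             k%:R * rho h)%:E)%E &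
  forall x, ~ Bad x -> forall t, t \in tests ->
    sqr_norm fam g t (concat_blocks J k) x <= A t].
Proof.
pose F x := \sum_(t <- tests)
     expR (lam t * (sqr_norm fam g t (concat_blocks J k) x - A t)).
have mF : measurable_fun setT F.
  apply: measurable_exp_sum => t tt; apply: measurable_funM; first exact: measurable_cst.
  by apply: measurable_funB; [exact: (measurable_sqr_norm fam mg _ tt)|exact: measurable_cst].
have F0 x : 0 <= F x by exact: exp_sum_ge0.
(* One event for all tests: a single excess of the squared norm over [A t] already gives a term at
   least 1. The measure of the event is at most the integral of the capped sum. *)
exists [set x | 1 <= F x].
have mBad : measurable [set x : PS | 1 <= F x].
  rewrite -[X in measurable X]setTI.
  exact: (@measurable_fun_le _ _ _ _ (cst 1) F).
split => //; last first.
  move=> x /negP; rewrite -ltNge => F1 t tt; rewrite leNgt; apply/negP => At.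
  move: F1; apply/negP; rewrite -leNgt.
  apply: (@le_trans _ _ (expR (lam t *
    (sqr_norm fam g t (concat_blocks J k) x - A t)))).
    apply: le_trans (expR_ge1Dx _); rewrite lerDl.
    by apply: mulr_ge0; [exact/ltW/lam_gt0|rewrite subr_ge0 ltW].
  rewrite /F (big_rem t)//= lerDl; apply: sumr_ge0 => u _; exact: expR_ge0.
have bm : bmeas (fun x => Num.min 1 (F x)) by exact: bmeas_min1.
rewrite -[Q _]fineK ?fin_num_measure// -bexp_indic// lee_fin.
apply: (@le_trans _ _ (\int[Q]_x Num.min 1 (F x))).
  apply: bexp_le => // [|x]; first exact: bmeas_indic.
  rewrite indicE; case: (boolP (x \in _)) => [|_]; last by rewrite le_min ler01 F0.
  by rewrite inE /= => F1; rewrite le_min lexx.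
apply: (@le_trans _ _ (\sum_(t <- tests) expR (- (lam t * A t) +
    growth A e v y lam t * T) + k%:R * rho h)).
  apply: (@blocks_deviation _ Q rho Q_mixing I L tests fam g J h A a W e v y lam) => //.
  - by move=> t /e_W /andP[].
  - by move=> t /v_W /andP[].
  - by move=> t /A_le /andP[].
  - by move=> t tt; rewrite /a !mulr_ge0 ?sqrtr_ge0.
  - move=> t tt; have /andP[_ A2] := A_le tt; apply: le_trans A2 _.
    rewrite /a !exprMn sqr_sqrtr; last exact: ltW.
    rewrite sqr_sqrtr; last by rewrite ltW ?W_gt0.
    by have := mulr_gt0 n_gt0 (W_gt0 tt); lra.
  - by move=> t tt; rewrite /y mulr_ge0 ?sqrtr_ge0.
  - move=> t j tt; rewrite /y exprMn sqr_sqrtr; last by rewrite ltW ?W_gt0.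
    rewrite ler_wpM2r ?(ltW (W_gt0 tt))// ler_sqr ?nnegrE// ler_nat.
    exact: size_J.
rewrite lerD2r.
apply: (@le_trans _ _ (\sum_(t <- tests) expR (- (del * ell ^+ 2 / C0) + (Cv + 1)))).
  rewrite big_seq [leRHS]big_seq; apply: ler_sum => t tt.
  by rewrite ler_expR growth_bound.
by rewrite big_const_seq count_predT iter_addr_0 -[leLHS]mulr_natl.
Qed.

End standard_deviation.

Section weak_variance_constant.
Context (R : realType).

Definition weak_constant (phi ks : R) : R := ks / (2 * phi) + 4 * Num.sqrt (ks / phi).

(** Origin of the exponent 16: the second term is of order W^(3/4), and gaining [ell ^+ 4] over [W]
    requires W^(1/4) of order [ell ^+ 4]. The first term, of order W^(1/2), is then smaller
    still. *)
Lemma weak_constant_bound (phi ks ell B W : R) :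
  0 < phi -> 0 <= ks -> 1 <= ell -> 0 <= B -> B <= W ->
  4 * phi ^+ 2 * ell ^+ 16 <= W ->
  Num.sqrt B * ks + 2 * (Num.sqrt (2 * B * (Num.sqrt B * ks)) * 2) <=
  weak_constant phi ks * W / ell ^+ 4.
Proof.
move=> phi0 ks0 ell1 B0 BW ellW.
have l0 : 0 < ell by exact: lt_le_trans ell1.
have W0 : 0 < W by apply: lt_le_trans ellW; rewrite !mulr_gt0 ?exprn_gt0.
pose b := Num.sqrt B; pose w := Num.sqrt W.
have b2 : b ^+ 2 = B by rewrite sqr_sqrtr.
have w2 : w ^+ 2 = W by rewrite sqr_sqrtr// ltW.
have b0 : 0 <= b by rewrite sqrtr_ge0.
have w0 : 0 < w by rewrite sqrtr_gt0.
have bw : b <= w by rewrite ler_sqrt// ltW.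
have wl : 2 * phi * ell ^+ 8 <= w.
  rewrite -ler_sqr ?nnegrE ?(ltW w0)//; last by rewrite !mulr_ge0 ?exprn_ge0 ?ltW.
  by rewrite w2; apply: le_trans ellW; rewrite le_eqVlt; apply/orP; left; apply/eqP; ring.
have l48 : ell ^+ 4 <= ell ^+ 8 by rewrite ler_weXn2l.
have l40 : 0 < ell ^+ 4 by rewrite exprn_gt0.
have bl : b * ell ^+ 8 * (2 * phi) <= W.
  rewrite -w2 expr2; apply: (@le_trans _ _ (w * (2 * phi * ell ^+ 8))).
    rewrite -mulrA [ell ^+ 8 * _]mulrC ler_wpM2r// !mulr_ge0 ?exprn_ge0 ?ltW//.
  by rewrite ler_wpM2l// ltW.
rewrite /weak_constant -/b.
have T1 : b * ks <= ks / (2 * phi) * W / ell ^+ 4.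
  have -> : ks / (2 * phi) * W / ell ^+ 4 = ks * (W / (2 * phi * ell ^+ 4)).
    by field; rewrite !gt_eqF.
  rewrite mulrC ler_wpM2l// ler_pdivlMr ?mulr_gt0//; apply: le_trans bl.
  have -> : b * ell ^+ 8 * (2 * phi) = b * (2 * phi * ell ^+ 8) by ring.
  rewrite ler_wpM2l// ler_wpM2l//.
  by rewrite mulr_ge0// ltW.
have T2 : Num.sqrt (2 * B * (b * ks)) <= Num.sqrt (ks / phi) * W / ell ^+ 4.
  have -> : Num.sqrt (ks / phi) * W / ell ^+ 4 =
      Num.sqrt ((ks / phi) * (W / ell ^+ 4) ^+ 2).
    have k10 : 0 <= ks / phi by rewrite divr_ge0// ltW.
    have k20 : 0 <= W / ell ^+ 4 by rewrite divr_ge0// ltW.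
    by rewrite (sqrtrM ((W / ell ^+ 4) ^+ 2) k10) sqrtr_sqr ger0_norm// mulrA.
  rewrite ler_sqrt; last by rewrite mulr_ge0 ?sqr_ge0// divr_ge0// ltW.
  have -> : ks / phi * (W / ell ^+ 4) ^+ 2 = ks * (W ^+ 2 / (phi * ell ^+ 8)).
    by field; rewrite !gt_eqF.
  have -> : 2 * B * (b * ks) = ks * (2 * B * b) by ring.
  rewrite ler_wpM2l// ler_pdivlMr ?mulr_gt0 ?exprn_gt0//.
  have -> : 2 * B * b * (phi * ell ^+ 8) = B * (b * ell ^+ 8 * (2 * phi)) by ring.
  by rewrite expr2 ler_pM// !mulr_ge0 ?exprn_ge0// ltW.
have -> : (ks / (2 * phi) + 4 * Num.sqrt (ks / phi)) * W / ell ^+ 4 =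
  ks / (2 * phi) * W / ell ^+ 4 + 4 * (Num.sqrt (ks / phi) * W / ell ^+ 4) by ring.
by lra.
Qed.

Lemma weak_constant_ge0 (phi ks : R) : 0 <= phi -> 0 <= ks -> 0 <= weak_constant phi ks.
Proof.
move=> p0 k0; apply: addr_ge0; first by rewrite divr_ge0// mulr_ge0.
by rewrite mulr_ge0// sqrtr_ge0.
Qed.

End weak_variance_constant.

Section model_deviation.
Context (R : realType) (d : measure_display) (Om : measurableType d)
  (P : probability Om R) (X : int -> {RV P >-> R}) (theta : R).
Local Notation Q := (path_law X).
Local Notation PS := (path_space R int).
Hypothesis X_stationary : strictly_stationary X.
Hypothesis theta_gt2 : 2 < theta.
Hypothesis X_mixing : arithmetically_beta_mixing X theta.
Context (L : choiceType) (ms : seq {fset L}) (tp : {fset L} -> L -> R -> R).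
Context (Phi ks n ell del : R).
Let B (m : {fset L}) : R := Phi ^+ 2 * #|` m|%:R.
(** Centering at most multiplies the bound [B m] by 4, by [(x - y)^2 <= 2 x^2 + 2 y^2]; the term
    [ell ^+ 16] is the floor that [weak_constant_bound] needs in low dimension. *)
Let W (m : {fset L}) : R := 4 * Phi ^+ 2 * (#|` m|%:R + ell ^+ 16).
Let Cv := weak_constant `|Phi| ks.
Hypothesis Phi_neq0 : Phi != 0.
Hypothesis ks_ge0 : 0 <= ks.
Hypothesis mtp : forall m l, measurable_fun setT (tp m l).
Hypothesis tpB : forall m, m \in ms -> forall u, \sum_(l <- m) tp m l u ^+ 2 <= B m.
Hypothesis tp_var : forall m, m \in ms -> forall a : L -> R,
  path_mean Q (fun u => (\sum_(l <- m) a l * tp m l u) ^+ 2) <=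
  Num.sqrt (B m) * ks * \sum_(l <- m) a l ^+ 2.
Hypothesis n_gt0 : 0 < n.
Hypothesis ell_ge1 : 1 <= ell.
Hypothesis Cv_ell : Cv <= ell ^+ 4.
Hypothesis del01 : 0 < del <= 1.

Definition centered_tp (m : {fset L}) (l : L) (u : R) : R :=
  tp m l u - path_mean Q (tp m l).

Let v (m : {fset L}) : R :=
  Num.sqrt (B m) * ks + 2 * (Num.sqrt (2 * B m * (Num.sqrt (B m) * ks)) * 2).

Let Phi2_gt0 : 0 < Phi ^+ 2.
Proof. by rewrite exprn_even_gt0. Qed.

Let B_ge0 m : 0 <= B m.
Proof. by rewrite mulr_ge0// ltW. Qed.

Let W_gt0 m : 0 < W m.
Proof.
apply: mulr_gt0; first exact: mulr_gt0.
by apply: ltr_wpDl => //; apply: exprn_gt0; exact: lt_le_trans ell_ge1.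
Qed.

Let BW m : 4 * B m <= W m.
Proof.
rewrite /B /W mulrA; apply: ler_wpM2l; first by rewrite mulr_ge0// sqr_ge0.
by rewrite lerDl; apply: exprn_ge0; exact: le_trans ell_ge1.
Qed.

Let v_ge0 m : 0 <= v m.
Proof. by rewrite addr_ge0 ?mulr_ge0 ?sqrtr_ge0. Qed.

Let v_le m : v m <= Cv * W m / ell ^+ 4.
Proof.
apply: weak_constant_bound => //.
- by rewrite normr_gt0.
- by have := BW m; have := B_ge0 m; lra.
- rewrite real_normK ?num_real//; apply: ler_wpM2l.
    by rewrite mulr_ge0// sqr_ge0.
  by rewrite lerDr.
Qed.

Let v_le_W m : v m <= W m.
Proof.
apply: le_trans (v_le m) _; rewrite ler_pdivrMr.
  by rewrite mulrC ler_wpM2l// ltW.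
by rewrite exprn_gt0//; exact: lt_le_trans ell_ge1.
Qed.

Let btp m l : m \in ms -> l \in m -> bmeas (tp m l).
Proof. by move=> mm lm; exact: (bmeas_of_sqr_le (r := m) (mtp m) (tpB mm)). Qed.

Let mcentered m l : measurable_fun setT (centered_tp m l).
Proof. by apply: measurable_funB => //; exact: measurable_cst. Qed.

Let shiftQ := @bexp_shift R d Om P X X_stationary.

Let mean_sqr_le (f : R -> R) : bmeas f ->
  path_mean Q f ^+ 2 <= path_mean Q (fun u => f u ^+ 2).
Proof.
move=> bf; set c := path_mean Q f.
have bf0 : bmeas (fun x : PS => f (x 0)) by exact: bmeas_coord.
have : 0 <= \int[Q]_x ((f (x 0) - c) ^+ 2).
  apply: Rintegral_ge0 => x _; exact: sqr_ge0.
have -> : \int[Q]_x ((f (x 0) - c) ^+ 2) =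
    \int[Q]_x (f (x 0) ^+ 2 - (2 * c * f (x 0) - c ^+ 2)).
  by apply: eq_Rintegral => x _; ring.
have b1 : bmeas (fun x : PS => 2 * c * f (x 0)) by exact: bmeasZ.
rewrite bexpB; [|exact: (bmeasX 2 bf0)|by apply: bmeasB => //; exact: bmeas_cst].
rewrite bexpB ?bexp_cst//; last exact: bmeas_cst.
rewrite (bexpZ Q _ bf0) -/(path_mean Q f) -/c -/(path_mean Q (fun u => f u ^+ 2)).
lra.
Qed.

Let centered_sum (m : {fset L}) (a : L -> R) (J : seq nat) (x : PS) : m \in ms ->
  \sum_(l <- m) a l * block_sum J (centered_tp m l) x =
  block_sum J (fun u => \sum_(l <- m) a l * tp m l u -
     path_mean Q (fun u => \sum_(l <- m) a l * tp m l u)) x.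
Proof.
move=> mm; rewrite /block_sum; under eq_bigr do rewrite mulr_sumr.
rewrite exchange_big; apply: eq_bigr => i _ /=.
have -> : path_mean Q (fun u => \sum_(l <- m) a l * tp m l u) =
    \sum_(l <- m) a l * path_mean Q (tp m l).
  rewrite /path_mean (@bexp_sum_in _ _ _ Q _ m (fun l x => a l * tp m l (x 0))).
    rewrite big_seq [RHS]big_seq; apply: eq_bigr => l lm.
    by rewrite (bexpZ Q _ (bmeas_coord 0 (btp mm lm))).
  by move=> l lm; apply: bmeasZ; apply: bmeas_coord; exact: btp.
by rewrite -sumrB; apply: eq_bigr => l _; rewrite mulrBr.
Qed.

Let comb_sqr_le (m : {fset L}) (a : L -> R) u : m \in ms ->
  (\sum_(l <- m) a l * tp m l u) ^+ 2 <= (\sum_(l <- m) a l ^+ 2) * B m.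
Proof.
move=> mm; apply: le_trans (cauchy_schwarz_sum _ _ _) _.
by rewrite ler_wpM2l ?sum_sqr_ge0// tpB.
Qed.

Let weak_var m J : m \in ms -> uniq J -> forall a : L -> R,
  \int[Q]_x ((\sum_(l <- m) a l * block_sum J (centered_tp m l) x) ^+ 2) <=
  v m * (size J)%:R * \sum_(l <- m) a l ^+ 2.
Proof.
move=> mm uJ a; under eq_Rintegral do rewrite centered_sum//.
set A := \sum_(l <- m) a l ^+ 2; have A0 : 0 <= A by exact: sum_sqr_ge0.
have mt : measurable_fun setT (fun u => \sum_(l <- m) a l * tp m l u).
  apply: measurable_sum => l; apply: measurable_funM => //; exact: measurable_cst.
have tA u := comb_sqr_le a u mm.
apply: le_trans (weak_variance_le (mixing_rate_ge0 theta)
  (path_law_mixing X_stationary X_mixing) shiftQ mt tA (tp_var mm a) uJ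
  (sum_sqrt_mixing_rate_le theta_gt2)) _.
rewrite -/A /v.
have -> : Num.sqrt (2 * (A * B m) * (Num.sqrt (B m) * ks * A)) =
    A * Num.sqrt (2 * B m * (Num.sqrt (B m) * ks)).
  have -> : 2 * (A * B m) * (Num.sqrt (B m) * ks * A) =
    A ^+ 2 * (2 * B m * (Num.sqrt (B m) * ks)) by ring.
  by rewrite sqrtrM ?sqr_ge0// sqrtr_sqr ger0_norm.
by rewrite le_eqVlt; apply/orP; left; apply/eqP; ring.
Qed.

Let strong_var m J : m \in ms -> uniq J ->
  \int[Q]_x (\sum_(l <- m) block_sum J (centered_tp m l) x ^+ 2) <=
  11 / 6 * B m * (size J)%:R.
Proof.
move=> mm uJ.
apply: le_trans (strong_variance_le (mixing_rate_ge0 theta)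
  (path_law_mixing X_stationary X_mixing) shiftQ (mtp m) (tpB mm) uJ
  (sum_mixing_rate_le theta_gt2)) _.
by rewrite le_eqVlt; apply/orP; left; apply/eqP; field.
Qed.

Let centered_le m u : m \in ms ->
  \sum_(l <- m) centered_tp m l u ^+ 2 <= W m.
Proof.
move=> mm; apply: le_trans (BW m).
have c2 : \sum_(l <- m) path_mean Q (tp m l) ^+ 2 <= B m.
  apply: (@le_trans _ _ (\sum_(l <- m) path_mean Q (fun u => tp m l u ^+ 2))).
    rewrite big_seq [leRHS]big_seq; apply: ler_sum => l lm.
    by apply: mean_sqr_le; exact: btp.
  rewrite /path_mean -(@bexp_sum_in _ _ _ Q _ m (fun l x => tp m l (x 0) ^+ 2)).
    apply: bexp_le_cst => [|x]; last exact: tpB.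
    apply: bmeas_sum_in => l lm; apply: bmeasX; apply: bmeas_coord; exact: btp.
  by move=> l lm; apply: bmeasX; apply: bmeas_coord; exact: btp.
apply: (@le_trans _ _ (\sum_(l <- m) (2 * tp m l u ^+ 2 +
    2 * path_mean Q (tp m l) ^+ 2))).
  apply: ler_sum => l _; rewrite /centered_tp.
  set a := tp _ _ _; set b := path_mean _ _.
  by have := sqr_ge0 (a + b); rewrite sqrrD sqrrB; lra.
rewrite big_split /= -!mulr_sumr; have := tpB mm u; lra.
Qed.

Context (J : nat -> seq nat) (h k q : nat) (T q0 C0 : R).
Hypothesis h_gt0 : (0 < h)%N.
Hypothesis J_uniq : forall k, uniq (J k).
Hypothesis J_gap : forall k, exists b : int,
  (forall i, i \in concat_blocks J k -> i%:Z <= b) /\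
  (forall j, j \in J k -> b + h%:Z <= j%:Z).
Hypothesis size_J : forall k, (size (J k) <= q)%N.
Hypothesis q0_ge1 : 1 <= q0.
Hypothesis C0_ge : 2 * (3 * q0 + q0 ^+ 2) <= C0.
Hypothesis q_small : q%:R <= q0 * Num.sqrt n / ell ^+ 2.
Hypothesis T_ge : (size (concat_blocks J k))%:R <= T.
Hypothesis T_le : T <= n.

Let tail : R := expR (- (del * ell ^+ 2 / C0) + (Cv + 1)).

Let Cv_ge0 : 0 <= Cv.
Proof.
by rewrite addr_ge0 ?mulr_ge0 ?sqrtr_ge0// invr_ge0 mulr_ge0.
Qed.

Lemma vector_deviation : exists Bad : set PS, [/\ measurable Bad,
  (Q Bad <= ((size ms)%:R * tail + k%:R * mixing_rate theta h)%:E)%E &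
  forall x, ~ Bad x -> forall m, m \in ms ->
    \sum_(l <- m) block_sum (concat_blocks J k) (centered_tp m l) x ^+ 2 <=
    T * (11 / 6 * B m) + del * n * W m].
Proof.
apply: (@standard_deviation _ Q (mixing_rate theta)
  (path_law_mixing X_stationary X_mixing) {fset L} L ms (fun m => m : seq L)
  centered_tp J h k q n T ell del Cv q0 C0 W (fun m => 11 / 6 * B m) v) => //.
- by move=> m mm u; exact: centered_le.
- move=> m l i mm lm; rewrite /centered_tp bexpB; first last.
  + exact: bmeas_cst.
  + by apply: bmeas_coord; exact: btp.
  by rewrite bexp_cst (path_meanE shiftQ i (btp mm lm)) subrr.
- by move=> m j mm; exact: strong_var.
- by move=> m j mm a; exact: weak_var.
- move=> m mm; have := BW m; have := B_ge0 m; lra.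
- by move=> m mm; rewrite v_ge0 v_le.
Qed.

(** A linear form is a family with one member, for which strong and weak variance coincide. Hence
    [e] can be taken equal to [v], and the main term is itself of order W / ell^4 instead of B. *)
Lemma direction_deviation (ps : seq ({fset L} * {fset L}))
    (u : {fset L} * {fset L} -> L -> R) :
  (forall p, p \in ps -> p.2 \in ms) ->
  (forall p : {fset L} * {fset L}, \sum_(l <- p.2) u p l ^+ 2 <= 1) ->
  exists Bad : set PS, [/\ measurable Bad,
  (Q Bad <= ((size ps)%:R * tail + k%:R * mixing_rate theta h)%:E)%E &
  forall x, ~ Bad x -> forall p : {fset L} * {fset L}, p \in ps ->
    (\sum_(l <- p.2) u p l *
       block_sum (concat_blocks J k) (centered_tp p.2 l) x) ^+ 2 <=
    T * (Cv * W p.2 / ell ^+ 4) + del * n * W p.2].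
Proof.
move=> psm u1.
pose t (p : {fset L} * {fset L}) y := \sum_(l <- p.2) u p l * tp p.2 l y.
pose g (p : {fset L} * {fset L}) (l : unit) y := t p y - path_mean Q (t p).
have mt p : measurable_fun setT (t p).
  apply: measurable_sum => l; apply: measurable_funM => //; exact: measurable_cst.
have tB p : p \in ps -> forall y, t p y ^+ 2 <= B p.2.
  move=> pp y; apply: le_trans (comb_sqr_le (u p) y (psm _ pp)) _.
  by rewrite -[leRHS]mul1r ler_wpM2r.
have bt p : p \in ps -> bmeas (t p).
  by move=> pp; apply: bmeas_sum_in => l lm; apply: bmeasZ; apply: btp => //; exact: psm.
have svar p J' : p \in ps -> uniq J' ->
    \int[Q]_x (block_sum J' (g p tt) x ^+ 2) <= v p.2 * (size J')%:R.
  move=> pp uJ; have := weak_var (psm _ pp) uJ (u p).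
  under eq_Rintegral do rewrite centered_sum ?psm//.
  move=> /le_trans; apply; rewrite -[leRHS]mulr1 ler_wpM2l// mulr_ge0//.
have svar1 p J' : p \in ps -> uniq J' ->
    \int[Q]_x (\sum_(l <- [:: tt]) block_sum J' (g p l) x ^+ 2) <=
    v p.2 * (size J')%:R.
  by move=> pp uJ; under eq_Rintegral do rewrite big_seq1; exact: svar.
have := @standard_deviation _ Q (mixing_rate theta)
  (path_law_mixing X_stationary X_mixing) _ _ ps (fun=> [:: tt])
  g J h k q n T ell del Cv q0 C0 (fun p => W p.2) (fun p => v p.2) (fun p => v p.2).
move=> /(_ h_gt0 J_gap).
have mg p : p \in ps -> forall l, measurable_fun setT (g p l).
  by move=> pp l; apply: measurable_funB => //; exact: measurable_cst.
have gW p : p \in ps -> forall y, \sum_(l <- [:: tt]) g p l y ^+ 2 <= W p.2.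
  move=> pp y; rewrite big_seq1 /g; apply: le_trans (BW _).
  have c2 : path_mean Q (t p) ^+ 2 <= B p.2.
    apply: le_trans (mean_sqr_le (bt _ pp)) _.
    apply: bexp_le_cst => [|x]; last exact: tB.
    exact: (bmeas_coord 0 (bmeasX 2 (bt _ pp))).
  have := tB _ pp y; move: c2; set a := t p y; set b := path_mean _ _.
  by have := sqr_ge0 (a + b); rewrite sqrrD sqrrB; lra.
have gm p l (i : nat) : p \in ps -> l \in [:: tt] -> \int[Q]_x g p l (x i%:Z) = 0.
  move=> pp _; rewrite /g bexpB; first last.
  + exact: bmeas_cst.
  + by apply: bmeas_coord; exact: bt.
  by rewrite bexp_cst (path_meanE shiftQ i (bt _ pp)) subrr.
move=> /(_ mg gW gm).
have sv p j : p \in ps -> \int[Q]_x (\sum_(l <- [:: tt]) block_sum (J j) (g p l) x ^+ 2)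
    <= v p.2 * (size (J j))%:R by move=> pp; exact: svar1.
have wv p j : p \in ps -> forall s : unit -> R,
    \int[Q]_x ((\sum_(l <- [:: tt]) s l * block_sum (J j) (g p l) x) ^+ 2) <=
    v p.2 * (size (J j))%:R * \sum_(l <- [:: tt]) s l ^+ 2.
  move=> pp s; rewrite big_seq1.
  under eq_Rintegral do rewrite big_seq1 exprMn.
  rewrite bexpZ; last first.
    apply: bmeasX; apply: bmeas_block_sum.
    by apply: bmeasB; [exact: bt|exact: bmeas_cst].
  by rewrite mulrC ler_wpM2r ?sqr_ge0//; exact: svar.
move=> /(_ sv wv).
case.
- by move=> p pp; exact: W_gt0.
- by move=> p pp; rewrite v_ge0 v_le_W.
- by move=> p pp; rewrite v_ge0 v_le.
- exact: size_J.
- exact: q0_ge1.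
- exact: C0_ge.
- exact: q_small.
- exact: T_ge.
- exact: T_le.
- exact: n_gt0.
- exact: ell_ge1.
- exact: del01.
move=> Bad [mBad QBad BadP]; exists Bad; split => // x nx p pp.
have := BadP x nx p pp; rewrite /sqr_norm big_seq1 centered_sum ?psm//.
move=> /le_trans; apply; rewrite lerD2r ler_wpM2l//.
exact: le_trans T_ge.
Qed.

End model_deviation.

Section good_event.
Context (R : realType) (d : measure_display) (Om : measurableType d)
  (P : probability Om R) (X : int -> {RV P >-> R}) (theta : R) (s : R -> R).
Local Notation mu := (@lebesgue_measure R).
Local Notation Q := (path_law X).
Local Notation PS := (path_space R int).
Hypothesis X_stationary : strictly_stationary X.
Hypothesis theta_gt2 : 2 < theta.
Hypothesis X_mixing : arithmetically_beta_mixing X theta.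
Hypothesis s_ge0 : forall x, 0 <= s x.
Hypothesis s_L2 : s \in Lfun mu 2%:E.
Hypothesis s_density : forall A : set R, measurable A ->
  distribution P (X 0) A = (\int[mu]_(x in A) (s x)%:E)%E.
Context (L : choiceType) (psi : L -> R -> R) (Phi : R) (M : set {fset L})
  (ms : seq {fset L}).
Hypothesis psi_on : orthonormal_system psi.
Hypothesis Phi_neq0 : Phi != 0.
Hypothesis M2 : assumption_M2 psi Phi M.
Hypothesis msM : forall m, m \in ms -> M m.
Context (n h : nat) (ell del C0 : R).
Let ks := (1 + dotL2 s s) / 2.
Let Cv := weak_constant `|Phi| ks.
Let c l := dotL2 (psi l) s.
Hypothesis n_gt0 : (0 < n)%N.
Hypothesis h_gt0 : (0 < h)%N.
Hypothesis ell_ge1 : 1 <= ell.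
Hypothesis del_gt0 : 0 < del.
Hypothesis del_le : del <= 2^-1.
Hypothesis Cv_ell : Cv <= del * ell ^+ 4.
Hypothesis h_del : h%:R <= del * n%:R.
Hypothesis h_small : h%:R <= Num.sqrt n%:R / ell ^+ 2.
Hypothesis C0_ge : 2 * (3 * 900 + 900 ^+ 2) <= C0.

Definition empirical_error (w : Om) (l : L) : R :=
  n%:R^-1 * \sum_(1 <= i < n.+1) psi l (X i%:Z w) - c l.

Definition tail_bound : R := expR (- (del * ell ^+ 2 / C0) + (Cv + 1)).

Let n0 : 0 < n%:R :> R. Proof. by rewrite ltr0n. Qed.

Let ks_ge0 : 0 <= ks.
Proof.
rewrite divr_ge0// addr_ge0//; apply: Rintegral_ge0 => x _.
by rewrite -expr2 sqr_ge0.
Qed.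

Let del01 : 0 < del <= 1.
Proof. by rewrite del_gt0; have := del_le; lra. Qed.

Let Cv_ell' : Cv <= ell ^+ 4.
Proof.
apply: le_trans Cv_ell _; rewrite ler_piMl//; last by case/andP: del01.
by rewrite exprn_ge0//; exact: le_trans ell_ge1.
Qed.

Let short_size : (n_blocks n h * h)%N%:R <= n%:R / 900 + h%:R :> R.
Proof.
have := n_blocks_mul_le n h_gt0; set k := (n_blocks n h * h)%N.
rewrite -(ler_nat R) natrD !natrM; lra.
Qed.

(** With (a + z)^2 <= (31/30) a^2 + 31 z^2 and a short part of length n/900, the constant is 31/30 +
    31/900 = (1 + 1/30)^2 = 961/900; its product with 11/6 is below 1.96. The terms in [del],
    including those due to [h], add up to less than 47. *)
Let combine_sqr (S1 S2 : L -> R) (m : {fset L}) (e W : R) :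
  0 <= e -> 24 * e <= 11 * W ->
  \sum_(l <- m) S1 l ^+ 2 <= n%:R * e + del * n%:R * W ->
  \sum_(l <- m) S2 l ^+ 2 <= (n%:R / 900 + h%:R) * e + del * n%:R * W ->
  \sum_(l <- m) (n%:R^-1 * (S1 l + S2 l)) ^+ 2 <=
  (961 / 900 * e + 47 * del * W) / n%:R.
Proof.
move=> e0 eW H1 H2.
have W0 : 0 <= W by lra.
have dn : 0 <= del * n%:R by rewrite mulr_ge0// ltW.
have he : h%:R * e <= del * n%:R * e by rewrite ler_wpM2r.
have eW' : del * n%:R * (24 * e) <= del * n%:R * (11 * W) by rewrite ler_wpM2l.
have dW : 0 <= del * n%:R * W by rewrite mulr_ge0.
have H : \sum_(l <- m) (S1 l + S2 l) ^+ 2 <=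
    n%:R * (961 / 900 * e + 47 * del * W).
  apply: (@le_trans _ _ (\sum_(l <- m) (31 / 30 * S1 l ^+ 2 + 31 * S2 l ^+ 2))).
    apply: ler_sum => l _; set a := S1 l; set z := S2 l.
    have := sqr_ge0 (a - 30 * z); rewrite sqrrB sqrrD exprMn; lra.
  rewrite big_split /= -!mulr_sumr.
  set A1 := \sum_(_ <- _) _ in H1 *; set A2 := \sum_(_ <- _) _ in H2 *.
  lra.
under eq_bigr do rewrite exprMn.
rewrite -mulr_sumr exprVn ler_pdivrMl ?exprn_gt0//; apply: le_trans H _.
by rewrite le_eqVlt; apply/orP; left; apply/eqP; field; rewrite gt_eqF.
Qed.

Let strong_le_scale (a b p : R) : 0 <= p * b ->
  24 * (11 / 6 * (p * a)) <= 11 * (4 * p * (a + b)).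
Proof. by move=> pb; lra. Qed.

Let sqrD_le (x y : R) : (x + y) ^+ 2 <= 2 * x ^+ 2 + 2 * y ^+ 2.
Proof. by have := sqr_ge0 (x - y); rewrite sqrrB sqrrD; lra. Qed.

Let double_le (x y a b e f : R) : x <= a + f -> y <= b + f -> a <= e -> b <= e ->
  f = e -> 2 * x + 2 * y <= 8 * e.
Proof. by move=> *; lra. Qed.

(** The selected model is random, so the bounds are uniform over all models and all ordered pairs.
    Four exceptional events are united: vectors or directions, on long or on short blocks. *)
Lemma good_event : exists Bad : set Om, [/\ measurable Bad,
  (P Bad <= (2 * ((size ms)%:R + (size ms * size ms)%:R) * tail_bound +
     4 * ((n_blocks n h)%:R * mixing_rate theta h))%:E)%E,
  forall w, ~ Bad w -> forall m, m \in ms ->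
    \sum_(l <- m) empirical_error w l ^+ 2 <=
    (961 / 900 * (11 / 6 * (Phi ^+ 2 * #|` m|%:R)) +
     47 * del * (4 * Phi ^+ 2 * (#|` m|%:R + ell ^+ 16))) / n%:R &
  forall w, ~ Bad w -> forall m m', m \in ms -> m' \in ms ->
    (\sum_(l <- m' | l \notin m) c l * empirical_error w l) ^+ 2 <=
    (\sum_(l <- m' | l \notin m) c l ^+ 2) *
    (8 * del * (4 * Phi ^+ 2 * (#|` m'|%:R + ell ^+ 16)) / n%:R)].
Proof.
(* The truncation depends on the model. Outside [M] the zero functions and the empty null set serve
   as default. *)
have /choice[z zP] (m : {fset L}) : exists z : (L -> R -> R) * set Om,
    [/\ measurable z.2, P z.2 = 0%E, forall l, measurable_fun setT (z.1 l) &
     M m -> [/\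
      forall u, \sum_(l <- m) z.1 l u ^+ 2 <= Phi ^+ 2 * #|` m|%:R,
      forall l, l \in m -> path_mean Q (z.1 l) = c l,
      forall a : L -> R, path_mean Q (fun u => (\sum_(l <- m) a l * z.1 l u) ^+ 2) <=
        Num.sqrt (Phi ^+ 2 * #|` m|%:R) * ks * \sum_(l <- m) a l ^+ 2 &
      forall w, ~ z.2 w -> forall (i : nat) l, z.1 l (X i%:Z w) = psi l (X i%:Z w)]].
  have [Mm|nM] := pselect (M m); last first.
    by exists (fun _ _ => 0, set0); split => //= l; exact: measurable_cst.
  have [tp [mtp tpB tpc tpv [N [mN N0 NE]]]] :=
    truncated_model X_stationary s_ge0 s_L2 s_density psi_on M2 Mm.
  by exists (tp, N).
pose tp m := (z m).1; pose N m := (z m).2.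
have mtp m l : measurable_fun setT (tp m l) by have [_ _ + _] := zP m; exact.
have tpB m : m \in ms -> forall u, \sum_(l <- m) tp m l u ^+ 2 <= Phi ^+ 2 * #|` m|%:R.
  by move=> /msM Mm; have [_ _ _ /(_ Mm)[+ _ _ _]] := zP m; exact.
have tpc m l : m \in ms -> l \in m -> path_mean Q (tp m l) = c l.
  by move=> /msM Mm; have [_ _ _ /(_ Mm)[_ + _ _]] := zP m; exact.
have tpv m : m \in ms -> forall a : L -> R,
    path_mean Q (fun u => (\sum_(l <- m) a l * tp m l u) ^+ 2) <=
    Num.sqrt (Phi ^+ 2 * #|` m|%:R) * ks * \sum_(l <- m) a l ^+ 2.
  by move=> /msM Mm; have [_ _ _ /(_ Mm)[_ _ + _]] := zP m; exact.
have tpE m w : m \in ms -> ~ N m w -> forall (i : nat) l,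
    tp m l (X i%:Z w) = psi l (X i%:Z w).
  by move=> /msM Mm; have [_ _ _ /(_ Mm)[_ _ _ +]] := zP m; exact.
pose a2 (p : {fset L} * {fset L}) : R := \sum_(l <- p.2 | l \notin p.1) c l ^+ 2.
(* Unit vector in the direction of the bias between the two models; if [a2 p] is 0, division by 0
   gives the zero vector, which is harmless since the cross term then vanishes. *)
pose u (p : {fset L} * {fset L}) l : R :=
  if l \in p.1 then 0 else c l / Num.sqrt (a2 p).
have a20 p : 0 <= a2 p by apply: sumr_ge0 => l _; exact: sqr_ge0.
have u1 (p : {fset L} * {fset L}) : \sum_(l <- p.2) u p l ^+ 2 <= 1.
  have -> : \sum_(l <- p.2) u p l ^+ 2 = a2 p / a2 p.
    rewrite {1}/a2 mulr_suml [RHS]big_mkcond /=; apply: eq_bigr => l _.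
    rewrite /u; case: (l \in p.1) => /=; first by rewrite expr0n.
    by rewrite expr_div_n sqr_sqrtr.
  have [->|an0] := eqVneq (a2 p) 0; first by rewrite mul0r.
  by rewrite divff.
pose ps := [seq (m, m') | m <- ms, m' <- ms].
have psm p : p \in ps -> p.2 \in ms by move=> /allpairsP[[m m'] [_ mm' ->]].
have size_ps : size ps = (size ms * size ms)%N by rewrite size_allpairs.
(* The full period [900 * h] bounds both kinds of blocks, whence [q0 = 900] and the numerical lower
   bound on [C0]. *)
have q01 : 1 <= 900 :> R by rewrite ler1n.
have qs : (900 * h)%N%:R <= 900 * Num.sqrt n%:R / ell ^+ 2 :> R.
  rewrite (natrM _ 900 h) -[leRHS]mulrA; apply: ler_wpM2l; last exact: h_small.
  exact: ler0n.
have T1 : (size (concat_blocks (long_block n h) (n_blocks n h)))%:R <= n%:R :> R.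
  by rewrite ler_nat size_concat_long.
have T2 : (size (concat_blocks (short_block n h) (n_blocks n h)))%:R <=
    n%:R / 900 + h%:R :> R.
  by apply: le_trans short_size; rewrite ler_nat size_concat_short.
have T2n : n%:R / 900 + h%:R <= n%:R :> R.
  have : del * n%:R <= 2^-1 * n%:R by rewrite ler_wpM2r.
  by have := h_del; have := n0; lra.
have sl k : (size (long_block n h k) <= 900 * h)%N by exact: size_period_block.
have ss k : (size (short_block n h k) <= 900 * h)%N by exact: size_period_block.
have ul k : uniq (long_block n h k) by exact: uniq_period_block.
have us k : uniq (short_block n h k) by exact: uniq_period_block.
have [B1 [mB1 QB1 B1P]] := vector_deviation X_stationary theta_gt2 X_mixing Phi_neq0
  ks_ge0 mtp tpB tpv n0 ell_ge1 del01 h_gt0 ul (long_block_gap n h_gt0)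
  sl q01 C0_ge qs T1 (lexx _).
have [B2 [mB2 QB2 B2P]] := vector_deviation X_stationary theta_gt2 X_mixing Phi_neq0
  ks_ge0 mtp tpB tpv n0 ell_ge1 del01 h_gt0 us (short_block_gap n h_gt0)
  ss q01 C0_ge qs T2 T2n.
have [B3 [mB3 QB3 B3P]] := direction_deviation X_stationary theta_gt2 X_mixing Phi_neq0
  ks_ge0 mtp tpB tpv n0 ell_ge1 Cv_ell' del01 h_gt0 ul (long_block_gap n h_gt0)
  sl q01 C0_ge qs T1 (lexx _) psm u1.
have [B4 [mB4 QB4 B4P]] := direction_deviation X_stationary theta_gt2 X_mixing Phi_neq0
  ks_ge0 mtp tpB tpv n0 ell_ge1 Cv_ell' del01 h_gt0 us (short_block_gap n h_gt0)
  ss q01 C0_ge qs T2 T2n psm u1.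
have mpre (B : set PS) : measurable B -> measurable (sample_path X @^-1` B).
  by move=> mB; rewrite -[X in measurable X]setTI; exact: measurable_sample_path.
(* Beyond the end of [ms] the default [fset0] contributes its own null set. *)
pose E := \bigcup_(i : nat) N (nth fset0 ms i).
have mN m : measurable (N m) by have [] := zP m.
have mE : measurable E by apply: bigcupT_measurable => i.
have PE : P E = 0%E.
  apply/eqP; rewrite -measure_le0.
  apply: (@le_trans _ _ (\sum_(i <oo) P (N (nth fset0 ms i)))%E).
    exact: measure_sigma_subadditive.
  by rewrite eseries0// => i _ _; have [] := zP (nth fset0 ms i).
have EN w m : ~ E w -> m \in ms -> ~ N m w.
  by move=> nE mm Nw; apply: nE; exists (index m ms) => //=; rewrite nth_index.
pose BB := B1 `|` B2 `|` (B3 `|` B4).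
have mBB : measurable BB by do ! apply: measurableU.
exists (sample_path X @^-1` BB `|` E).
have errE w m : ~ E w -> m \in ms -> forall l, l \in m -> empirical_error w l =
    n%:R^-1 * (block_sum (concat_blocks (long_block n h) (n_blocks n h))
                 (centered_tp X tp m l) (sample_path X w) +
               block_sum (concat_blocks (short_block n h) (n_blocks n h))
                 (centered_tp X tp m l) (sample_path X w)).
  move=> nE mm l lm; rewrite /block_sum -sum_long_short// /empirical_error.
  rewrite -[n.+1]/(1 + n)%N /index_iota -[iota 1 (1 + n - 1)]/(iota 1 (n.+1 - 1)).
  rewrite subn1 /= /centered_tp sumrB tpc// mulrBr; congr (_ - _).
    by congr (_ * _); apply: eq_bigr => i _; rewrite -(tpE m w mm (EN w m nE mm)).
  rewrite big_const_seq count_predT iter_addr_0 size_iota -[c l *+ n]mulr_natl.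
  by rewrite mulrA mulVf ?mul1r// gt_eqF.
split.
- by apply: measurableU => //; exact: mpre.
- apply: (@le_trans _ _ (P (sample_path X @^-1` BB) + P E)%E).
    by apply: measureU2 => //; exact: mpre.
  rewrite PE adde0.
  rewrite -[P _]/(Q BB).
  have L0 (A B : set PS) (x y : R) : measurable A -> measurable B ->
      (Q A <= x%:E)%E -> (Q B <= y%:E)%E -> (Q (A `|` B) <= (x + y)%:E)%E.
    move=> mA mB Ax By; apply: (@le_trans _ _ (Q A + Q B)%E).
      exact: measureU2.
    by rewrite EFinD; exact: leeD.
  have := L0 _ _ _ _ (measurableU _ _ mB1 mB2) (measurableU _ _ mB3 mB4)
    (L0 _ _ _ _ mB1 mB2 QB1 QB2) (L0 _ _ _ _ mB3 mB4 QB3 QB4).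
  move=> /le_trans; apply; rewrite lee_fin size_ps -/(tail_bound).
  by rewrite le_eqVlt; apply/orP; left; apply/eqP; ring.
- move=> w /not_orP[/= nB nE] m mm.
  have nB1 : ~ B1 (sample_path X w) by move=> b; apply: nB; left; left.
  have nB2 : ~ B2 (sample_path X w) by move=> b; apply: nB; left; right.
  rewrite (eq_big_seq _ (fun l lm => congr1 (fun t => t ^+ 2) (errE w m nE mm l lm))).
  apply: combine_sqr.
  + by apply: mulr_ge0; [rewrite divr_ge0|rewrite mulr_ge0 ?sqr_ge0].
  + apply: strong_le_scale; rewrite mulr_ge0 ?sqr_ge0// exprn_ge0//.
    exact: le_trans ell_ge1.
  + exact: B1P.
  + exact: B2P.
- move=> w /not_orP[/= nB nE] m m' mm mm'.
  have nB3 : ~ B3 (sample_path X w) by move=> b; apply: nB; right; left.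
  have nB4 : ~ B4 (sample_path X w) by move=> b; apply: nB; right; right.
  have pp : (m, m') \in ps by apply/allpairsP; exists (m, m').
  have := B3P _ nB3 _ pp; have := B4P _ nB4 _ pp; rewrite /=.
  set W := 4 * Phi ^+ 2 * _.
  set S2 := \sum_(l <- m') _; set S1 := \sum_(l <- m') _ => H2 H1.
  have W0 : 0 <= W.
    apply: mulr_ge0; first by rewrite mulr_ge0 ?sqr_ge0.
    by apply: addr_ge0 => //; apply: exprn_ge0; exact: le_trans ell_ge1.
  have CW : Cv * W / ell ^+ 4 <= del * W.
    rewrite ler_pdivrMr ?exprn_gt0 ?(lt_le_trans _ ell_ge1)//.
    by rewrite mulrAC ler_wpM2r.
  have CW1 : n%:R * (Cv * W / ell ^+ 4) <= n%:R * (del * W) by rewrite ler_wpM2l.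
  have CW2 : (n%:R / 900 + h%:R) * (Cv * W / ell ^+ 4) <= n%:R * (del * W).
    apply: (@le_trans _ _ ((n%:R / 900 + h%:R) * (del * W))).
      apply: ler_wpM2l; last exact: CW.
      by apply: addr_ge0; [apply: divr_ge0; exact: ler0n|exact: ler0n].
    apply: ler_wpM2r; last exact: T2n.
    by apply: mulr_ge0; [exact: ltW|exact: W0].
  have uE : \sum_(l <- m') u (m, m') l * empirical_error w l = n%:R^-1 * (S1 + S2).
    rewrite /S1 /S2 -big_split mulr_sumr big_seq [RHS]big_seq.
    apply: eq_bigr => l lm; rewrite (errE w m' nE mm' l lm) /=; ring.
  have uB : (\sum_(l <- m') u (m, m') l * empirical_error w l) ^+ 2 <= 8 * del * W / n%:R.
    rewrite uE exprMn exprVn ler_pdivrMl ?exprn_gt0//.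
    apply: le_trans (sqrD_le _ _) _.
    have -> : n%:R ^+ 2 * (8 * del * W / n%:R) = 8 * (n%:R * (del * W)).
      by field; rewrite gt_eqF.
    apply: double_le H1 H2 CW1 CW2 _; ring.
  have -> : \sum_(l <- m' | l \notin m) c l * empirical_error w l =
      Num.sqrt (a2 (m, m')) * \sum_(l <- m') u (m, m') l * empirical_error w l.
    have [a0|an0] := eqVneq (a2 (m, m')) 0.
      rewrite a0 sqrtr0 mul0r big1_seq// => l /andP[lm lm'].
      have : c l ^+ 2 <= a2 (m, m').
        rewrite /a2 (big_rem l)//= lm lerDl.
        by apply: sumr_ge0 => j _; exact: sqr_ge0.
      rewrite a0 => c0; have /eqP : c l ^+ 2 = 0 by apply/eqP; rewrite eq_le c0 sqr_ge0.
      by rewrite sqrf_eq0 => /eqP ->; rewrite mul0r.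
    rewrite mulr_sumr [LHS]big_mkcond; apply: eq_bigr => l _; rewrite /u /=.
    case: (l \in m) => /=; first by rewrite mul0r mulr0.
    rewrite mulrA mulrCA divff ?mulr1// sqrtr_eq0 -ltNge lt_def an0.
    exact: a20.
  by rewrite exprMn sqr_sqrtr ?a20// ler_wpM2l ?a20.
Qed.

End good_event.

(** * Oracle inequality *)

Section oracle_inequality.
Context (R : realType).

(** Linear core of [oracle_scalar], with [X = F * Dh], [Y = F * D], [Z = F * Lr], [e = eta] and
    [e2 = eta ^+ 2]; products such as [e * X] are atoms for [lra]. *)
Let linear (B Bh p ph pen penh S X Y Z e e2 : R) :
  0 <= p -> Bh + ph <= B + pen - p + (2 * ph - penh) + 2 * S ->
  ph <= 49 / 25 * X + 188 * e2 * X + 188 * e2 * Z ->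
  2 * S <= e * B + e * Bh + 32 * (e * X + e * Y + e * Z) ->
  e2 * X <= e / 1000 * X -> e2 * Z <= e / 1000 * Z -> e * X <= 1 / 1000 * X ->
  e * Z <= e * Y -> e * (4 * Y) <= e * pen -> 0 <= e * B -> 0 <= e * ph ->
  0 <= e * Y -> 0 <= X -> 4 * X <= penh ->
  Bh + ph - e * Bh - e * ph <= B + pen + 17 * (e * B) + 17 * (e * pen).
Proof. by move=> *; lra. Qed.

(* [Bh + ph] and [B + pen] are the risks of the selected and of the oracle
   model; the penalty exceeds twice the variance term by [0.08 F Dh], which
   absorbs all the remainder terms. *)
Lemma oracle_scalar (B Bh p ph pen penh S F D Dh Lr eta : R) :
  0 < eta -> 1000 * eta <= 1 -> 0 <= B -> 0 <= Bh -> 0 <= p -> 0 <= ph ->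
  0 <= F -> 0 <= D -> 0 <= Dh -> 0 <= Lr -> Lr <= D ->
  4 * (F * D) <= pen -> 4 * (F * Dh) <= penh ->
  Bh + ph <= B + pen - p + (2 * ph - penh) + 2 * S ->
  ph <= 49 / 25 * (F * Dh) + 188 * eta ^+ 2 * (F * (Dh + Lr)) ->
  S ^+ 2 <= (B + Bh) * (32 * eta ^+ 2 * (F * (Dh + D + Lr))) ->
  Bh + ph <= (1 + 20 * eta) * (B + pen).
Proof.
move=> e0 e1 B0 Bh0 p0 ph0 F0 D0 Dh0 L0 LD penD penDh crit phb S2.
set G := F * (Dh + D + Lr) in S2.
have FD : 0 <= F * D by exact: mulr_ge0.
have FDh : 0 <= F * Dh by exact: mulr_ge0.
have FL : F * Lr <= F * D by exact: ler_wpM2l.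
have FL0 : 0 <= F * Lr by exact: mulr_ge0.
have GE : G = F * Dh + F * D + F * Lr by rewrite /G; ring.
have G0 : 0 <= G by rewrite GE !addr_ge0.
have phb' : ph <= 49 / 25 * (F * Dh) +
    188 * eta ^+ 2 * (F * Dh) + 188 * eta ^+ 2 * (F * Lr).
  by apply: le_trans phb _; rewrite le_eqVlt; apply/orP; left; apply/eqP; ring.
(* Arithmetic-geometric inequality balanced by [eta]: the biases come back with a small factor, and
   [G] is absorbed by the surplus of the penalties. *)
have SE : 2 * S <= eta * (B + Bh) + 32 * eta * G.
  have T0 : 0 <= eta * (B + Bh) + 32 * eta * G.
    by apply: addr_ge0; rewrite !mulr_ge0 ?addr_ge0// ltW.
  apply: le_trans (ler_norm _) _.
  rewrite -ler_sqr ?nnegrE// real_normK ?num_real//.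
  have -> : (2 * S) ^+ 2 = 4 * S ^+ 2 by ring.
  apply: (@le_trans _ _ (4 * ((eta * (B + Bh)) * (32 * eta * G)))).
    apply: (@le_trans _ _ (4 * ((B + Bh) * (32 * eta ^+ 2 * G)))).
      by rewrite ler_wpM2l.
    by rewrite le_eqVlt; apply/orP; left; apply/eqP; ring.
  set x := eta * _; set y := 32 * eta * G.
  by have := sqr_ge0 (x - y); rewrite sqrrB sqrrD; lra.
have e2 : eta ^+ 2 <= eta / 1000.
  by rewrite expr2 ler_pM2l//; lra.
have e2Dh : eta ^+ 2 * (F * Dh) <= eta / 1000 * (F * Dh) by rewrite ler_wpM2r.
have e2L : eta ^+ 2 * (F * Lr) <= eta / 1000 * (F * Lr) by rewrite ler_wpM2r.
have e3 : eta <= 1 / 1000 by lra.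
have eDh : eta * (F * Dh) <= 1 / 1000 * (F * Dh) by rewrite ler_wpM2r.
have eL : eta * (F * Lr) <= eta * (F * D) by rewrite ler_wpM2l// ltW.
have epen : eta * (4 * (F * D)) <= eta * pen by rewrite ler_wpM2l// ltW.
have GeE : eta * G = eta * (F * Dh) + eta * (F * D) + eta * (F * Lr).
  by rewrite GE; ring.
have eB : 0 <= eta * B by rewrite mulr_ge0// ltW.
have eph : 0 <= eta * ph by rewrite mulr_ge0// ltW.
(* The risk of the selected model also occurs on the right and is moved to the left; 17 becomes 20
   because 1 + 17 eta <= (1 - eta)(1 + 20 eta). *)
have step : (1 - eta) * (Bh + ph) <= (1 + 17 * eta) * (B + pen).
  have -> : (1 - eta) * (Bh + ph) = Bh + ph - eta * Bh - eta * ph by ring.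
  have -> : (1 + 17 * eta) * (B + pen) = B + pen + 17 * (eta * B) + 17 * (eta * pen).
    by ring.
  have SE' : 2 * S <= eta * B + eta * Bh + 32 * (eta * G).
    by apply: le_trans SE _; rewrite le_eqVlt; apply/orP; left; apply/eqP; ring.
  rewrite GeE in SE'.
  have eY0 : 0 <= eta * (F * D) by rewrite mulr_ge0// ltW.
  exact: (linear p0 crit phb' SE' e2Dh e2L eDh eL epen eB eph eY0 FDh penDh).
have R0 : 0 <= B + pen by rewrite addr_ge0//; lra.
have e11 : 0 < 1 - eta by lra.
rewrite -(ler_pM2l e11); apply: le_trans step _.
rewrite mulrA ler_wpM2r//.
have : eta * eta <= eta / 1000 by rewrite -expr2.
lra.
Qed.

Context (L : choiceType).

(** By nesting, the cross term lives on the difference of the two models, where the squared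
    coefficients sum to at most the bias of the smaller one. Only the deviation along one direction
    per pair is therefore needed. *)
Lemma oracle_models (m mh : {fset L}) (c nu : L -> R) (sig2 pen penh F Lr eta : R) :
  (m `<=` mh)%fset \/ (mh `<=` m)%fset ->
  \sum_(l <- m) c l ^+ 2 <= sig2 -> \sum_(l <- mh) c l ^+ 2 <= sig2 ->
  0 < eta -> 1000 * eta <= 1 -> 0 <= F -> 0 <= Lr -> Lr <= #|` m|%:R ->
  4 * (F * #|` m|%:R) <= pen -> 4 * (F * #|` mh|%:R) <= penh ->
  - \sum_(l <- mh) (c l + nu l) ^+ 2 + penh <=
  - \sum_(l <- m) (c l + nu l) ^+ 2 + pen ->
  \sum_(l <- mh) nu l ^+ 2 <= 49 / 25 * (F * #|` mh|%:R) +
    188 * eta ^+ 2 * (F * (#|` mh|%:R + Lr)) ->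
  (\sum_(l <- mh | l \notin m) c l * nu l) ^+ 2 <=
    (\sum_(l <- mh | l \notin m) c l ^+ 2) *
    (32 * eta ^+ 2 * (F * (#|` mh|%:R + Lr))) ->
  (\sum_(l <- m | l \notin mh) c l * nu l) ^+ 2 <=
    (\sum_(l <- m | l \notin mh) c l ^+ 2) *
    (32 * eta ^+ 2 * (F * (#|` m|%:R + Lr))) ->
  sig2 - \sum_(l <- mh) c l ^+ 2 + \sum_(l <- mh) nu l ^+ 2 <=
  (1 + 20 * eta) * (sig2 - \sum_(l <- m) c l ^+ 2 + pen).
Proof.
move=> nest cm cmh e0 e1 F0 L0 LD penD penDh crit phb Sh Sm.
have sum_sub (a b : {fset L}) (f : L -> R) : (a `<=` b)%fset ->
    \sum_(l <- b) f l = \sum_(l <- a) f l + \sum_(l <- b | l \notin a) f l.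
  move=> /fsubsetP ab; rewrite (bigID (mem a)) /=; congr (_ + _).
  rewrite -big_filter; apply: perm_big; apply: uniq_perm.
  - exact: filter_uniq (fset_uniq b).
  - exact: fset_uniq.
  - by move=> l; rewrite mem_filter; case: (boolP (l \in a)) => // /ab ->.
set Dm := #|` m|%:R in LD penD Sm *; set Dh := #|` mh|%:R in penDh phb Sh.
have Dm0 : 0 <= Dm by []. have Dh0 : 0 <= Dh by [].
pose S := \sum_(l <- mh) c l * nu l - \sum_(l <- m) c l * nu l.
have expand (a : {fset L}) : \sum_(l <- a) (c l + nu l) ^+ 2 =
    \sum_(l <- a) c l ^+ 2 + (2 * \sum_(l <- a) c l * nu l + \sum_(l <- a) nu l ^+ 2).
  by rewrite mulr_sumr -!big_split /=; apply: eq_bigr => l _; ring.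
apply: (@oracle_scalar _ _ (\sum_(l <- m) nu l ^+ 2) _ _ penh S F Dm Dh Lr) => //.
- by rewrite subr_ge0.
- by rewrite subr_ge0.
- exact: sum_sqr_ge0.
- exact: sum_sqr_ge0.
- rewrite !expand in crit; rewrite /S; lra.
have mono (a b x y : R) : 0 <= a -> a <= b -> 0 <= x -> x <= y ->
    a * (32 * eta ^+ 2 * (F * x)) <= b * (32 * eta ^+ 2 * (F * y)).
  move=> a0 ab xy0 xy; have e32 : 0 <= 32 * eta ^+ 2 by rewrite mulr_ge0 ?sqr_ge0.
  apply: (@le_trans _ _ (a * (32 * eta ^+ 2 * (F * y)))).
    by rewrite !ler_wpM2l.
  rewrite ler_wpM2r//; apply: mulr_ge0 => //; apply: mulr_ge0 => //.
  exact: le_trans xy0 xy.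
have sig0 : 0 <= sig2 - \sum_(l <- mh) c l ^+ 2 by rewrite subr_ge0.
have sig0' : 0 <= sig2 - \sum_(l <- m) c l ^+ 2 by rewrite subr_ge0.
case: nest => sub.
  have -> : S = \sum_(l <- mh | l \notin m) c l * nu l.
    by rewrite /S (sum_sub _ _ _ sub); ring.
  apply: le_trans Sh _; apply: mono.
  - by apply: sumr_ge0 => l _; exact: sqr_ge0.
  - by rewrite (sum_sub _ _ (fun l => c l ^+ 2) sub) in sig0 *; lra.
  - exact: addr_ge0.
  - by lra.
have -> : S ^+ 2 = (\sum_(l <- m | l \notin mh) c l * nu l) ^+ 2.
  by rewrite /S (sum_sub _ _ (fun l => c l * nu l) sub); ring.
apply: le_trans Sm _; apply: mono.
- by apply: sumr_ge0 => l _; exact: sqr_ge0.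
- by rewrite (sum_sub _ _ (fun l => c l ^+ 2) sub) in sig0' *; lra.
- exact: addr_ge0.
- by lra.
Qed.

End oracle_inequality.

(** * The estimator and the risks in coefficients *)

Section estimator.
Context (R : realType) (L : choiceType) (psi : L -> R -> R) (s : R -> R).
Local Notation mu := (@lebesgue_measure R).
Hypothesis psi_on : orthonormal_system psi.
Hypothesis s_L2 : s \in Lfun mu 2%:E.
Let c l := dotL2 (psi l) s.

Definition empirical_coef (x : int -> R) (n : nat) (l : L) : R :=
  n%:R^-1 * \sum_(1 <= i < n.+1) psi l (x i%:Z).

(** Completion of the square in each coefficient. *)
Lemma contrast_sum (x : int -> R) (n : nat) (m : {fset L}) (a : L -> R) :
  contrast x n (fun y => \sum_(l <- m) a l * psi l y) =
  \sum_(l <- m) (a l - empirical_coef x n l) ^+ 2 -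
  \sum_(l <- m) empirical_coef x n l ^+ 2.
Proof.
have t2 : (fun y => \sum_(l <- m) a l * psi l y) \in Lfun mu 2%:E.
  by apply: L2_sum; exact: psi_on.1.
rewrite /contrast (Lpnorm2E t2) (dotL2_sum_self psi_on a (fset_uniq m)) /=.
rewrite sqr_sqrtr ?sum_sqr_ge0// exchange_big /= -sumrB mulr_sumr -sumrB.
apply: eq_bigr => l _; rewrite -mulr_sumr /empirical_coef.
set A := \sum_(_ <= _ < _) _; ring.
Qed.

Lemma pls_estimator (M : set {fset L}) (pen : {fset L} -> R) (x : int -> R)
    (n : nat) (mh : {fset L}) (t : R -> R) :
  is_pen_ls_estimator psi M pen x n mh t ->
  [/\ M mh, forall m, M m ->
    - \sum_(l <- mh) empirical_coef x n l ^+ 2 + pen mh <=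
    - \sum_(l <- m) empirical_coef x n l ^+ 2 + pen m &
    (Lpnorm 2%:E (t \- s)%R ^+ 2 = (dotL2 s s - \sum_(l <- mh) c l ^+ 2 +
      \sum_(l <- mh) (empirical_coef x n l - c l) ^+ 2)%:E)%E].
Proof.
move=> [Mmh crit_le [a tE] tcrit].
have critE m : contrast x n (proj_estimator psi x n m) =
    - \sum_(l <- m) empirical_coef x n l ^+ 2.
  rewrite contrast_sum big1 ?sub0r// => l _.
  by rewrite subrr expr0n.
have {}crit_le m : M m ->
    - \sum_(l <- mh) empirical_coef x n l ^+ 2 + pen mh <=
    - \sum_(l <- m) empirical_coef x n l ^+ 2 + pen m.
  by move=> Mm; have := crit_le m Mm; rewrite !critE.
split => //.
have infE : ereal_inf [set (contrast x n (proj_estimator psi x n m') + pen m')%:E |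
    m' in M] = (- \sum_(l <- mh) empirical_coef x n l ^+ 2 + pen mh)%:E.
  apply/eqP; rewrite eq_le; apply/andP; split.
    by apply: ereal_inf_lbound; exists mh => //; rewrite critE.
  apply: le_ereal_inf_tmp => _ [m Mm <-].
  by rewrite critE lee_fin crit_le.
(* Attaining the infimum forces the sum of squares in [contrast_sum] to vanish, which identifies the
   coefficients of [t] on [mh]. *)
move: tcrit; rewrite infE => -[]; rewrite tE contrast_sum => /addIr.
move=> /(canRL (addrK _)); rewrite opprK addNr => a0.
have aE l : l \in mh -> a l = empirical_coef x n l.
  move=> lm; apply/eqP; rewrite -subr_eq0 -sqrf_eq0 eq_le sqr_ge0 andbT -a0.
  rewrite (big_rem l)//= lerDl; exact: sum_sqr_ge0.
rewrite Lpnorm2_sqr; last first.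
  by apply: L2B => //; apply: L2_sum; exact: psi_on.1.
congr (_%:E).
have := dotL2_sum_sub psi_on a s_L2 (fset_uniq mh).
move=> ->; rewrite -/c.
have -> : \sum_(l <- mh) a l * dotL2 (psi l) s = \sum_(l <- mh) empirical_coef x n l * c l.
  by apply: eq_big_seq => l lm; rewrite aE.
have -> : \sum_(l <- mh) a l ^+ 2 = \sum_(l <- mh) empirical_coef x n l ^+ 2.
  by apply: eq_big_seq => l lm; rewrite aE.
rewrite -!addrA; congr (_ + _); rewrite mulr_sumr -!sumrN -!big_split /=.
by apply: eq_bigr => l _; ring.
Qed.

Lemma oracle_bias (m : {fset L}) (sm : R -> R) :
  is_orth_proj (model psi m) s sm ->
  (Lpnorm 2%:E (s \- sm)%R ^+ 2 = (dotL2 s s - \sum_(l <- m) c l ^+ 2)%:E)%E.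
Proof.
move=> /(orth_proj_coef psi_on s_L2) smE.
have sm2 : sm \in Lfun mu 2%:E by rewrite smE; apply: L2_sum; exact: psi_on.1.
rewrite Lpnorm2_sqr; last exact: L2B.
congr (_%:E).
have -> : dotL2 (s \- sm) (s \- sm) = dotL2 (fun x => sm x - s x) (fun x => sm x - s x).
  by apply: eq_Rintegral => x _ /=; ring.
rewrite smE (dotL2_sum_sub psi_on (fun l => dotL2 (psi l) s) s_L2 (fset_uniq m)).
rewrite -!addrA; congr (_ + _).
under eq_bigr do rewrite -expr2.
by rewrite /c; lra.
Qed.

Lemma sum_coef_le (m : {fset L}) : \sum_(l <- m) c l ^+ 2 <= dotL2 s s.
Proof.
have := dotL2_sum_sub psi_on (fun l => dotL2 (psi l) s) s_L2 (fset_uniq m).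
under [X in _ = _ - 2 * X + _]eq_bigr do rewrite -expr2.
set d := dotL2 (fun x => _) _ => dE.
have : 0 <= d by apply: Rintegral_ge0 => x _; rewrite -expr2 sqr_ge0.
by rewrite dE /c; lra.
Qed.

(** If [Phi] were 0, the sup bound would make [psi l] vanish almost everywhere, against its unit
    norm. This gives the positivity of the scale [W]. *)
Lemma M2_constant_neq0 (Phi : R) (M : set {fset L}) (m : {fset L}) :
  assumption_M2 psi Phi M -> M m -> (0 < #|` m|)%N -> Phi != 0.
Proof.
move=> M2 Mm; rewrite cardfs_gt0 => /fset0Pn[l lm].
apply/eqP => Phi0; have [E [mE E0 EB]] := M2_sup_bound psi_on M2 Mm.
have : dotL2 (psi l) (psi l) = 0.
  rewrite /dotL2 /Rintegral (ae_eq_integral (cst 0%E)) ?integral0//.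
  - apply/measurable_EFinP; apply: measurable_funM;
      by apply: L2_measurable; exact: psi_on.1.
  - exists E; split => // x /= nE; apply: contrapT => Ex; apply: nE => _.
    have := EB x Ex; rewrite Phi0 expr0n mul0r => psi0.
    have : psi l x ^+ 2 <= 0.
      apply: le_trans psi0; rewrite (big_rem l)//= lerDl; exact: sum_sqr_ge0.
    rewrite -expr2 => h; congr (_%:E); apply/eqP; rewrite eq_le h.
    exact: sqr_ge0.
by rewrite psi_on.2 eqxx => /eqP; rewrite oner_eq0.
Qed.

End estimator.

Section kappa1_bound.
Context (R : realType) (d : measure_display) (Om : measurableType d)
  (P : probability Om R) (X : int -> {RV P >-> R}) (theta : R).
Hypothesis theta_gt2 : 2 < theta.
Hypothesis X_mixing : arithmetically_beta_mixing X theta.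

Lemma beta_coef_ge0 (d' : measure_display) (G : set (set Om))
    (T : measurableType d') (Y : Om -> T) : (0 <= beta_coef P G Y)%E.
Proof.
apply: le_ereal_inf_tmp => _ [k _ ->]; apply: integral_ge0 => w _.
apply: ereal_sup_ge; exists `|k w set0 - P (Y @^-1` set0)|%E; first by exists set0.
exact: abse_ge0.
Qed.

Lemma beta_mixing_ge0 k : (0 <= beta_mixing X k)%E.
Proof. by rewrite /beta_mixing; case: ifP => // _; exact: beta_coef_ge0. Qed.

Lemma kappa1_ge1 : 1 <= kappa1 X.
Proof.
have le1 : (1 <= \sum_(0 <= l <oo) beta_mixing X l)%E.
  rewrite (nneseries_split 0 1); last by move=> k _; exact: beta_mixing_ge0.
  rewrite big_nat1 {1}/beta_mixing eqxx leeDl//.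
  by apply: nneseries_ge0 => k _ _; exact: beta_mixing_ge0.
have rate_le n : \sum_(0 <= l < n) mixing_rate theta l <= 1 + 5 / 24 :> R.
  case: n => [|n]; first by rewrite big_geq// addr_ge0// divr_ge0.
  rewrite big_ltn//; apply: lerD; last exact: (sum_mixing_rate_le theta_gt2 n).
  by rewrite /mixing_rate addr0 powR1.
(* Finiteness matters because [fine] sends [+oo] to 0. *)
have fin : (\sum_(0 <= l <oo) beta_mixing X l < +oo)%E.
  apply: (@le_lt_trans _ _ (1 + 5 / 24)%:E); last exact: ltry.
  apply: lime_le; first by apply: is_cvg_nneseries => k _ _; exact: beta_mixing_ge0.
  near=> n.
  apply: (@le_trans _ _ (\sum_(0 <= l < n) (mixing_rate theta l)%:E)%E).
    by apply: lee_sum => l _; exact: X_mixing.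
  by rewrite sumEFin lee_fin; exact: rate_le.
have ge0 : (0 <= \sum_(0 <= l <oo) beta_mixing X l)%E by exact: le_trans le1.
by rewrite /kappa1 -lee_fin fineK// ge0_fin_numE.
Unshelve. all: by end_near. Qed.

End kappa1_bound.

(** * Rates *)

Section rates.
Context (R : realType) (theta kappa Cv C0 : R).
Hypothesis theta_gt2 : 2 < theta.
Hypothesis kappa_gt2 : 2 < kappa.
Hypothesis Cv_ge0 : 0 <= Cv.
Hypothesis C0_ge1 : 1 <= C0.

(** Lower bound for r = ell^(1/4): 1000 serves the oracle inequality, [Cv] the weak variance,
    [theta] and [kappa] the comparison with the rate; the factor [C0] undoes the division by [C0] in
    the exponent. *)
Definition radius_threshold : R := C0 * (1000 + Cv + theta + 8 * kappa).

Definition deviation_rate (n : nat) : R :=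
  ln n%:R `^ ((theta + 2) * kappa) / n%:R `^ (theta / 2).

Context (n : nat) (ell r : R).
Hypothesis n_gt0 : (0 < n)%N.
Hypothesis ellE : ln n%:R = ell.
Hypothesis rE : r ^+ 4 = ell.
Hypothesis r_ge : radius_threshold <= r.

Lemma radius_large : 1000 <= r /\ 8 * kappa <= r.
Proof.
have H : 1 * (1000 + Cv + theta + 8 * kappa) <= r.
  apply: le_trans r_ge; apply: ler_wpM2r; last exact: C0_ge1.
  by have := theta_gt2; have := kappa_gt2; have := Cv_ge0; lra.
have := theta_gt2; have := kappa_gt2; have := Cv_ge0; split; lra.
Qed.

Let r_ge1 : 1 <= r. Proof. by have [] := radius_large; lra. Qed.
Let r_gt0 : 0 < r. Proof. exact: lt_le_trans r_ge1. Qed.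

Lemma log_ge1 : 1 <= ell.
Proof. by rewrite -rE exprn_ege1. Qed.

Let ell_gt0 : 0 < ell. Proof. exact: lt_le_trans log_ge1. Qed.

Let nE : n%:R = expR ell.
Proof. by rewrite -ellE lnK// posrE ltr0n. Qed.

(** Ensures that the gap is at least 1: ln ell = 4 ln r <= 4 r, while 8 kappa <= r <= r^3 and r^4 =
    ell. *)
Lemma log_log_le : kappa * ln ell <= ell / 2.
Proof.
have lnr : ln ell <= 4 * r.
  rewrite -rE lnXn// -[leLHS]mulr_natl; apply: ler_wpM2l => //.
  exact: ltW (ln_sublinear r_gt0).
apply: (@le_trans _ _ (kappa * (4 * r))).
  by rewrite ler_wpM2l//; have := kappa_gt2; lra.
have [_ kr] := radius_large.
have r3 : r <= r ^+ 3 by rewrite ler_eXnr.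
have k3 : 8 * kappa * r <= r ^+ 3 * r by apply: ler_wpM2r; [exact: ltW|exact: le_trans r3].
by rewrite -rE exprSr; lra.
Qed.

(** [expR u] is sqrt n / ell^kappa; in logarithmic form the comparisons of rates become linear. *)
Let u : R := ell / 2 - kappa * ln ell.
Let u_ge0 : 0 <= u. Proof. by rewrite subr_ge0; exact: log_log_le. Qed.

Definition gap : nat := Num.truncn (expR u).

Let gap_le : gap%:R <= expR u. Proof. by rewrite truncn_le expR_ge0. Qed.
Let gap_gt : expR u < 1 + gap%:R.
Proof. by rewrite addrC natr1; exact: truncnS_gt. Qed.

Lemma gap_gt0 : (0 < gap)%N.
Proof. by rewrite truncn_gt0 -expR0 ler_expR. Qed.

Let lnell_ge0 : 0 <= ln ell. Proof. exact: ln_ge0 log_ge1. Qed.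

(** The threshold 2 for [kappa] comes from here: [ell ^+ 2] is the factor by which the exponential
    step needs blocks shorter than sqrt n. *)
Lemma gap_small : gap%:R <= Num.sqrt n%:R / ell ^+ 2.
Proof.
apply: le_trans gap_le _.
have -> : Num.sqrt n%:R = expR (ell / 2) :> R.
  have -> : n%:R = expR (ell / 2) ^+ 2 :> R by rewrite -expRM_natl nE; congr expR; field.
  by rewrite sqrtr_sqr ger0_norm ?expR_ge0.
have -> : ell ^+ 2 = expR (2 * ln ell) by rewrite expRM_natl lnK.
rewrite -expRN -expRD ler_expR /u lerD2l lerN2 ler_wpM2r//.
exact: ltW.
Qed.

Lemma gap_le_eta : gap%:R <= r^-1 ^+ 2 * n%:R.
Proof.
apply: le_trans gap_small _; rewrite exprVn [leRHS]mulrC.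
have n1 : 1 <= n%:R :> R by rewrite ler1n.
apply: ler_pM.
- exact: sqrtr_ge0.
- by rewrite invr_ge0 sqr_ge0.
- apply: (@le_trans _ _ (Num.sqrt (n%:R ^+ 2))).
    by rewrite ler_sqrt ?sqr_ge0// ler_eXnr.
  by rewrite sqrtr_sqr ger0_norm.
- rewrite lef_pV2 ?posrE ?exprn_gt0//; rewrite -rE -exprM.
  by rewrite ler_weXn2l.
Qed.

Let half_gap : gap%:R <= 2^-1 * n%:R :> R.
Proof.
apply: le_trans gap_le_eta _; rewrite ler_wpM2r// exprVn lef_pV2 ?posrE ?exprn_gt0//.
have [r1000 _] := radius_large.
have r2 : r <= r ^+ 2 by rewrite ler_eXnr.
by apply: le_trans r2; apply: le_trans r1000; rewrite ler_nat.
Qed.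

Let rateE : deviation_rate n = expR ((theta + 2) * kappa * ln ell - theta / 2 * ell).
Proof.
rewrite /deviation_rate ellE nE /powR gt_eqF// gt_eqF ?expR_gt0// expRK.
by rewrite -expRN -expRD.
Qed.

Lemma n_blocks_le : (n_blocks n gap)%:R <= 2 * expR (ell - u).
Proof.
have nbg : (n_blocks n gap)%:R * gap%:R <= n%:R :> R.
  have := n_blocks_mul_le n gap_gt0; set k := (n_blocks n gap * gap)%N.
  rewrite -natrM -/k -(ler_nat R) natrD !natrM => H.
  by have := half_gap; have := ler0n R n; lra.
have g1 : 1 <= gap%:R :> R by rewrite ler1n gap_gt0.
rewrite expRD expRN mulrA ler_pdivlMr ?expR_gt0// -nE.
apply: (@le_trans _ _ ((n_blocks n gap)%:R * (2 * gap%:R))).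
  by apply: ler_wpM2l => //; apply: le_trans (ltW gap_gt) _; lra.
by rewrite mulrCA ler_wpM2l.
Qed.

Lemma n_blocks_mixing_rate :
  (n_blocks n gap)%:R * mixing_rate theta gap <= 2 * deviation_rate n.
Proof.
(* The rate is evaluated at [1 + gap], which exceeds [expR u], so the integer part costs nothing. *)
have mr : mixing_rate theta gap <= expR (- (1 + theta) * u).
  rewrite /mixing_rate mulNr expRN powRN lef_pV2 ?posrE ?expR_gt0 ?powR_gt0 ?ltr_pwDl//.
  rewrite [_ * u]mulrC expRM ge0_ler_powR ?nnegrE ?expR_ge0 ?addr_ge0//.
    by have := theta_gt2; lra.
  exact: ltW gap_gt.
apply: le_trans (ler_pM _ _ n_blocks_le mr) _ => //; first exact: mixing_rate_ge0.
rewrite -mulrA -expRD rateE le_eqVlt; apply/orP; left; apply/eqP.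
by congr (2 * expR _); rewrite /u; field.
Qed.

(** The exponent is [ell * (r ^+ 2 / C0)], and [r_ge] makes the second factor larger than any
    multiple of [ell] to be beaten; [12 * n%:R ^+ 2] covers the models and the pairs of models. *)
Lemma tail_bound_rate :
  12 * n%:R ^+ 2 * expR (- (r^-1 ^+ 2 * ell ^+ 2 / C0) + (Cv + 1)) <= deviation_rate n.
Proof.
have e12 : 12 <= expR 12 :> R by apply: le_trans (expR_ge1Dx _); rewrite lerDr.
rewrite nE -expRM_natl.
apply: (@le_trans _ _ (expR 12 * expR (2 * ell) * expR (- (r^-1 ^+ 2 * ell ^+ 2 / C0) + (Cv + 1)))).
  by rewrite -!mulrA ler_wpM2r// mulr_ge0 ?expR_ge0.
rewrite -!expRD rateE ler_expR.
have -> : r^-1 ^+ 2 * ell ^+ 2 / C0 = r ^+ 4 * (r ^+ 2 / C0).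
  by rewrite -rE; field; rewrite !gt_eqF// (lt_le_trans _ C0_ge1).
have r2 : 1000 + Cv + theta + 8 * kappa <= r ^+ 2 / C0.
  rewrite ler_pdivlMr ?(lt_le_trans _ C0_ge1)// mulrC.
  by apply: le_trans r_ge _; rewrite ler_eXnr.
have H : r ^+ 4 * (1000 + Cv + theta + 8 * kappa) <= r ^+ 4 * (r ^+ 2 / C0).
  by rewrite ler_wpM2l// exprn_ge0// ltW.
have kl : 0 <= (theta + 2) * kappa * ln ell.
  apply: mulr_ge0 lnell_ge0; apply: mulr_ge0; first by have := theta_gt2; lra.
  by have := kappa_gt2; lra.
rewrite rE in H *.
have eC : 1 * Cv <= ell * Cv by rewrite ler_wpM2r// log_ge1.
have et : 0 <= ell * theta by rewrite mulr_ge0 ?ltW//; have := theta_gt2; lra.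
have ek : 0 <= ell * kappa by rewrite mulr_ge0 ?ltW//; have := kappa_gt2; lra.
move: H eC kl; have := log_ge1; set T := ell * (_ / _); set U := _ * ln ell; lra.
Qed.

End rates.

(** [M_3] leaves at most one model per dimension and [M_1] bounds the dimensions by [n]; the number
    of tests is thus polynomial in [n]. *)
Lemma model_enumeration (L : choiceType) (n : nat) (M : set {fset L}) :
  assumption_M1 n M -> assumption_M3 M ->
  exists ms : seq {fset L}, [/\ (size ms <= n.+1)%N,
    forall m, m \in ms -> M m & forall m, M m -> m \in ms].
Proof.
move=> M1 M3.
have inj m m' : M m -> M m' -> #|` m| = #|` m'| -> m = m'.
  move=> Mm Mm' mm'; apply/eqP; rewrite eqEfsubset.
  by apply/andP; split; apply: M3 => //; rewrite /model_dim mm'.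
(* Dimensions without a model return [fset0]; the filter on [M] removes it unless it is a model. *)
pose mD D : {fset L} := xget fset0 [set m | M m /\ #|` m| = D].
exists [seq m <- [seq mD D | D <- iota 0 n.+1] | `[<M m>]]; split.
- by rewrite size_filter (leq_trans (count_size _ _))// size_map size_iota.
- by move=> m; rewrite mem_filter => /andP[/asboolP].
- move=> m Mm; rewrite mem_filter; apply/andP; split; first exact/asboolP.
  apply/mapP; exists #|` m|.
    by rewrite mem_iota add0n leq0n ltnS; have /andP[] := M1 m Mm.
  have [MD cD] : M (mD #|` m|) /\ #|` mD #|` m| | = #|` m|.
    by rewrite /mD; apply: (@xgetPex _ fset0 [set m' | M m' /\ _]); exists m.
  exact: inj.
Qed.

(** * Accuracy parameter and small samples *)

Section log_root.
Context (R : realType).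

(** The inverse is the accuracy [eta]. With a fourth root, [del = eta ^+ 2] is ell^(-1/2): it tends
    to 0, and del ell^2 still grows faster than ell. *)
Definition log_root (n : nat) : R := Num.sqrt (Num.sqrt (ln n%:R)).

Lemma log_root4 n : (0 < n)%N -> log_root n ^+ 4 = ln n%:R.
Proof.
move=> n0; rewrite (exprM _ 2 2) !sqr_sqrtr ?sqrtr_ge0// ln_ge0//.
by rewrite ler1n.
Qed.

Lemma log_root_ge0 n : 0 <= log_root n. Proof. exact: sqrtr_ge0. Qed.

Lemma log_root_ge (A : R) n : (0 < n)%N -> 0 <= A ->
  (A <= log_root n) = (expR (A ^+ 4) <= n%:R).
Proof.
move=> n0 A0; have n0' : (n%:R : R) \is Num.pos by rewrite posrE ltr0n.
rewrite -[n%:R in RHS](lnK n0') ler_expR -log_root4//.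
by rewrite ler_pXn2r// nnegrE log_root_ge0.
Qed.

Lemma cvg_log_root_inv (a : R) : (fun n => a * (log_root n)^-1) @ \oo --> (0 : R).
Proof.
rewrite -[X in _ --> X](mulr0 a); apply: cvgMr.
apply/cvgrPdist_lt => e e0; near=> n.
have n0 : (0 < n)%N by near: n; exact: nbhs_infty_gt.
have e1 : 0 < 2 / e by rewrite divr_gt0.
have re : 2 / e <= log_root n.
  rewrite log_root_ge//; last exact: ltW.
  near: n; exact: nbhs_infty_ger.
have r0 : 0 < log_root n by exact: lt_le_trans re.
rewrite sub0r normrN gtr0_norm ?invr_gt0//.
rewrite -[e]invrK ltf_pV2 ?posrE ?invr_gt0//; apply: lt_le_trans re.
by rewrite ltr_pMl ?invr_gt0// ltr1n.
Unshelve. all: by end_near. Qed.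

End log_root.

Section small_sample.
Context (R : realType) (theta kappa A : R).
Hypothesis theta_gt2 : 2 < theta.
Hypothesis kappa_gt2 : 2 < kappa.

(** For the sample sizes below the threshold, [n] is at most [expR (A ^+ 4)] and [ln n] is at least
    [ln 2]; with this constant the claimed bound is at least 1 there. *)
Definition small_sample_constant : R :=
  expR (A ^+ 4 * (theta / 2)) / ln 2 `^ ((theta + 2) * kappa).

Lemma small_sample_constant_gt0 : 0 < small_sample_constant.
Proof. by rewrite divr_gt0 ?expR_gt0// powR_gt0// ln_gt0// ltr1n. Qed.

Lemma small_sample_rate n : (2 <= n)%N -> 0 <= A -> log_root R n < A ->
  1 <= small_sample_constant * deviation_rate theta kappa n.
Proof.
move=> n2 A0 rA; have n0 : (0 < n)%N by exact: ltn_trans n2.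
have nA : n%:R <= expR (A ^+ 4).
  by apply: ltW; rewrite ltNge -log_root_ge// -ltNge.
have l2 : 0 < ln 2 :> R by rewrite ln_gt0// ltr1n.
have th : 0 <= theta / 2 by have := theta_gt2; lra.
have tk : 0 <= (theta + 2) * kappa.
  by apply: mulr_ge0; have := theta_gt2; have := kappa_gt2; lra.
rewrite /deviation_rate mulrACA [_^-1 * _]mulrC mulrACA.
apply: mulr_ege1.
- rewrite ler_pdivlMr ?powR_gt0 ?ltr0n// mul1r expRM.
  by rewrite ge0_ler_powR ?nnegrE ?expR_ge0.
- rewrite ler_pdivlMr ?powR_gt0// mul1r ge0_ler_powR ?nnegrE ?ln_ge0 ?ler1n//.
  by rewrite ler_ln ?posrE ?ltr0n// ler_nat.
Qed.

End small_sample.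

Section large_sample.
Context (R : realType) (d : measure_display) (Om : measurableType d)
  (P : probability Om R) (X : int -> {RV P >-> R}) (theta : R) (s : R -> R).
Local Notation mu := (@lebesgue_measure R).
Hypothesis X_stationary : strictly_stationary X.
Hypothesis theta_gt2 : 2 < theta.
Hypothesis X_mixing : arithmetically_beta_mixing X theta.
Hypothesis s_ge0 : forall x, 0 <= s x.
Hypothesis s_L2 : s \in Lfun mu 2%:E.
Hypothesis s_density : forall A : set R, measurable A ->
  distribution P (X 0) A = (\int[mu]_(x in A) (s x)%:E)%E.
Context (L : choiceType) (psi : L -> R -> R) (Phi K kappa C0 : R)
  (n : nat) (M : set {fset L}) (mhat : Om -> {fset L}) (stilde : Om -> R -> R).
Hypothesis psi_on : orthonormal_system psi.
Hypothesis n_ge2 : (2 <= n)%N.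
Hypothesis M_nonempty : M !=set0.
Hypothesis M1 : assumption_M1 n M.
Hypothesis M2 : assumption_M2 psi Phi M.
Hypothesis M3 : assumption_M3 M.
Hypothesis K_gt4 : 4 < K.
Hypothesis kappa_gt2 : 2 < kappa.
Let pen := penalty (L := L) K Phi (kappa1 X) n.
Hypothesis stilde_pls : forall w, is_pen_ls_estimator psi M pen
  (fun i => X i w) n (mhat w) (stilde w).
Let Cv := weak_constant `|Phi| ((1 + dotL2 s s) / 2).
Let r := log_root R n.
Let ell := ln n%:R : R.
Hypothesis C0_ge : 2 * (3 * 900 + 900 ^+ 2) <= C0.
Hypothesis r_ge : radius_threshold theta kappa Cv C0 <= r.

Let n0 : (0 < n)%N. Proof. exact: ltn_trans n_ge2. Qed.
Let n0' : 0 < n%:R :> R. Proof. by rewrite ltr0n. Qed.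
Let rE : r ^+ 4 = ell. Proof. exact: log_root4. Qed.

Let C0_ge1 : 1 <= C0.
Proof. by apply: le_trans C0_ge; lra. Qed.

Let Cv_ge0 : 0 <= Cv.
Proof.
apply: weak_constant_ge0 => //; rewrite divr_ge0// addr_ge0//.
by apply: Rintegral_ge0 => x _; rewrite -expr2 sqr_ge0.
Qed.

Let large := radius_large theta_gt2 kappa_gt2 Cv_ge0 C0_ge1 r_ge.

Let r_gt0 : 0 < r.
Proof. by apply: lt_le_trans large.1; rewrite ltr0n. Qed.

Let ell_ge1 : 1 <= ell.
Proof. exact: (log_ge1 theta_gt2 kappa_gt2 Cv_ge0 C0_ge1 rE r_ge). Qed.

Let Phi_neq0 : Phi != 0.
Proof.
have [m Mm] := M_nonempty; apply: (M2_constant_neq0 psi_on M2 Mm).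
by have /andP[m2 _] := M1 Mm; exact: leq_trans m2.
Qed.

Let pen_ge m : 4 * (Phi ^+ 2 / n%:R * #|` m|%:R) <= pen m.
Proof.
have Kk : 4 <= K * kappa1 X.
  rewrite -[4]mulr1; apply: ler_pM => //; first exact: ltW.
  exact: kappa1_ge1 theta_gt2 X_mixing.
have -> : pen m = K * kappa1 X * (Phi ^+ 2 / n%:R * #|` m|%:R).
  by rewrite /pen /penalty /model_dim; field; rewrite gt_eqF.
by apply: ler_wpM2r => //; rewrite mulr_ge0// divr_ge0 ?sqr_ge0.
Qed.

Let eta_small : 1000 * r^-1 <= 1.
Proof. by rewrite ler_pdivrMr// mul1r; exact: large.1. Qed.

Let del_le : r^-1 ^+ 2 <= 2^-1.
Proof.
have r2 : r <= r ^+ 2.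
  by rewrite ler_eXnr//; apply: le_trans large.1; rewrite ler1n.
rewrite exprVn lef_pV2 ?posrE ?exprn_gt0//; apply: le_trans r2.
by apply: le_trans large.1; rewrite ler_nat.
Qed.

Let Cv_le : Cv <= r^-1 ^+ 2 * ell ^+ 4.
Proof.
have -> : r^-1 ^+ 2 * ell ^+ 4 = r ^+ 14.
  by rewrite -rE; field; rewrite gt_eqF.
apply: (@le_trans _ _ r); last first.
  by rewrite ler_eXnr//; apply: le_trans large.1; rewrite ler1n.
apply: le_trans r_ge; rewrite /radius_threshold.
apply: (@le_trans _ _ (1 * (1000 + Cv + theta + 8 * kappa))).
  by have := theta_gt2; have := kappa_gt2; lra.
apply: ler_wpM2r; last exact: C0_ge1.
by have := theta_gt2; have := kappa_gt2; have := Cv_ge0; lra.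
Qed.

Let strong_le (p D L1 e nn : R) : 0 <= p / nn * D ->
  (961 / 900 * (11 / 6 * (p * D)) + 47 * e * (4 * p * (D + L1))) / nn <=
  49 / 25 * (p / nn * D) + 188 * e * (p / nn * (D + L1)).
Proof.
move=> y0; have -> : (961 / 900 * (11 / 6 * (p * D)) + 47 * e * (4 * p * (D + L1))) / nn =
  (961 / 900 * (11 / 6)) * (p / nn * D) + 188 * e * (p / nn * (D + L1)) by ring.
by rewrite lerD2r ler_wpM2r//; lra.
Qed.

Let quadratic_le (x y : R) : 0 <= x -> x <= y + 1 -> 2 <= y ->
  2 * (x + x * x) <= 12 * y ^+ 2.
Proof.
move=> x0 xy y2; have x2 : x <= 2 * y by lra.
have xx : x * x <= 2 * y * (2 * y) by apply: ler_pM.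
have yy : 2 * y <= y * y by apply: ler_wpM2r => //; lra.
by rewrite expr2; lra.
Qed.

(** The 9 is 1 for the exponential tails plus 4 * 2 for the four applications of mixing. *)
Let bad_rate (N : nat) : (N <= n.+1)%N ->
  2 * (N%:R + (N * N)%:R) * tail_bound s Phi ell (r^-1 ^+ 2) C0 +
  4 * ((n_blocks n (gap kappa ell))%:R * mixing_rate theta (gap kappa ell)) <=
  9 * deviation_rate theta kappa n.
Proof.
move=> Nn.
have H1 := tail_bound_rate theta_gt2 kappa_gt2 Cv_ge0 C0_ge1 n0 erefl rE r_ge.
have H2 := n_blocks_mixing_rate theta_gt2 kappa_gt2 Cv_ge0 C0_ge1 n0 erefl rE r_ge.
have H3 : 2 * (N%:R + (N * N)%:R) <= 12 * n%:R ^+ 2 :> R.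
  rewrite natrM; apply: quadratic_le => //.
    by apply: (@le_trans _ _ n.+1%:R); [rewrite ler_nat|rewrite -natr1].
  by rewrite (ler_nat _ 2).
have H4 : 2 * (N%:R + (N * N)%:R) * tail_bound s Phi ell (r^-1 ^+ 2) C0 <=
    12 * n%:R ^+ 2 * expR (- (r^-1 ^+ 2 * ell ^+ 2 / C0) + (Cv + 1)).
  by apply: ler_wpM2r; [exact: expR_ge0|exact: H3].
move: H1 H2 H4; rewrite -/ell; lra.
Qed.

Lemma large_sample_bound : exists Bad : set Om, [/\ measurable Bad,
  (P Bad <= (9 * deviation_rate theta kappa n)%:E)%E &
  forall w, ~ Bad w ->
    (Lpnorm 2%:E (stilde w \- s)%R ^+ 2 <= (1 + 20 * r^-1)%:E *
       oracle_risk psi M pen s (ell ^+ 16))%E].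
Proof.
have [ms [size_ms msM Mms]] := model_enumeration M1 M3.
have h0 : (0 < gap kappa ell)%N.
  exact: (gap_gt0 theta_gt2 kappa_gt2 Cv_ge0 C0_ge1 rE r_ge).
have hs := gap_small theta_gt2 kappa_gt2 Cv_ge0 C0_ge1 n0 erefl rE r_ge.
have hd := gap_le_eta theta_gt2 kappa_gt2 Cv_ge0 C0_ge1 n0 erefl rE r_ge.
have d0 : 0 < r^-1 ^+ 2 by rewrite exprn_gt0// invr_gt0.
have [Bad [mBad PBad errB crossB]] := good_event X_stationary theta_gt2 X_mixing
  s_ge0 s_L2 s_density psi_on Phi_neq0 M2 msM n0 h0 ell_ge1 d0 del_le Cv_le hd hs C0_ge.
exists Bad; split => //.
  by apply: le_trans PBad _; rewrite lee_fin; exact: bad_rate.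
move=> w nBad; have [Mmh crit ->] := pls_estimator psi_on s_L2 (stilde_pls w).
set c := fun l => dotL2 (psi l) s.
set nu := fun l => empirical_coef psi (fun i => X i w) n l - c l.
have nuE l : empirical_error X s psi n w l = nu l by [].
have eps0 : 0 < 1 + 20 * r^-1 by rewrite ltr_pwDl// mulr_ge0// invr_ge0 ltW.
(* The factor is divided out so that the infimum can be treated model by model; an infimum over no
   model is covered as well. *)
rewrite -lee_pdivrMl//; apply: le_ereal_inf_tmp => _ [m [sm [Mm Dm smP ->]]].
rewrite (oracle_bias psi_on s_L2 smP) -EFinD -EFinM lee_fin ler_pdivrMl//.
have sumE (a : {fset L}) :
    \sum_(l <- a) empirical_coef psi (fun i => X i w) n l ^+ 2 =
    \sum_(l <- a) (c l + nu l) ^+ 2.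
  by apply: eq_bigr => l _; congr (_ ^+ 2); rewrite /nu; ring.
have L0 : 0 <= ell ^+ 16 by rewrite exprn_ge0// (le_trans _ ell_ge1).
have F0 : 0 <= Phi ^+ 2 / n%:R by rewrite divr_ge0 ?sqr_ge0.
have e0 : 0 < r^-1 by rewrite invr_gt0.
have crossE (D : R) : 8 * r^-1 ^+ 2 * (4 * Phi ^+ 2 * (D + ell ^+ 16)) / n%:R =
    32 * r^-1 ^+ 2 * (Phi ^+ 2 / n%:R * (D + ell ^+ 16)) by ring.
apply: (oracle_models _ (sum_coef_le psi_on s_L2 m) (sum_coef_le psi_on s_L2 (mhat w))
  e0 eta_small F0 L0 Dm (pen_ge m) (pen_ge (mhat w))).
- by have [le|/ltnW le] := leqP #|` m| #|` mhat w|; [left|right]; exact: M3.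
- by rewrite -!sumE; exact: crit.
- have := errB w nBad _ (Mms _ Mmh); move=> /le_trans; apply.
  by apply: strong_le; rewrite mulr_ge0.
- rewrite -crossE; exact: (crossB w nBad _ _ (Mms _ Mm) (Mms _ Mmh)).
- rewrite -crossE; exact: (crossB w nBad _ _ (Mms _ Mmh) (Mms _ Mm)).
Qed.

End large_sample.

(* The selection (mhat, stilde) need not be measurable, hence the outer
   measure P^* in the conclusion; it equals P on measurable events. *)
Theorem theorem3p1 (R : realType) (d : measure_display)
    (Om : measurableType d) (P : probability Om R)
    (X : int -> {RV P >-> R}) (theta : R) (s : R -> R)
    (L : choiceType) (psi : L -> R -> R) (M : nat -> set {fset L})
    (Phi K : R) (mhat : nat -> Om -> {fset L})
    (stilde : nat -> Om -> R -> R)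
    (X_stationary : strictly_stationary X)
    (theta_gt2 : 2 < theta)
    (X_mixing : arithmetically_beta_mixing X theta)
    (s_ge0 : forall x, 0 <= s x)
    (s_L2 : s \in Lfun (@lebesgue_measure R) 2%:E)
    (s_supp : forall x, ~ (0 <= x <= 1) -> s x = 0)
    (s_density : forall A : set R, measurable A ->
      distribution P (X 0) A = (\int[lebesgue_measure]_(x in A) (s x)%:E)%E)
    (psi_orthonormal : orthonormal_system psi)
    (M_nonempty : forall n, (2 <= n)%N -> M n !=set0)
    (HM1 : forall n, (2 <= n)%N -> assumption_M1 n (M n))
    (HM2 : forall n, (2 <= n)%N -> assumption_M2 psi Phi (M n))
    (HM3 : forall n, (2 <= n)%N -> assumption_M3 (M n))
    (K_gt4 : 4 < K)
    (stilde_pls : forall n, (2 <= n)%N -> forall w : Om,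
      is_pen_ls_estimator psi (M n) (penalty K Phi (kappa1 X) n)
        (fun i => X i w) n (mhat n w) (stilde n w)) :
  forall kappa : R, 2 < kappa ->
  exists c0 Ls gamma1 : R, exists eps : nat -> R,
    [/\ 0 < c0, 0 < Ls, 0 < gamma1,
        eps @ \oo --> (0 : R) &
        forall n : nat, (2 <= n)%N ->
          (mu_ext P [set w : Om |
             (1 + eps n)%:E *
               oracle_risk psi (M n) (penalty K Phi (kappa1 X) n) s
                 (c0 * ln n%:R `^ gamma1)
             < Lpnorm 2%:E (stilde n w \- s)%R ^+ 2]
           <= (Ls * (ln n%:R `^ ((theta + 2) * kappa) / n%:R `^ (theta / 2)))%:E)%E].
Proof.
move=> kappa kappa_gt2.
have [C0 C0_ge] : exists C0 : R, 2 * (3 * 900 + 900 ^+ 2) <= C0.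
  by eexists; exact: lexx.
pose Cv := weak_constant `|Phi| ((1 + dotL2 s s) / 2).
pose A := Num.max 0 (radius_threshold theta kappa Cv C0).
have A0 : 0 <= A by rewrite le_max lexx.
have Cs0 := small_sample_constant_gt0 theta kappa A.
(* [gamma1 = 16] is the exponent imposed by the weak variance, and [20 * r^-1] is the loss in the
   oracle inequality; the second term of [Ls] serves small samples only. *)
exists 1, (9 + small_sample_constant theta kappa A), 16,
  (fun n => 20 * (log_root R n)^-1).
split => //; [by rewrite addr_gt0|exact: cvg_log_root_inv|move=> n n2].
rewrite -/(deviation_rate theta kappa n) mul1r.
have rate0 : 0 <= deviation_rate theta kappa n.
  by rewrite divr_ge0 ?powR_ge0.
(* Below the threshold the outer probability is bounded by 1. *)
have [rA|rA] := ltP (log_root R n) A.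
  apply: (@le_trans _ _ 1%E).
    rewrite -(probability_setT P) -(measurable_mu_extE P measurableT).
    exact: le_mu_ext.
  rewrite lee_fin mulrDl.
  apply: le_trans (small_sample_rate theta_gt2 kappa_gt2 n2 A0 rA) _.
  by rewrite lerDr mulr_ge0.
have r_ge : radius_threshold theta kappa Cv C0 <= log_root R n.
  by apply: le_trans rA; rewrite le_max lexx orbT.
have [Bad [mBad PBad BadP]] := large_sample_bound X_stationary theta_gt2 X_mixing
  s_ge0 s_L2 s_density psi_orthonormal n2 (M_nonempty n n2) (HM1 n n2) (HM2 n n2)
  (HM3 n n2) K_gt4 kappa_gt2 (stilde_pls n n2) C0_ge r_ge.
apply: (@le_trans _ _ (mu_ext P Bad)).
  apply: le_mu_ext => w /= lt; apply: contrapT => nBad.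
  have := BadP w nBad; rewrite leNgt => /negP; apply.
  by rewrite -(@powR_mulrn _ (ln n%:R) 16)// ln_ge0// ler1n (ltn_trans _ n2).
rewrite measurable_mu_extE//; apply: le_trans PBad _.
by rewrite lee_fin ler_wpM2r// lerDl ltW.
Qed.
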